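(* Let $-A$ be the generator of a bounded $C_0$-semigroup on a Hilbert space $H$ such that $0\in\varrho(A)$. Then, for all $\alpha>0$, $$\sup_{t\ge0}\|e^{-tA^{-1}}A^{-\alpha}\|<\infty.$$
   Context: Hilbert spaces are complex. $\varrho(A)$ is the resolvent set of $A$, so $0\in\varrho(A)$ means that $A$ has a bounded inverse. A $C_0$-semigroup $(e^{-tA})_{t\ge0}$ is bounded if $\sup_{t\ge0}\|e^{-tA}\|<\infty$. $A^{-\alpha}$ denotes the (bounded) fractional power of $A$ (via the sectorial functional calculus), and $e^{-tA^{-1}}$ is the exponential of the bounded operator $-tA^{-1}$. *)

(* Defs.v *)
From Stdlib Require Export Reals.
From Stdlib Require Import Factorial ClassicalEpsilon.
From Coquelicot Require Export Coquelicot.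
Open Scope R_scope.

(** * Complex Hilbert spaces

    The inner product is linear in its first argument; [inner_norm] makes it
    positive definite and says that it induces the norm of the space. *)

Record HilbertSpace := {
  hilbert_sort :> CompleteNormedModule C_AbsRing;
  inner : hilbert_sort -> hilbert_sort -> C;
  inner_plus_l : forall x y z,
    inner (plus x y) z = Cplus (inner x z) (inner y z);
  inner_scal_l : forall (a : C) x y,
    inner (scal a x) y = Cmult a (inner x y);
  inner_conj : forall x y, inner y x = Cconj (inner x y);
  inner_norm : forall x, inner x x = RtoC (norm x ^ 2)
}.

(** * Restriction of scalars from [C] to [R]

    [RInt] and [RInt_gen] integrate functions with values in a complete normed
    module over [R].  The group, the uniform structure and the norm are those
    of the original space. *)

Section Restriction.
Variable V : CompleteNormedModule C_AbsRing.

Definition restr_scal (a : R) (x : V) : V := scal (RtoC a) x.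

Lemma restr_scal_assoc (a b : R) (x : V) :
  restr_scal a (restr_scal b x) = restr_scal (mult a b) x.
Proof.
  unfold restr_scal; rewrite scal_assoc; f_equal.
  symmetry; apply RtoC_mult.
Qed.

Lemma restr_scal_one (x : V) : restr_scal one x = x.
Proof. exact (scal_one x). Qed.

Lemma restr_scal_distr_l (a : R) (x y : V) :
  restr_scal a (plus x y) = plus (restr_scal a x) (restr_scal a y).
Proof. exact (scal_distr_l (RtoC a) x y). Qed.

Lemma restr_scal_distr_r (a b : R) (x : V) :
  restr_scal (plus a b) x = plus (restr_scal a x) (restr_scal b x).
Proof.
  unfold restr_scal.
  transitivity (scal (plus (RtoC a) (RtoC b)) x).
  - f_equal; apply RtoC_plus.
  - exact (@scal_distr_r C_Ring V (RtoC a) (RtoC b) x).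
Qed.

Lemma restr_norm_scal (a : R) (x : V) :
  norm (restr_scal a x) <= abs a * norm x.
Proof.
  apply Rle_trans with (1 := norm_scal (RtoC a) x).
  apply Req_le, (f_equal (fun r => r * norm x)), Cmod_R.
Qed.

Definition restr_ModuleSpace_mixin :=
  ModuleSpace.Mixin R_AbsRing V restr_scal restr_scal_assoc restr_scal_one
    restr_scal_distr_l restr_scal_distr_r.

Definition restr_ModuleSpace : ModuleSpace R_AbsRing :=
  ModuleSpace.Pack R_AbsRing V
    (ModuleSpace.Class R_AbsRing V (AbelianGroup.class V)
       restr_ModuleSpace_mixin) V.

Definition restr_NormedModuleAux : NormedModuleAux R_AbsRing :=
  NormedModuleAux.Pack R_AbsRing V
    (NormedModuleAux.Class R_AbsRing V (ModuleSpace.class _ restr_ModuleSpace)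
       (UniformSpace.class V)) V.

Lemma restr_norm_ball (x y : V) (eps : posreal) :
  ball x eps y -> norm (minus y x) < @norm_factor C_AbsRing V * eps.
Proof. exact (@norm_compat2 C_AbsRing V x y eps). Qed.

Lemma restr_norm_eq_zero (x : V) : norm x = 0 -> x = zero.
Proof. exact (@norm_eq_zero C_AbsRing V x). Qed.

Definition restr_NormedModule_mixin :=
  NormedModule.Mixin R_AbsRing restr_NormedModuleAux
    (@norm C_AbsRing V) (@norm_factor C_AbsRing V)
    (@norm_triangle C_AbsRing V) restr_norm_scal
    (@norm_compat1 C_AbsRing V) restr_norm_ball restr_norm_eq_zero.

Definition restr_NormedModule : NormedModule R_AbsRing :=
  NormedModule.Pack R_AbsRing V
    (NormedModule.Class R_AbsRing V
       (NormedModuleAux.class _ restr_NormedModuleAux)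
       restr_NormedModule_mixin) V.

Definition restr_R : CompleteNormedModule R_AbsRing :=
  CompleteNormedModule.Pack R_AbsRing V
    (CompleteNormedModule.Class R_AbsRing V
       (NormedModule.class _ restr_NormedModule)
       (CompleteSpace.mixin V (CompleteSpace.class V))) V.

End Restriction.

(** * Argument and principal powers of complex numbers *)

(** The principal argument of [z <> 0], in the interval (-PI, PI]. *)
Definition Carg (z : C) : R :=
  if Rle_dec 0 (Im z) then acos (Re z / Cmod z) else - acos (Re z / Cmod z).

Definition Cis (theta : R) : C := (cos theta, sin theta).

(** The principal branch of [z ^ s] for real [s] and [z <> 0]. *)
Definition Cpower (z : C) (s : R) : C :=
  Cmult (RtoC (Rpower (Cmod z) s)) (Cis (s * Carg z)).

(** * Unbounded operators *)

(** The values of [op_act] outside of [op_dom] are irrelevant. *)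
Record operator (H : HilbertSpace) := {
  op_dom : H -> Prop;
  op_act :> H -> H;
  op_dom_zero : op_dom zero;
  op_dom_plus : forall x y, op_dom x -> op_dom y -> op_dom (plus x y);
  op_dom_scal : forall (a : C) x, op_dom x -> op_dom (scal a x);
  op_act_plus : forall x y, op_dom x -> op_dom y ->
    op_act (plus x y) = plus (op_act x) (op_act y);
  op_act_scal : forall (a : C) x, op_dom x ->
    op_act (scal a x) = scal a (op_act x)
}.
Arguments op_dom {H} o _.
Arguments op_act {H} o _.

Program Definition op_opp {H : HilbertSpace} (A : operator H) : operator H :=
  {| op_dom := op_dom A; op_act := fun x => opp (A x) |}.
Next Obligation. intros; apply op_dom_zero. Qed.
Next Obligation. intros; now apply op_dom_plus. Qed.
Next Obligation. intros; now apply op_dom_scal. Qed.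
Next Obligation. intros; simpl; rewrite op_act_plus by easy; exact (@opp_plus H (A x) (A y)). Qed.
Next Obligation.
  intros; simpl; rewrite op_act_scal by easy; symmetry; exact (@scal_opp_r C_Ring H a (A x)).
Qed.

Section Operators.
Context {H : HilbertSpace}.

(** [is_linear] includes boundedness. *)
Definition resolvent_set (A : operator H) (z : C) : Prop :=
  exists S : H -> H, is_linear S /\
    (forall y, op_dom A (S y) /\ minus (scal z (S y)) (A (S y)) = y) /\
    (forall x, op_dom A x -> S (minus (scal z x) (A x)) = x).

(** The resolvent (z - A)^{-1}, meaningful for [z] in the resolvent set. *)
Definition resolvent (A : operator H) (z : C) (y : H) : H :=
  iota (fun x : H => op_dom A x /\ minus (scal z x) (A x) = y).

(** A^{-1}, meaningful for 0 in the resolvent set. *)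
Definition op_inv (A : operator H) (y : H) : H :=
  iota (fun x : H => op_dom A x /\ A x = y).

(** The exponential of a bounded operator. *)
Definition op_exp (B : H -> H) (x : H) : H :=
  iota (is_series (fun n => scal (RtoC (/ INR (fact n))) (Nat.iter n B x))).

(** The supremum over t >= 0 of the operator norms of [T t] is finite. *)
Definition bounded_family (T : R -> H -> H) : Prop :=
  exists M : R, forall t, 0 <= t -> forall x, norm (T t x) <= M * norm x.

(** Only the values [T t] with 0 <= t matter. *)
Record C0_semigroup (T : R -> H -> H) : Prop := {
  sg_linear : forall t, 0 <= t -> is_linear (T t);
  sg_zero : forall x, T 0 x = x;
  sg_plus : forall s t x, 0 <= s -> 0 <= t -> T (s + t) x = T s (T t x);
  sg_cont : forall x, filterlim (fun t => T t x) (at_right 0) (locally x)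
}.

Definition is_generator (T : R -> H -> H) (G : operator H) : Prop :=
  forall x y : H,
    (op_dom G x /\ G x = y) <->
    filterlim (fun h => scal (RtoC (/ h)) (minus (T h x) x))
      (at_right 0) (locally y).

(** * Functional calculus of invertible sectorial operators *)

(** Sectoriality of angle [omega]: the spectrum lies in the closure of the
    sector |arg z| < omega and [z (z - A)^{-1}] is uniformly bounded outside of
    every larger sector. *)
Definition sectorial (A : operator H) (omega : R) : Prop :=
  0 <= omega < PI /\
  (forall z : C, z <> RtoC 0 -> omega < Rabs (Carg z) -> resolvent_set A z) /\
  (forall omega', omega < omega' < PI ->
     exists M : R, forall z : C, z <> RtoC 0 -> omega' < Rabs (Carg z) ->
       forall x, norm (scal z (resolvent A z x)) <= M * norm x).

(** The spectrum of [A] lies inside the region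
    {z | |arg z| < phi, |z| > delta}, and [A] is sectorial of an angle smaller
    than [phi]. *)
Definition admissible (A : operator H) (phi delta : R) : Prop :=
  (exists omega, sectorial A omega /\ omega < phi < PI) /\
  0 < delta /\ (forall z : C, Cmod z <= delta -> resolvent_set A z).

(** [1 / (2 i PI)] times the integral of [f z * (z - A)^{-1} x dz] along the
    positively oriented boundary of {z | |arg z| < phi, |z| > delta}: inwards
    along the ray of argument [phi], clockwise along the circle of radius
    [delta], outwards along the ray of argument [- phi]. *)
Definition contour_calculus (A : operator H) (phi delta : R) (f : C -> C)
  (x : H) : H :=
  let F (z dz : C) : restr_R H :=
    scal (Cmult (f z) dz) (resolvent A z x) in
  let ray (theta : R) : H :=
    RInt_gen (fun r => F (Cmult (RtoC r) (Cis theta)) (Cis theta))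
      (at_point delta) (Rbar_locally p_infty) in
  let arc : H :=
    RInt (fun theta => F (Cmult (RtoC delta) (Cis theta))
                         (Cmult Ci (Cmult (RtoC delta) (Cis theta))))
      phi (- phi) in
  scal (Cinv (Cmult (RtoC (2 * PI)) Ci))
    (plus (plus (opp (ray phi)) arc) (ray (- phi))).

(** By Cauchy's theorem the value at functions that are holomorphic on the
    slit plane and decay polynomially at infinity does not depend on the
    admissible contour. *)
Definition sectorial_calculus (A : operator H) (f : C -> C) : H -> H :=
  let c := epsilon (inhabits (0, 0))
             (fun p : R * R => admissible A (fst p) (snd p)) in
  contour_calculus A (fst c) (snd c) f.

(** The fractional power A^{- alpha} for [alpha > 0]. *)
Definition neg_power (A : operator H) (alpha : R) : H -> H :=
  sectorial_calculus A (fun z => Cpower z (- alpha)).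

End Operators.

(* Main.v *)
From Stdlib Require Import ssreflect Lra Lia Psatz ClassicalEpsilon Classical Factorial FunctionalExtensionality.
Require Import Defs.

(** Write [B_xi = (A + xi)^-1], and let [M] bound the semigroup.  The Euler scheme
    [(1 - t B_0 / N)^N] tends to [exp (- t A^-1)] and is estimated uniformly in [N];
    the estimates below are written for the exponential.

    On a Hilbert space, averaging [norm (T_s x) ^ 2] against [2 xi exp (- 2 xi s) ds]
    gives a quadratic form [P <= M^2] with [2 Re <P (A + xi) x, x> = 2 xi norm x ^ 2].
    Used as a Lyapunov function along [y' = - B_xi y] it yields the square function
    estimate that the integral over [s >= 0] of [norm (B_xi exp (- s B_xi) x) ^ 2] is
    at most [M^2 norm x ^ 2 / (2 xi)], and likewise for the adjoints.  Duhamel's formula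
    and the Cauchy-Schwarz inequality then give
    [norm (exp (- t B_xi) - exp (- t B_eta)) <= c |xi - eta| / sqrt (xi eta)] and
    [norm (B_xi^2 exp (- t B_xi)) <= c / (xi t)].  Interpolating between the two and
    telescoping over [xi, 2 xi, 4 xi, ...] gives
    [norm (B_xi exp (- t B_xi)) <= c / sqrt (xi t)].

    For [s >= 1] the norm of [exp (- t B_0) B_s] is estimated through dyadic [xi]:
    between [0] and [1 / t] the exponential changes by a bounded factor, because [A] is
    invertible; each of the [O (1 + ln s)] doublings from [1 / t] to [s^2 / t] costs
    [c / s]; and at [s^2 / t] the last estimate gives [c / s].  Hence
    [norm (exp (- t A^-1) (A + s)^-1) <= c (1 + ln s) / s], uniformly in [t], and with
    [s = 1 + |z|] this makes the contour integral of [A^-alpha] converge after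
    application of [exp (- t A^-1)], uniformly in [t]. *)

(** * Hilbert space preliminaries *)

(** The Hilbert space structure enters twice: a quadratic form can act as a Lyapunov function, and
    adjoints give the square function estimate a dual, so that a Duhamel sum is bounded by a product
    of two square functions. For both it is enough to use the real form [ip].

    Time is discrete throughout. The integral defining [P] is replaced by a geometric sum of
    [norm (V^n x) ^ 2] with [V = lam (A + lam)^-1], and the errors of order [1 / lam] disappear as
    [lam] grows. Thus only resolvents and their adjoints are manipulated; the semigroup serves to
    show that [A] is dissipative in an equivalent norm, from which the resolvent bounds and,
    starting from [0], the whole left half-plane follow by Neumann series.

    The price of the explicit scheme is the step condition [16 M^2 h <= xi], which excludes
    [xi = 0]. For this reason the estimates stop at some [xi] of size [1 / t], and the last passage
    to [0] uses a resolvent bound [beta] that is uniform down to [0].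

    The logarithm costs nothing in the end: half of the decay of [z^-alpha] absorbs it and the other
    half makes the integral converge. *)

Section RealInnerProduct.
Context {H : HilbertSpace}.
Implicit Types x y z : H.

Lemma inner_plus_r x y z : inner H x (plus y z) = Cplus (inner H x y) (inner H x z).
Proof.
rewrite (inner_conj H (plus y z)) inner_plus_l (inner_conj H x y) (inner_conj H x z).
by apply injective_projections => /=; ring.
Qed.

Lemma inner_scal_r (a : C) x y : inner H x (scal a y) = Cmult (Cconj a) (inner H x y).
Proof.
rewrite (inner_conj H (scal a y)) inner_scal_l (inner_conj H x y).
by apply injective_projections => /=; ring.
Qed.

Definition rscal (r : R) x : H := scal (RtoC r) x.

Definition ip x y : R := Re (inner H x y).

Lemma ip_sym x y : ip x y = ip y x.
Proof. by rewrite /ip (inner_conj H x y). Qed.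

Lemma ip_plus_l x y z : ip (plus x y) z = ip x z + ip y z.
Proof. by rewrite /ip inner_plus_l. Qed.

Lemma ip_plus_r x y z : ip x (plus y z) = ip x y + ip x z.
Proof. by rewrite /ip inner_plus_r. Qed.

Lemma ip_rscal_l r x y : ip (rscal r x) y = r * ip x y.
Proof. rewrite /ip /rscal inner_scal_l; case: (inner H x y) => a b; rewrite /Re /=; ring. Qed.

Lemma ip_rscal_r r x y : ip x (rscal r y) = r * ip x y.
Proof. by rewrite ip_sym ip_rscal_l ip_sym. Qed.

Lemma opp_rscal x : opp x = rscal (-1) x.
Proof.
rewrite -(scal_opp_one (K := C_Ring) x) /rscal; congr (scal _ x).
by apply injective_projections => /=; ring.
Qed.

Lemma ip_opp_l x y : ip (opp x) y = - ip x y.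
Proof. rewrite opp_rscal ip_rscal_l; ring. Qed.

Lemma ip_opp_r x y : ip x (opp y) = - ip x y.
Proof. by rewrite ip_sym ip_opp_l ip_sym. Qed.

Lemma ip_minus_l x y z : ip (minus x y) z = ip x z - ip y z.
Proof. rewrite /minus ip_plus_l ip_opp_l; ring. Qed.

Lemma ip_minus_r x y z : ip x (minus y z) = ip x y - ip x z.
Proof. rewrite /minus ip_plus_r ip_opp_r; ring. Qed.

Lemma ip_zero_l y : ip zero y = 0.
Proof.
have -> : (zero : H) = rscal 0 zero by rewrite /rscal (scal_zero_r (K := C_Ring)).
rewrite ip_rscal_l; ring.
Qed.

Lemma ip_zero_r y : ip y zero = 0.
Proof. by rewrite ip_sym ip_zero_l. Qed.

Lemma ip_norm x : ip x x = norm x ^ 2.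
Proof. by rewrite /ip inner_norm. Qed.

Lemma norm_nneg x : 0 <= norm x.
Proof. exact: norm_ge_0. Qed.

Lemma ip_ext x y : (forall z, ip x z = ip y z) -> x = y.
Proof.
move=> E.
have E0 : norm (minus x y) = 0.
  apply: Rsqr_0_uniq; rewrite Rsqr_pow2 -ip_norm ip_minus_l E; ring.
have := norm_eq_zero (minus x y) E0 => E1.
by rewrite -(plus_zero_r x) -(plus_opp_l y) plus_assoc -/(minus x y) E1 plus_zero_l.
Qed.

End RealInnerProduct.

Notation "r '*r' x" := (rscal r x) (at level 40, left associativity).

(** Vector identities are tested against all inner products, which turns them into identities of real (for [cvec], complex) numbers. *)
Ltac ipsimp := rewrite ?(ip_plus_l, ip_plus_r, ip_minus_l, ip_minus_r, ip_opp_l, ip_opp_r, ip_rscal_l, ip_rscal_r, ip_zero_l, ip_zero_r).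
Ltac vec_ext := apply: ip_ext; let z := fresh "z" in intro z; ipsimp.
Ltac vec := vec_ext; ring.

Section NormEstimates.
Context {H : HilbertSpace}.
Implicit Types x y z : H.

Lemma ip_le_norm x y : ip x y <= norm x * norm y.
Proof.
have T := norm_triangle x y.
have : norm (plus x y) ^ 2 <= (norm x + norm y) ^ 2.
  by apply: pow_incr; split => //; apply: norm_nneg.
rewrite -ip_norm; ipsimp; rewrite !ip_norm (ip_sym y x); nra.
Qed.

Lemma norm_rscal r x : norm (r *r x) = Rabs r * norm x.
Proof.
have E : norm (r *r x) ^ 2 = (Rabs r * norm x) ^ 2.
  rewrite -ip_norm; ipsimp; rewrite ip_norm Rpow_mult_distr pow2_abs; ring.
have A := norm_nneg (r *r x); have B := norm_nneg x; have D := Rabs_pos r.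
by apply: Rsqr_inj => //; [apply: Rmult_le_pos|rewrite !Rsqr_pow2].
Qed.

Lemma norm_minus_sym x y : norm (minus x y) = norm (minus y x).
Proof.
have -> : minus x y = (-1) *r (minus y x) by vec.
rewrite norm_rscal Rabs_Ropp Rabs_R1; ring.
Qed.

Lemma norm_minus_le x y : norm (minus x y) <= norm x + norm y.
Proof.
have -> : minus x y = plus x ((-1) *r y) by vec.
apply: Rle_trans (norm_triangle _ _) _.
rewrite norm_rscal Rabs_Ropp Rabs_R1; lra.
Qed.

Lemma norm_sq_add_le x y : norm (plus x y) ^ 2 <= 2 * norm x ^ 2 + 2 * norm y ^ 2.
Proof.
have : 0 <= norm (minus x y) ^ 2 by apply: pow2_ge_0.
rewrite -!ip_norm; ipsimp; rewrite (ip_sym y x); lra.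
Qed.

Lemma norm_cauchy_lim (u : nat -> H) :
  (forall eps : posreal, exists N, forall n m, (N <= n)%nat -> (N <= m)%nat ->
     norm (minus (u n) (u m)) < eps) ->
  exists l, filterlim u eventually (locally l).
Proof.
move=> C; apply/(filterlim_locally_cauchy (U := H)) => eps.
have [N HN] := C eps; exists (fun n => (N <= n)%nat); split; first by exists N.
move=> n m Hn Hm; apply: (norm_compat1 (V := H)).
by rewrite norm_minus_sym; apply: HN.
Qed.

Lemma lim_norm_seq (u : nat -> H) l :
  filterlim u eventually (locally l) -> is_lim_seq (fun n => norm (u n)) (norm l).
Proof. move=> L; exact: (filterlim_comp _ _ _ u norm _ _ _ L (filterlim_norm l)). Qed.

Lemma lim_minus_seq (u : nat -> H) l :
  filterlim u eventually (locally l) -> is_lim_seq (fun n => norm (minus (u n) l)) 0.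
Proof.
move=> L; apply/is_lim_seq_spec => eps.
have := L _ (locally_le_locally_norm l _ (locally_norm_ball_norm l eps)).
case=> N HN; exists N => n Hn; rewrite Rminus_0_r Rabs_pos_eq; last exact: norm_nneg.
exact: HN.
Qed.

End NormEstimates.

(** * Riesz representation and adjoints *)

Section Riesz.
Context {H : HilbertSpace}.
Implicit Types x y z : H.

(** The functional [J x = ip x x - 2 * phi x] is bounded below. The parallelogram identity makes a
    minimizing sequence Cauchy, and the first-order condition at its limit [l] is
    [ip l v = phi v]. *)
Lemma riesz_representation (phi : H -> R) (c : R) :
  (forall x y, phi (plus x y) = phi x + phi y) ->
  (forall r x, phi (r *r x) = r * phi x) ->
  (forall x, phi x <= c * norm x) ->
  exists u, forall x, phi x = ip x u.
Proof.
move=> phiD phiZ phiB.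
pose J x := ip x x - 2 * phi x.
have Jlow x : - c ^ 2 <= J x.
  have := phiB x; rewrite /J ip_norm; have := pow2_ge_0 (norm x - c); nra.
have [d [dub dlub]] : {d | is_lub (fun r => exists x, r = - J x) d}.
  apply: completeness; last by exists (- J zero), zero.
  by exists (c ^ 2) => r [x ->]; have := Jlow x; lra.
have Jd x : - d <= J x by have := dub (- J x) (ex_intro _ x eq_refl); lra.
have near n : exists x, J x < - d + / (INR n + 1).
  apply: NNPP => N.
  have E : d <= d - / (INR n + 1).
    apply: dlub => r [x ->]; apply: Rnot_lt_le => L; apply: N; exists x; lra.
  have := RinvN_pos n; lra.
have [u Hu] := choice _ near.
have para x y : norm (minus x y) ^ 2 = 2 * J x + 2 * J y - 4 * J ((/ 2) *r (plus x y)).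
  rewrite -ip_norm /J; ipsimp; rewrite phiZ phiD; ipsimp.
  rewrite (ip_sym y x); field.
have [l Hl] : exists l, filterlim u eventually (locally l).
  apply: norm_cauchy_lim => eps.
  have e2 : 0 < eps ^ 2 / 4 by have := cond_pos eps; nra.
  have [N [HN N0]] := archimed_cor1 _ e2.
  exists N => n m Hn Hm.
  have small k : (N <= k)%nat -> / (INR k + 1) < eps ^ 2 / 4.
    move=> Hk; apply: Rle_lt_trans _ (HN).
    have Npos : 0 < INR N by apply: lt_0_INR.
    by apply: Rinv_le_contravar => //; have := le_INR _ _ Hk; lra.
  have := para (u n) (u m); have := Hu n; have := Hu m.
  have := small _ Hn; have := small _ Hm; have := Jd ((/ 2) *r (plus (u n) (u m))).
  move=> A1 A2 A3 A4 A5 A6.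
  have A7 : norm (minus (u n) (u m)) ^ 2 < eps ^ 2 by lra.
  apply: Rnot_le_lt => A8; have := cond_pos eps; nra.
(* The value of [J] at [u n + r v] is at least the infimum [- d], while
   [J (u n) < - d + 1 / (n + 1)]. In the expansion [u n] is replaced by [l] at a cost proportional
   to [norm (u n - l)], and then [n] tends to infinity. *)
have first_order r v : 0 <= 2 * r * (ip l v - phi v) + r ^ 2 * norm v ^ 2.
  have L : is_lim_seq (fun n => 2 * r * (ip l v - phi v) + r ^ 2 * norm v ^ 2
      + (Rabs (2 * r) * norm v) * norm (minus (u n) l) + / (INR n + 1))
    (2 * r * (ip l v - phi v) + r ^ 2 * norm v ^ 2 + (Rabs (2 * r) * norm v) * 0 + 0).
    apply: is_lim_seq_plus'; first apply: is_lim_seq_plus'.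
    - exact: is_lim_seq_const.
    - apply: is_lim_seq_mult'; first exact: is_lim_seq_const.
      exact: lim_minus_seq.
    - apply: (is_lim_seq_ext (fun n => / (INR (S n)))); first by move=> n; rewrite S_INR.
      apply/(is_lim_seq_incr_1 (fun n => / INR n)).
      have -> : Finite 0 = Rbar_inv p_infty by [].
      by apply: is_lim_seq_inv; first exact: is_lim_seq_INR.
  have := is_lim_seq_le _ _ _ _ _ (is_lim_seq_const 0) L.
  rewrite /Rbar_le Rmult_0_r !Rplus_0_r; apply => n.
  have := Jd (plus (u n) (r *r v)); have := Hu n.
  rewrite /J phiD phiZ; ipsimp; rewrite (ip_sym v (u n)) -(ip_norm v) => A B.
  have D : 2 * r * ip (minus (u n) l) v <= Rabs (2 * r) * norm v * norm (minus (u n) l).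
    have -> : 2 * r * ip (minus (u n) l) v = ip ((2 * r) *r minus (u n) l) v by ipsimp.
    apply: Rle_trans (ip_le_norm _ _) _; rewrite norm_rscal; apply: Req_le; ring.
  move: D; ipsimp; nra.
exists l => v.
have W : 0 < norm v ^ 2 + 1 by have := pow2_ge_0 (norm v); lra.
pose e := ip l v - phi v.
(* This [r] nearly minimizes the quadratic polynomial; the [+ 1] keeps the denominator positive when
   [v] is zero. *)
have := first_order (- e / (norm v ^ 2 + 1)) v; rewrite -/e => F.
have F' : 2 * (- e / (norm v ^ 2 + 1)) * e + (- e / (norm v ^ 2 + 1)) ^ 2 * norm v ^ 2
  = - (e ^ 2 * (norm v ^ 2 + 2)) / (norm v ^ 2 + 1) ^ 2 by field; lra.
have G : 0 <= - (e ^ 2 * (norm v ^ 2 + 2)).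
  rewrite F' in F; have P2 : 0 < (norm v ^ 2 + 1) ^ 2 by nra.
  apply: (Rmult_le_reg_r (/ (norm v ^ 2 + 1) ^ 2)); first exact: Rinv_0_lt_compat.
  by rewrite Rmult_0_l.
have : e = 0 by have := pow2_ge_0 (norm v); nra.
by rewrite /e (ip_sym l v); lra.
Qed.

Definition rlinear (f : H -> H) : Prop :=
  (forall x y, f (plus x y) = plus (f x) (f y)) /\ (forall r x, f (r *r x) = r *r f x).

Lemma adjoint_exists (f : H -> H) (c : R) :
  rlinear f -> (forall x, norm (f x) <= c * norm x) ->
  exists g : H -> H, forall x y, ip (f x) y = ip x (g y).
Proof.
move=> [fD fZ] fB.
suff /choice [g Hg] : forall y, exists z, forall x, ip (f x) y = ip x z by exists g.
move=> y.
apply: (riesz_representation _ (c * norm y)).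
- by move=> a b; rewrite fD; ipsimp.
- by move=> r a; rewrite fZ; ipsimp.
- move=> x; apply: Rle_trans (ip_le_norm _ _) _.
  have := fB x; have := norm_nneg y; nra.
Qed.

Lemma adjoint_rlinear (f g : H -> H) :
  (forall x y, ip (f x) y = ip x (g y)) -> rlinear g.
Proof.
move=> E; split=> [x y|r x]; apply: ip_ext => z; rewrite ip_sym -E; ipsimp;
  by rewrite !E ?(ip_sym z).
Qed.

Lemma adjoint_bound (f g : H -> H) (c : R) :
  (forall x y, ip (f x) y = ip x (g y)) ->
  (forall x, norm (f x) <= c * norm x) -> forall y, norm (g y) <= c * norm y.
Proof.
move=> E B y.
case: (Rle_lt_or_eq_dec 0 (norm (g y)) (norm_nneg _)) => [P|Z]; last first.
  (* When [g y] vanishes the claim is [0 <= c * norm y], which the bound on [f y] supplies. *)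
  rewrite -Z; case: (Rle_lt_or_eq_dec 0 (norm y) (norm_nneg _)) => [P|<-]; last lra.
  apply: (Rle_trans _ (norm (f y))); [exact: norm_nneg|exact: B].
apply: (Rmult_le_reg_l (norm (g y))) => //.
have -> : norm (g y) * norm (g y) = ip (f (g y)) y by rewrite E ip_norm; ring.
apply: Rle_trans (ip_le_norm _ _) _.
have := B (g y); have := norm_nneg y; nra.
Qed.

Lemma rlinear_minus (f : H -> H) x y : rlinear f -> f (minus x y) = minus (f x) (f y).
Proof.
move=> [fD fZ].
have -> : minus x y = plus x ((-1) *r y) by vec.
by rewrite fD fZ; vec.
Qed.

End Riesz.

(** * Finite sums and powers *)

Fixpoint rsum (n : nat) (f : nat -> R) : R :=
  match n with O => 0 | S m => rsum m f + f m end.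

Lemma rsum_ext n f g : (forall k, (k < n)%nat -> f k = g k) -> rsum n f = rsum n g.
Proof.
elim: n => [//|n IH] E /=.
have -> : rsum n f = rsum n g by apply: IH => k Hk; apply: E; lia.
have -> //: f n = g n by apply: E; lia.
Qed.

Lemma rsum_le n f g : (forall k, (k < n)%nat -> f k <= g k) -> rsum n f <= rsum n g.
Proof.
elim: n => [_|n IH E] /=; first exact: Rle_refl.
by apply: Rplus_le_compat; [apply: IH => k Hk; apply: E; lia|apply: E; lia].
Qed.

Lemma rsum_plus n f g : rsum n (fun k => f k + g k) = rsum n f + rsum n g.
Proof. elim: n => [|n IH] /=; [ring|rewrite IH; ring]. Qed.

Lemma rsum_mult n a f : rsum n (fun k => a * f k) = a * rsum n f.
Proof. elim: n => [|n IH] /=; [ring|rewrite IH; ring]. Qed.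

Lemma rsum_const n a : rsum n (fun _ => a) = INR n * a.
Proof. elim: n => [|n IH]; [rewrite /=; ring|rewrite S_INR /= IH; ring]. Qed.

Lemma rsum_nneg n f : (forall k, (k < n)%nat -> 0 <= f k) -> 0 <= rsum n f.
Proof.
move=> P; have -> : 0 = rsum n (fun _ => 0) by rewrite rsum_const; ring.
exact: rsum_le.
Qed.

Lemma rsum_telescope n f : rsum n (fun k => f k - f (S k)) = f O - f n.
Proof. elim: n => [|n IH] /=; [ring|rewrite IH; ring]. Qed.

Lemma rsum_geometric_le n r : 0 <= r < 1 -> (1 - r) * rsum n (fun k => r ^ k) <= 1.
Proof.
move=> Hr; have -> : (1 - r) * rsum n (fun k => r ^ k) = 1 - r ^ n.
  elim: n => [|n IH] /=; [ring|rewrite Rmult_plus_distr_l IH; ring].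
by have := pow_le r n (proj1 Hr); lra.
Qed.

Lemma rsum_front n f : rsum (S n) f = f O + rsum n (fun k => f (S k)).
Proof.
elim: n => [|n IH]; first by rewrite /=; ring.
by rewrite [LHS]/= -/(rsum (S n) f) IH /=; ring.
Qed.

Lemma rsum_rev n f : rsum n (fun k => f (n - 1 - k)%nat) = rsum n f.
Proof.
elim: n f => [//|n IH] f.
rewrite [RHS]/= -(IH f) rsum_front Rplus_comm; congr (_ + _); last by congr f; lia.
by apply: rsum_ext => k Hk; congr f; lia.
Qed.

(** The squares of [a * f k - b * g k] have a nonnegative sum; the choice [a = sqrt G], [b = sqrt F]
    is optimal. *)
Lemma rsum_cauchy_schwarz n f g :
  rsum n (fun k => f k * g k)
  <= sqrt (rsum n (fun k => f k ^ 2)) * sqrt (rsum n (fun k => g k ^ 2)).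
Proof.
have pos h : 0 <= rsum n (fun k => h k ^ 2) by apply: rsum_nneg => k _; apply: pow2_ge_0.
set S := rsum n (fun k => f k * g k); set F := rsum n (fun k => f k ^ 2);
  set G := rsum n (fun k => g k ^ 2).
have quad a b : 2 * a * b * S <= a ^ 2 * F + b ^ 2 * G.
  rewrite -!rsum_mult -rsum_plus; apply: rsum_le => k _.
  have := pow2_ge_0 (a * f k - b * g k); nra.
have F0 : 0 <= F by apply: pos. have G0 : 0 <= G by apply: pos.
have HF := sqrt_sqrt F F0; have HG := sqrt_sqrt G G0.
have PF := sqrt_pos F; have PG := sqrt_pos G.
case: (Rle_lt_or_eq_dec _ _ PF) => [PF'|ZF]; last first.
  rewrite -ZF Rmult_0_l; have F00 : F = 0 by rewrite -HF -ZF; ring.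
  (* With [F = 0] and [S > 0], this large value of [a] would give [2 * (G + 1) <= G]. *)
  apply: Rnot_lt_le => SP; have := quad ((G + 1) / S) 1.
  have -> : 2 * ((G + 1) / S) * 1 * S = 2 * (G + 1) by field; lra.
  rewrite F00; lra.
case: (Rle_lt_or_eq_dec _ _ PG) => [PG'|ZG]; last first.
  rewrite -ZG Rmult_0_r; have G00 : G = 0 by rewrite -HG -ZG; ring.
  apply: Rnot_lt_le => SP; have := quad 1 ((F + 1) / S).
  have -> : 2 * 1 * ((F + 1) / S) * S = 2 * (F + 1) by field; lra.
  rewrite G00; lra.
have := quad (sqrt G) (sqrt F).
have -> : sqrt G ^ 2 * F + sqrt F ^ 2 * G = 2 * (sqrt G * sqrt F) * (sqrt F * sqrt G).
  transitivity (sqrt G ^ 2 * (sqrt F * sqrt F) + sqrt F ^ 2 * (sqrt G * sqrt G)); last by ring.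
  by rewrite HF HG.
have : 0 < sqrt G * sqrt F by apply: Rmult_lt_0_compat.
nra.
Qed.

Section Powers.
Context {H : HilbertSpace}.
Implicit Types (x y : H) (f g : H -> H).

Lemma iter_plus n m f x : Nat.iter (n + m) f x = Nat.iter n f (Nat.iter m f x).
Proof. by elim: n => [//|n IH] /=; rewrite IH. Qed.

Lemma iter_comm n f g x : (forall y, f (g y) = g (f y)) -> Nat.iter n f (g x) = g (Nat.iter n f x).
Proof. by move=> C; elim: n => [//|n IH] /=; rewrite IH C. Qed.

Lemma iter_rlinear n f : rlinear f -> rlinear (Nat.iter n f).
Proof.
move=> [fD fZ]; elim: n => [|n [ID IZ]] /=; first by split.
by split=> [x y|r x] /=; [rewrite ID fD|rewrite IZ fZ].
Qed.

Lemma rlinear_zero f : rlinear f -> f zero = zero.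
Proof.
move=> [fD fZ]; have -> : (zero : H) = 0 *r zero by vec.
by rewrite fZ; vec.
Qed.

Lemma iter_adjoint n f g :
  (forall x y, ip (f x) y = ip x (g y)) ->
  forall x y, ip (Nat.iter n f x) y = ip x (Nat.iter n g y).
Proof.
move=> E; elim: n => [//|n IH] x y /=.
by rewrite E IH -(iter_comm n g g).
Qed.

Lemma iter_bound n f c x :
  0 <= c -> (forall y, norm (f y) <= c * norm y) -> norm (Nat.iter n f x) <= c ^ n * norm x.
Proof.
move=> c0 B; elim: n => [|n IH]; first by rewrite /=; lra.
rewrite [Nat.iter _ _ _]/= -tech_pow_Rmult; apply: Rle_trans (B _) _.
by rewrite Rmult_assoc; apply: Rmult_le_compat_l.
Qed.

End Powers.

(** * A discrete Lyapunov estimate *)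

Section Lyapunov.
Context {H : HilbertSpace}.
Implicit Types (x y v w : H) (V B : H -> H).

Definition power_bounded (M : R) V : Prop := forall n x, norm (Nat.iter n V x) <= M * norm x.

(** For [V = lam (A + lam)^-1], close to the semigroup at time [1 / lam], and
    [r = (1 - xi / lam) ^ 2], close to [exp (- 2 xi / lam)], this is a truncated Riemann sum for the
    integral of [2 xi exp (- 2 xi s) norm (T_s x) ^ 2]. *)
Definition energy (r : R) (N : nat) V x : R :=
  (1 - r) * rsum N (fun n => r ^ n * norm (Nat.iter n V x) ^ 2).

Lemma energy_nneg r N V x : 0 <= r < 1 -> 0 <= energy r N V x.
Proof.
move=> Hr; apply: Rmult_le_pos; first by lra.
apply: rsum_nneg => k _; apply: Rmult_le_pos; [apply: pow_le; lra|exact: pow2_ge_0].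
Qed.

Lemma energy_le M r N V x :
  0 <= r < 1 -> power_bounded M V -> energy r N V x <= M ^ 2 * norm x ^ 2.
Proof.
move=> Hr PB.
have L : rsum N (fun n => r ^ n * norm (Nat.iter n V x) ^ 2)
    <= rsum N (fun n => (M * norm x) ^ 2 * r ^ n).
  apply: rsum_le => k _; rewrite Rmult_comm; apply: Rmult_le_compat_r; first by apply: pow_le; lra.
  by apply: pow_incr; split; [exact: norm_nneg|exact: PB].
rewrite (rsum_mult _ _ (fun n => r ^ n)) in L.
have G := rsum_geometric_le N r Hr; have P := pow2_ge_0 (M * norm x).
rewrite /energy -Rpow_mult_distr.
apply: Rle_trans (Rmult_le_compat_l (1 - r) _ _ (ltac:(lra)) L) _.
have := Rmult_le_compat_l _ _ _ P G; rewrite Rmult_1_r => G2.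
by apply: Rle_trans _ G2; apply: Req_le; ring.
Qed.

(** The sum telescopes. This is the discrete form of the Lyapunov identity for [P]; the term with
    [r ^ N] is the price of the truncation. *)
Lemma energy_shift r N V x :
  energy r N V x - r * energy r N V (V x)
  = (1 - r) * (norm x ^ 2 - r ^ N * norm (Nat.iter N V x) ^ 2).
Proof.
rewrite /energy; have E := rsum_telescope N (fun n => r ^ n * norm (Nat.iter n V x) ^ 2).
rewrite /= Rmult_1_l in E.
have <- : rsum N (fun k => r ^ k * norm (Nat.iter k V x) ^ 2
    + (- r) * (r ^ k * norm (Nat.iter k V (V x)) ^ 2))
  = norm x ^ 2 - r ^ N * norm (Nat.iter N V x) ^ 2.
  rewrite /= -E; apply: rsum_ext => k _; rewrite (iter_comm k V V) //=; ring.
rewrite rsum_plus rsum_mult; ring.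
Qed.

(** A quadratic identity between norms that holds along the powers of [V] can be summed with
    weights, so the energy obeys the same identities as a squared Hilbert norm. *)
Lemma energy_combine r N V (a b c d : R) x y z t :
  (forall n, a * norm (Nat.iter n V x) ^ 2 + b * norm (Nat.iter n V y) ^ 2
    = c * norm (Nat.iter n V z) ^ 2 + d * norm (Nat.iter n V t) ^ 2) ->
  a * energy r N V x + b * energy r N V y = c * energy r N V z + d * energy r N V t.
Proof.
move=> E; rewrite /energy.
have E' : rsum N (fun n => a * (r ^ n * norm (Nat.iter n V x) ^ 2)
                          + b * (r ^ n * norm (Nat.iter n V y) ^ 2))
        = rsum N (fun n => c * (r ^ n * norm (Nat.iter n V z) ^ 2)
                          + d * (r ^ n * norm (Nat.iter n V t) ^ 2)).
  apply: rsum_ext => n _.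
  by rewrite -!(Rmult_assoc _ (r ^ n)) !(Rmult_comm _ (r ^ n)) !Rmult_assoc -!Rmult_plus_distr_l E.
move: E'; rewrite !rsum_plus !rsum_mult => E'.
by rewrite -!(Rmult_assoc _ (1 - r)) !(Rmult_comm _ (1 - r)) !Rmult_assoc -!Rmult_plus_distr_l E'.
Qed.

(** The inner product [<w, v>] of the energy norm is eliminated between the squares of [v - h w] and of [q w + v / lam]. *)
Lemma energy_polarization r N V h lam q v w :
  rlinear V -> lam <> 0 ->
  q * energy r N V (minus v (h *r w))
    + h * lam * energy r N V (plus (q *r w) ((/ lam) *r v))
  = (q + h / lam) * energy r N V v + (q * h ^ 2 + h * lam * q ^ 2) * energy r N V w.
Proof.
move=> LV l0; apply: energy_combine => n.
have LI := iter_rlinear n V LV.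
rewrite (rlinear_minus _ _ _ LI) (proj1 LI) !(proj2 LI) -!ip_norm; ipsimp.
rewrite (ip_sym (Nat.iter n V w) (Nat.iter n V v)); field => //.
Qed.

(** [B] plays the part of [(A + xi)^-1] and [V] that of [lam (A + lam)^-1]: the identity is the resolvent equation. *)
Definition resolvent_like (M xi : R) B : Prop :=
  rlinear B /\
  forall lam, 2 * xi <= lam -> exists V, rlinear V /\ power_bounded M V /\
    (forall v, V (B v) = B (V v)) /\
    (forall v, V (plus ((1 - xi / lam) *r B v) ((/ lam) *r v)) = B v).

Definition euler_step (h : R) B x : H := minus x (h *r B x).

Lemma energy_decay M xi h lam r N V B v :
  0 < xi -> 0 < h -> 16 * M ^ 2 * h <= xi -> 2 * xi <= lam ->
  r = (1 - xi / lam) ^ 2 -> 2 * M ^ 2 * r ^ N <= 1 ->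
  rlinear V -> power_bounded M V ->
  V (plus ((1 - xi / lam) *r B v) ((/ lam) *r v)) = B v ->
  h * xi / 32 * norm (B v) ^ 2
  <= (1 - xi / lam) * energy r N V v - (1 - xi / lam) * energy r N V (euler_step h B v)
     + h / lam * ((M ^ 2 + 1) * norm v ^ 2).
Proof.
move=> xi0 h0 hM lam0 Er HN LV PB EV; rewrite /euler_step.
have l0 : 0 < lam by lra.
set q := 1 - xi / lam in Er EV *.
have ql : q * lam = lam - xi by rewrite /q; field; lra.
have q12 : / 2 <= q < 1 by split; nra.
have r01 : 0 <= r < 1 by rewrite Er; nra.
set w := B v in EV *; set u := plus _ _ in EV.
have P := energy_polarization r N V h lam q v w LV (Rgt_not_eq _ _ l0).
rewrite -/u in P.
have S := energy_shift r N V u; rewrite EV in S.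
have Pv := energy_le M r N V v r01 PB; have Pw := energy_le M r N V w r01 PB.
have Pu : norm u ^ 2 / 2 <= norm u ^ 2 - r ^ N * norm (Nat.iter N V u) ^ 2.
  have : norm (Nat.iter N V u) ^ 2 <= M ^ 2 * norm u ^ 2.
    by rewrite -Rpow_mult_distr; apply: pow_incr; split; [exact: norm_nneg|exact: PB].
  have : 0 <= r ^ N by apply: pow_le; lra.
  have := pow2_ge_0 (norm u); nra.
have wu : q ^ 2 * norm w ^ 2 <= 2 * norm u ^ 2 + 2 * (/ lam) ^ 2 * norm v ^ 2.
  have -> : q ^ 2 * norm w ^ 2 = norm (plus u ((- / lam) *r v)) ^ 2.
    have -> : plus u ((- / lam) *r v) = q *r w by rewrite /u; vec.
    by rewrite norm_rscal Rpow_mult_distr pow2_abs.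
  apply: Rle_trans (norm_sq_add_le _ _) _.
  by rewrite norm_rscal Rpow_mult_distr pow2_abs; apply: Req_le; ring.
have li : 0 < / lam by apply: Rinv_0_lt_compat.
have lam_r : lam * (1 - r) = xi * (1 + q) by rewrite Er; nra.
have W8 : norm w ^ 2 / 8 - (/ lam) ^ 2 * norm v ^ 2 <= norm u ^ 2.
  have := pow2_ge_0 (norm w); have : / 4 <= q ^ 2 by nra.
  nra.
have Eu : q ^ 2 * energy r N V w + (1 - r) * (norm u ^ 2 / 2) <= energy r N V u.
  by rewrite -Er; nra.
have HL : 0 < h * lam by nra.
have K1 : h * lam * (q ^ 2 * energy r N V w) + h * (xi * (1 + q)) * (norm u ^ 2 / 2)
    <= h * lam * energy r N V u.
  rewrite -lam_r; nra.
have K2 : h * xi * (3 / 4) * norm u ^ 2 <= h * (xi * (1 + q)) * (norm u ^ 2 / 2).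
  have : 0 <= h * xi by nra.
  have := pow2_ge_0 (norm u); have : 3 / 2 <= 1 + q by lra.
  move=> A1 A2 A3; have : 0 <= h * xi * norm u ^ 2 by nra.
  nra.
have K3 : h * xi * (3 / 4) * (norm w ^ 2 / 8 - (/ lam) ^ 2 * norm v ^ 2)
    <= h * xi * (3 / 4) * norm u ^ 2.
  by apply: Rmult_le_compat_l => //; nra.
have K4 : h * xi * (3 / 4) * ((/ lam) ^ 2 * norm v ^ 2) <= h / lam * norm v ^ 2.
  have : xi * / lam <= / 2.
    by apply: (Rmult_le_reg_r lam) => //; rewrite Rmult_assoc Rinv_l; lra.
  move=> A1; have A2 : 0 <= h * / lam * norm v ^ 2.
    by apply: Rmult_le_pos; [nra|exact: pow2_ge_0].
  rewrite /Rdiv; nra.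
have K5 : q * h ^ 2 * energy r N V w <= h * xi / 16 * norm w ^ 2.
  have E0 := energy_nneg r N V w r01.
  have A1 : q * h ^ 2 * energy r N V w <= h ^ 2 * energy r N V w.
    have : 0 <= h ^ 2 * energy r N V w by apply: Rmult_le_pos => //; exact: pow2_ge_0.
    nra.
  have A2 : h ^ 2 * energy r N V w <= h ^ 2 * (M ^ 2 * norm w ^ 2).
    by apply: Rmult_le_compat_l => //; exact: pow2_ge_0.
  have A3 : h * (16 * M ^ 2 * h) * norm w ^ 2 <= h * xi * norm w ^ 2.
    by apply: Rmult_le_compat_r; [exact: pow2_ge_0|apply: Rmult_le_compat_l => //; lra].
  lra.
have K6 : h / lam * energy r N V v <= h / lam * (M ^ 2 * norm v ^ 2).
  by apply: Rmult_le_compat_l => //; rewrite /Rdiv; nra.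
nra.
Qed.

Lemma le_of_le_add_inv a b K L : (forall lam, L <= lam -> 0 < lam -> a <= b + K / lam) -> a <= b.
Proof.
move=> A; apply: Rnot_lt_le => ba.
pose lam := Rmax L ((Rabs K + 1) / (a - b)).
have l1 : (Rabs K + 1) / (a - b) <= lam by apply: Rmax_r.
have p : 0 < (Rabs K + 1) / (a - b).
  by apply: Rdiv_lt_0_compat; have := Rabs_pos K; lra.
have l0 : 0 < lam by lra.
have := A lam (Rmax_l _ _) l0.
have : K / lam < a - b.
  apply: (Rmult_lt_reg_r lam) => //; rewrite /Rdiv Rmult_assoc Rinv_l; last lra.
  have : Rabs K + 1 <= lam * (a - b).
    apply: (Rmult_le_reg_r (/ (a - b))); first by apply: Rinv_0_lt_compat; lra.
    by rewrite Rmult_assoc Rinv_r; lra.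
  by have := Rle_abs K; lra.
lra.
Qed.

(** Summing the decay of the energy along the Euler trajectory telescopes, and the initial energy is
    at most [M ^ 2 * norm x ^ 2]. The bound is free of [n]. *)
Lemma square_sum M xi h B n x :
  0 < xi -> 0 < h -> 16 * M ^ 2 * h <= xi -> resolvent_like M xi B ->
  rsum n (fun k => norm (B (Nat.iter k (euler_step h B) x)) ^ 2)
  <= 32 * M ^ 2 / (h * xi) * norm x ^ 2.
Proof.
move=> xi0 h0 hM [LB HB].
set S := rsum _ _.
suff : h * xi / 32 * S <= M ^ 2 * norm x ^ 2.
  move=> A; apply: (Rmult_le_reg_l (h * xi / 32)); first by nra.
  by apply: Rle_trans A _; apply: Req_le; field; lra.
set v := fun k => Nat.iter k (euler_step h B) x.
(* The error depends on [n] and on the trajectory, both fixed, but carries a factor [1 / lam]. The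
   truncation length [N] is chosen afterwards, for each [lam]. *)
apply: (le_of_le_add_inv _ _ (h * (M ^ 2 + 1) * rsum n (fun k => norm (v k) ^ 2)) (2 * xi)) => lam Hl l0.
have [V [LV [PB [CV EV]]]] := HB lam Hl.
set q := 1 - xi / lam.
have ql : q * lam = lam - xi by rewrite /q; field; lra.
have q12 : / 2 <= q < 1 by split; nra.
have [N HN] : exists N, 2 * M ^ 2 * (q ^ 2) ^ N <= 1.
  have p : 0 < / (2 * M ^ 2 + 1) by apply: Rinv_0_lt_compat; have := pow2_ge_0 M; lra.
  have [N /(_ N (le_n N)) HN] := pow_lt_1_zero (q ^ 2) (ltac:(rewrite Rabs_pos_eq; nra)) _ p.
  exists N; rewrite Rabs_pos_eq in HN; last by apply: pow_le; nra.
  have := Rmult_lt_compat_l (2 * M ^ 2 + 1) _ _ (ltac:(have := pow2_ge_0 M; lra)) HN.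
  rewrite Rinv_r; last by have := pow2_ge_0 M; lra.
  have : 0 <= (q ^ 2) ^ N by apply: pow_le; nra.
  nra.
have step k : h * xi / 32 * norm (B (v k)) ^ 2
    <= (q * energy (q ^ 2) N V (v k) - q * energy (q ^ 2) N V (v (Datatypes.S k)))
       + h / lam * (M ^ 2 + 1) * norm (v k) ^ 2.
  rewrite (Rmult_assoc (h / lam)).
  by apply: (energy_decay M xi h lam (q ^ 2) N V B (v k)).
have := rsum_le n _ _ (fun k _ => step k).
rewrite rsum_mult rsum_plus (rsum_telescope n (fun k => q * energy (q ^ 2) N V (v k))) rsum_mult.
have E0 := energy_nneg (q ^ 2) N V (v n) (ltac:(nra)).
have E1 := energy_le M (q ^ 2) N V (v O) (ltac:(nra)) PB.
have E2 := energy_nneg (q ^ 2) N V (v O) (ltac:(nra)).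
rewrite -/S => A; apply: Rle_trans A _.
have -> : h * (M ^ 2 + 1) * rsum n (fun k => norm (v k) ^ 2) / lam
  = h / lam * (M ^ 2 + 1) * rsum n (fun k => norm (v k) ^ 2) by rewrite /Rdiv; ring.
have E3 : norm (v O) = norm x by [].
rewrite E3 in E1; apply: Rplus_le_compat_r.
have A1 : 0 <= q * energy (q ^ 2) N V (v n) by apply: Rmult_le_pos; lra.
have A2 : 0 <= (1 - q) * energy (q ^ 2) N V (v O) by apply: Rmult_le_pos; lra.
lra.
Qed.

(** Taking adjoints reverses the order of the factors in the resolvent equation. The commutation of
    [V] with [B] that is part of [resolvent_like] restores it. *)
Lemma resolvent_like_adjoint M xi B c :
  resolvent_like M xi B -> (forall x, norm (B x) <= c * norm x) ->
  exists B', resolvent_like M xi B' /\ (forall x y, ip (B x) y = ip x (B' y)).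
Proof.
move=> [LB HB] Bc; have [B' EB] := adjoint_exists B c LB Bc.
exists B'; split=> //; split; first exact: adjoint_rlinear EB.
move=> lam /HB [V [LV [PB [CV EV]]]].
have [V' EV'] := adjoint_exists V M LV (PB 1%nat).
exists V'; split; first exact: adjoint_rlinear EV'.
have [VD' VZ'] := adjoint_rlinear _ _ EV'.
have CV' v : V' (B' v) = B' (V' v).
  by apply: ip_ext => z; rewrite !(ip_sym _ z) -EV' -!EB -EV' CV.
split; last split=> [//|v].
- move=> n; apply: (adjoint_bound (Nat.iter n V)); last exact: PB.
  exact: iter_adjoint.
- rewrite VD' !VZ' CV'; apply: ip_ext => z; rewrite !(ip_sym _ z) -EB -(EV z).
  by rewrite EV'; ipsimp; rewrite -EB.
Qed.

End Lyapunov.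

(** * Square function estimates and differences of Euler powers *)

Section SquareFunctionEstimates.
Context {H : HilbertSpace}.
Implicit Types (x y z : H) (f g B : H -> H).

Lemma ratio_nneg M h xi : 0 < h -> 0 < xi -> 0 <= 32 * M ^ 2 / (h * xi).
Proof.
move=> h0 xi0; apply: Rmult_le_pos; first by have := pow2_ge_0 M; lra.
by apply/Rlt_le/Rinv_0_lt_compat/Rmult_lt_0_compat.
Qed.

Fixpoint vsum (n : nat) (u : nat -> H) : H :=
  match n with O => zero | S m => plus (vsum m u) (u m) end.

Lemma ip_vsum n u z : ip (vsum n u) z = rsum n (fun k => ip (u k) z).
Proof. by elim: n => [|n IH] /=; ipsimp => //; rewrite IH. Qed.

Lemma vsum_ext n u v : (forall k, (k < n)%nat -> u k = v k) -> vsum n u = vsum n v.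
Proof.
move=> E; apply: ip_ext => z; rewrite !ip_vsum.
by apply: rsum_ext => k /E ->.
Qed.

(** The discrete Duhamel formula: [f^n - g^n] is the telescoping sum of [f^k (f - g) g^(n-1-k)]. *)
Lemma iter_minus_iter n f g x :
  rlinear f ->
  minus (Nat.iter n f x) (Nat.iter n g x)
  = vsum n (fun k => Nat.iter k f (minus (f (Nat.iter (n - 1 - k) g x)) (g (Nat.iter (n - 1 - k) g x)))).
Proof.
move=> Lf; have front m u : vsum (S m) u = plus (u O) (vsum m (fun k => u (S k))).
  elim: m => [|m IH]; first by rewrite /=; vec.
  by rewrite [LHS]/= -/(vsum (S m) u) IH /=; vec.
have sum_f m u : f (vsum m u) = vsum m (fun k => f (u k)).
  elim: m => [|m IH] /=; first exact: rlinear_zero.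
  by rewrite (proj1 Lf) IH.
elim: n => [|n IH]; first by rewrite /=; vec.
rewrite front [Nat.iter 0 f _]/=.
have -> : (S n - 1 - 0)%nat = n by lia.
have -> : vsum n (fun k => Nat.iter (S k) f (minus (f (Nat.iter (S n - 1 - S k) g x)) (g (Nat.iter (S n - 1 - S k) g x))))
  = f (minus (Nat.iter n f x) (Nat.iter n g x)).
  rewrite IH sum_f; apply: vsum_ext => k Hk /=.
  by have -> : (n - 0 - S k)%nat = (n - 1 - k)%nat by lia.
by rewrite (rlinear_minus _ _ _ Lf) /=; vec.
Qed.

Lemma euler_step_rlinear h B : rlinear B -> rlinear (euler_step h B).
Proof. by move=> [BD BZ]; split=> *; rewrite /euler_step ?BD ?BZ; vec. Qed.

Lemma euler_step_comm h B f x :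
  rlinear f -> (forall y, f (B y) = B (f y)) -> f (euler_step h B x) = euler_step h B (f x).
Proof. by move=> Lf C; rewrite /euler_step (rlinear_minus _ _ _ Lf) (proj2 Lf) C. Qed.

Lemma iter_euler_comm n h B f x :
  rlinear f -> (forall y, f (B y) = B (f y)) ->
  f (Nat.iter n (euler_step h B) x) = Nat.iter n (euler_step h B) (f x).
Proof. by move=> Lf C; rewrite iter_comm // => y; rewrite euler_step_comm. Qed.

(** Dual to [square_sum], through the adjoints of [B] and of the Euler step. *)
Lemma dual_square_sum M xi h B c n (u : nat -> H) :
  0 < xi -> 0 < h -> 16 * M ^ 2 * h <= xi -> resolvent_like M xi B ->
  (forall x, norm (B x) <= c * norm x) ->
  norm (vsum n (fun k => B (Nat.iter k (euler_step h B) (u k)))) ^ 2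
  <= 32 * M ^ 2 / (h * xi) * rsum n (fun k => norm (u k) ^ 2).
Proof.
move=> xi0 h0 hM RB Bc.
have [B' [RB' EB]] := resolvent_like_adjoint M xi B c RB Bc.
set z := vsum _ _; set K := 32 * M ^ 2 / (h * xi).
have K0 : 0 <= K.
  by apply: ratio_nneg.
have Es x y : ip (euler_step h B x) y = ip x (euler_step h B' y).
  by rewrite /euler_step; ipsimp; rewrite EB.
have E : norm z ^ 2 <= rsum n (fun k => norm (u k) * norm (B' (Nat.iter k (euler_step h B') z))).
  rewrite -ip_norm {1}/z ip_vsum; apply: rsum_le => k _.
  rewrite EB (iter_adjoint k _ _ Es) -(iter_euler_comm k h B' B' z (proj1 RB')) //.
  exact: ip_le_norm.
have := Rle_trans _ _ _ E (rsum_cauchy_schwarz _ _ _).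
set S := rsum n (fun k => norm (u k) ^ 2); set Q := rsum n _ => A.
have QK : Q <= K * norm z ^ 2 by apply: square_sum.
have S0 : 0 <= S by apply: rsum_nneg => k _; apply: pow2_ge_0.
have Q0 : 0 <= Q by apply: rsum_nneg => k _; apply: pow2_ge_0.
have A2 : (norm z ^ 2) ^ 2 <= S * Q.
  have -> : S * Q = (sqrt S * sqrt Q) ^ 2 by rewrite Rpow_mult_distr !pow2_sqrt.
  by apply: pow_incr; split=> //; apply: pow2_ge_0.
case: (Rle_lt_or_eq_dec 0 (norm z ^ 2) (pow2_ge_0 _)) => [P|<-]; last by apply: Rmult_le_pos.
by apply: (Rmult_le_reg_r (norm z ^ 2)) => //; nra.
Qed.

(** By the resolvent equation each Duhamel term contains [h (xi1 - xi2) B1 B2]. The factor [B1] with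
    its Euler powers is handled by the dual estimate, [B2] with its powers by the direct one. These
    contribute [1 / (h xi1)] and [1 / (h xi2)], so that [h] cancels and the bound depends neither on
    the step nor on [n]. *)
Lemma euler_difference M xi1 xi2 h B1 B2 c n x :
  0 < xi1 -> 0 < xi2 -> 0 < h -> 16 * M ^ 2 * h <= xi1 -> 16 * M ^ 2 * h <= xi2 ->
  resolvent_like M xi1 B1 -> resolvent_like M xi2 B2 ->
  (forall x, norm (B1 x) <= c * norm x) ->
  (forall x, minus (B2 x) (B1 x) = (xi1 - xi2) *r B1 (B2 x)) ->
  norm (minus (Nat.iter n (euler_step h B1) x) (Nat.iter n (euler_step h B2) x)) ^ 2
  <= (32 * M ^ 2) ^ 2 * (xi1 - xi2) ^ 2 / (xi1 * xi2) * norm x ^ 2.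
Proof.
move=> p1 p2 h0 hM1 hM2 R1 R2 Bc E.
set u := fun k => (h * (xi1 - xi2)) *r B2 (Nat.iter (n - 1 - k) (euler_step h B2) x).
rewrite (iter_minus_iter n _ _ x (euler_step_rlinear h B1 (proj1 R1))).
have -> : vsum n (fun k => Nat.iter k (euler_step h B1)
      (minus (euler_step h B1 (Nat.iter (n - 1 - k) (euler_step h B2) x))
             (euler_step h B2 (Nat.iter (n - 1 - k) (euler_step h B2) x))))
  = vsum n (fun k => B1 (Nat.iter k (euler_step h B1) (u k))).
  apply: vsum_ext => k _; rewrite (iter_euler_comm k h B1 B1 (u k) (proj1 R1)) //.
  congr (Nat.iter _ _ _); rewrite /u (proj2 (proj1 R1)).
  set v := Nat.iter _ _ x.
  have -> : (h * (xi1 - xi2)) *r B1 (B2 v) = h *r ((xi1 - xi2) *r B1 (B2 v)) by vec.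
  by rewrite -E /euler_step; vec.
apply: Rle_trans (dual_square_sum M xi1 h B1 c n u p1 h0 hM1 R1 Bc) _.
have -> : rsum n (fun k => norm (u k) ^ 2)
   = (h * (xi1 - xi2)) ^ 2 * rsum n (fun k => norm (B2 (Nat.iter k (euler_step h B2) x)) ^ 2).
  rewrite -rsum_mult -[RHS](rsum_rev n); apply: rsum_ext => k _.
  by rewrite /u norm_rscal Rpow_mult_distr pow2_abs.
have S := square_sum M xi2 h B2 n x p2 h0 hM2 R2.
have K0 : 0 <= 32 * M ^ 2 / (h * xi1).
  by apply: ratio_nneg.
apply: Rle_trans (Rmult_le_compat_l _ _ _ K0 (Rmult_le_compat_l _ _ _ (pow2_ge_0 _) S)) _.
by apply: Req_le; field; lra.
Qed.

(** The same vector is written in [n + 1] ways, by distributing the [n] Euler steps between the two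
    factors [B]. The sum of these equal terms is bounded by the dual and the direct square function
    estimates. *)
Lemma euler_square_decay M xi h B c n x :
  0 < xi -> 0 < h -> 16 * M ^ 2 * h <= xi -> resolvent_like M xi B ->
  (forall x, norm (B x) <= c * norm x) ->
  INR (S n) * norm (B (B (Nat.iter n (euler_step h B) x))) <= 32 * M ^ 2 / (h * xi) * norm x.
Proof.
move=> xi0 h0 hM RB Bc; have LB := proj1 RB.
set K := 32 * M ^ 2 / (h * xi).
have K0 : 0 <= K.
  by apply: ratio_nneg.
set u := fun k => B (Nat.iter (n - k) (euler_step h B) x).
have := dual_square_sum M xi h B c (S n) u xi0 h0 hM RB Bc.
have -> : vsum (S n) (fun k => B (Nat.iter k (euler_step h B) (u k)))
  = INR (S n) *r B (B (Nat.iter n (euler_step h B) x)).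
  apply: ip_ext => z; rewrite ip_vsum; ipsimp; rewrite -rsum_const; apply: rsum_ext => k Hk.
  rewrite /u -(iter_euler_comm k h B B _ LB) // -iter_plus.
  by have -> : (k + (n - k))%nat = n by lia.
have -> : rsum (S n) (fun k => norm (u k) ^ 2)
   = rsum (S n) (fun k => norm (B (Nat.iter k (euler_step h B) x)) ^ 2).
  rewrite -[RHS](rsum_rev (S n)); apply: rsum_ext => k Hk.
  by rewrite /u; have -> : (S n - 1 - k)%nat = (n - k)%nat by lia.
have S := square_sum M xi h B (Datatypes.S n) x xi0 h0 hM RB.
move=> A; have A2 := Rle_trans _ _ _ A (Rmult_le_compat_l _ _ _ K0 S).
rewrite norm_rscal Rabs_pos_eq -/K in A2; last exact: pos_INR.
have P : 0 <= K * norm x by apply: Rmult_le_pos => //; exact: norm_nneg.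
by apply: Rsqr_incr_0_var => //; rewrite !Rsqr_pow2; apply: Rle_trans A2 _; apply: Req_le; ring.
Qed.

End SquareFunctionEstimates.

(** * Uniform bounds for the Euler scheme *)

Lemma pow_le_exp a n : 0 <= a -> (1 + a) ^ n <= exp (INR n * a).
Proof.
move=> a0; elim: n => [|n IH]; first by rewrite /= Rmult_0_l exp_0; lra.
have -> : INR (S n) * a = a + INR n * a by rewrite S_INR; ring.
rewrite exp_plus -tech_pow_Rmult.
by apply: Rmult_le_compat => //; [lra|apply: pow_le; lra|exact: exp_ineq1_le].
Qed.

Lemma exp_le_compat a b : a <= b -> exp a <= exp b.
Proof. by case=> [/exp_increasing|->]; lra. Qed.

Section ResolventFamily.
Context {H : HilbertSpace}.
Implicit Types (x y z : H) (f g : H -> H).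

(** All that the estimates use of [B xi = (A + xi)^-1]: [rf_power] is the Hille-Yosida bound,
    [rf_bounded] expresses the invertibility of [A] since it includes [xi = 0], and [rf_equation] is
    the resolvent equation. *)
Record resolvent_family (M beta : R) (B : R -> H -> H) : Prop := {
  rf_linear : forall xi, 0 <= xi -> rlinear (B xi);
  rf_power : forall xi, 0 < xi -> power_bounded M (fun x => xi *r B xi x);
  rf_bounded : forall xi x, 0 <= xi -> norm (B xi x) <= beta * norm x;
  rf_equation : forall xi eta x, 0 <= xi -> 0 <= eta ->
    minus (B eta x) (B xi x) = (xi - eta) *r B xi (B eta x)
}.

Variables (M beta : R) (B : R -> H -> H).
Hypothesis M1 : 1 <= M.
Hypothesis RF : resolvent_family M beta B.

Lemma rf_commute xi eta x : 0 <= xi -> 0 <= eta -> B xi (B eta x) = B eta (B xi x).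
Proof.
move=> Hx He; case: (Req_dec xi eta) => [->//|D].
apply: ip_ext => z.
have E1 := f_equal (fun v => ip v z) (rf_equation _ _ _ RF xi eta x Hx He).
have E2 := f_equal (fun v => ip v z) (rf_equation _ _ _ RF eta xi x He Hx).
move: E1 E2 => /=; ipsimp => E1 E2.
apply: (Rmult_eq_reg_l (xi - eta)); lra.
Qed.

Lemma rf_shift xi eta x : 0 <= xi -> 0 <= eta ->
  B eta x = B xi (plus x ((xi - eta) *r B eta x)).
Proof.
move=> Hx He; rewrite (proj1 (rf_linear _ _ _ RF _ Hx)) (proj2 (rf_linear _ _ _ RF _ Hx)).
by rewrite -(rf_equation _ _ _ RF) //; vec.
Qed.

Lemma rf_decay xi x : 0 < xi -> norm (B xi x) <= M / xi * norm x.
Proof.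
move=> Hx; have := rf_power _ _ _ RF xi Hx 1%nat x; rewrite /= norm_rscal Rabs_pos_eq; last lra.
move=> A; apply: (Rmult_le_reg_l xi) => //; apply: Rle_trans A _.
by apply: Req_le; field; lra.
Qed.

Lemma rf_resolvent_like xi : 0 < xi -> resolvent_like M xi (B xi).
Proof.
move=> Hx; split; first by apply: (rf_linear _ _ _ RF); lra.
move=> lam Hl; have l0 : 0 < lam by lra.
have L := rf_linear _ _ _ RF lam (Rlt_le _ _ l0).
exists (fun x => lam *r B lam x); split.
  by split=> [x y|r x]; rewrite ?(proj1 L) ?(proj2 L); vec.
split; first exact: (rf_power _ _ _ RF).
split=> v.
  rewrite (rf_commute lam xi v); try lra.
  by rewrite (proj2 (rf_linear _ _ _ RF xi _)) //; lra.
rewrite (proj1 L) !(proj2 L); apply: ip_ext => z.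
have := f_equal (fun v => ip v z) (rf_equation _ _ _ RF lam xi v (Rlt_le _ _ l0) (Rlt_le _ _ Hx)).
rewrite /=; ipsimp => E.
transitivity ((lam - xi) * ip (B lam (B xi v)) z + ip (B lam v) z); first by field; lra.
by rewrite -E; ring.
Qed.

(** * Bounds for the Euler powers over a fixed total time [t = N h] *)

Section EulerBounds.
Variables (N : nat) (h : R).
Hypotheses (N0 : (0 < N)%nat) (h0 : 0 < h).

Let t := INR N * h.
Let E xi := Nat.iter N (euler_step h (B xi)).

Lemma euler_time_pos : 0 < t.
Proof. by apply: Rmult_lt_0_compat => //; apply: lt_0_INR. Qed.

Lemma euler_rlinear xi : 0 <= xi -> rlinear (E xi).
Proof. by move=> Hx; apply/iter_rlinear/euler_step_rlinear/(rf_linear _ _ _ RF). Qed.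

Lemma euler_commute xi eta x : 0 <= xi -> 0 <= eta -> B eta (E xi x) = E xi (B eta x).
Proof.
move=> Hx He; apply: iter_euler_comm; first exact: (rf_linear _ _ _ RF).
by move=> y; apply: rf_commute.
Qed.

(** A crude bound that ignores the sign of the exponent; it serves where [t * c] stays bounded. *)
Lemma euler_norm_le c xi x :
  0 <= c -> (forall y, norm (B xi y) <= c * norm y) -> norm (E xi x) <= exp (t * c) * norm x.
Proof.
move=> c0 Bc; have a0 : 0 <= h * c by apply: Rmult_le_pos; lra.
have S y : norm (euler_step h (B xi) y) <= (1 + h * c) * norm y.
  apply: Rle_trans (norm_minus_le _ _) _; rewrite norm_rscal Rabs_pos_eq; last lra.
  have := Rmult_le_compat_l h _ _ (Rlt_le _ _ h0) (Bc y); lra.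
apply: Rle_trans (iter_bound N _ (1 + h * c) x _ S) _; first lra.
apply: Rmult_le_compat_r; first exact: norm_nneg.
by have := pow_le_exp (h * c) N a0; rewrite /t Rmult_assoc.
Qed.

Lemma step_pos xi : 16 * M ^ 2 * h <= xi -> 0 < xi.
Proof. have := pow_R1_Rle M 2 M1; nra. Qed.

Lemma euler_dyadic_difference xi x :
  16 * M ^ 2 * h <= xi -> norm (minus (E xi x) (E (2 * xi) x)) <= 32 * M ^ 2 * norm x.
Proof.
move=> hM; have Hx := step_pos xi hM.
have Hx2 : 0 < 2 * xi by lra.
have A := euler_difference M xi (2 * xi) h (B xi) (B (2 * xi)) beta N x Hx Hx2 h0 hM
  (ltac:(lra)) (rf_resolvent_like xi Hx) (rf_resolvent_like _ Hx2)
  (fun y => rf_bounded _ _ _ RF xi y (Rlt_le _ _ Hx))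
  (fun y => rf_equation _ _ _ RF xi (2 * xi) y (Rlt_le _ _ Hx) (Rlt_le _ _ Hx2)).
have P : 0 <= 32 * M ^ 2 * norm x.
  by apply: Rmult_le_pos; [have := pow2_ge_0 M; lra|exact: norm_nneg].
apply: Rsqr_incr_0_var => //; rewrite !Rsqr_pow2; apply: Rle_trans A _.
have -> : (32 * M ^ 2) ^ 2 * (xi - 2 * xi) ^ 2 / (xi * (2 * xi)) * norm x ^ 2
  = (32 * M ^ 2 * norm x) ^ 2 / 2 by field; lra.
have := pow2_ge_0 (32 * M ^ 2 * norm x); lra.
Qed.

Lemma euler_square_bound xi x :
  16 * M ^ 2 * h <= xi -> norm (B xi (B xi (E xi x))) <= 32 * M ^ 2 / (xi * t) * norm x.
Proof.
move=> hM; have Hx := step_pos xi hM; have tp := euler_time_pos.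
have A := euler_square_decay M xi h (B xi) beta N x Hx h0 hM (rf_resolvent_like xi Hx)
  (fun y => rf_bounded _ _ _ RF xi y (Rlt_le _ _ Hx)).
have Np : 0 < INR N by apply: lt_0_INR.
apply: (Rmult_le_reg_l (INR N)) => //; rewrite S_INR in A.
apply: (Rle_trans _ ((INR N + 1) * norm (B xi (B xi (E xi x))))).
  by apply: Rmult_le_compat_r; [exact: norm_nneg|lra].
by apply: Rle_trans A _; apply: Req_le; rewrite /t; field; lra.
Qed.

(** With [b = (A + xi)^-1] and [r = (A + xi + mu)^-1], one has [b = r + mu b^2 (1 - mu r)]. *)
Lemma resolvent_interpolation f a c mu xi :
  (forall x y, f (plus x y) = plus (f x) (f y)) -> (forall r x, f (r *r x) = r *r f x) ->
  (forall eta x, 0 < eta -> f (B eta x) = B eta (f x)) ->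
  0 < mu -> 0 < xi -> 0 <= a -> 0 <= c ->
  (forall x, norm (f x) <= a * norm x) ->
  (forall x, norm (f (B xi (B xi x))) <= c * norm x) ->
  forall x, norm (f (B xi x)) <= (M * a / mu + mu * (1 + M) * c) * norm x.
Proof.
move=> fD fZ fB mu0 Hx a0 c0 fa fc x.
have E1 : B xi x = plus (B (xi + mu) x) (mu *r B xi (B xi (minus x (mu *r B (xi + mu) x)))).
  have -> : B xi (minus x (mu *r B (xi + mu) x)) = B (xi + mu) x.
    rewrite [RHS](rf_shift xi (xi + mu)); try lra.
    by congr (B xi _); vec.
  rewrite -rf_commute; try lra.
  have -> : mu *r B (xi + mu) (B xi x) = (xi + mu - xi) *r B (xi + mu) (B xi x).
    by congr (_ *r _); ring.
  by rewrite -(rf_equation _ _ _ RF); try lra; vec.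
have n0 := norm_nneg x.
rewrite E1 fD fZ; apply: Rle_trans (norm_triangle _ _) _.
rewrite norm_rscal Rabs_pos_eq; last lra.
have T1 : norm (f (B (xi + mu) x)) <= M * a / mu * norm x.
  rewrite fB; last lra.
  apply: Rle_trans (rf_decay _ _ _) _; first lra.
  have -> : M * a / mu * norm x = M / mu * (a * norm x) by field; lra.
  apply: Rmult_le_compat; [|exact: norm_nneg| |exact: fa].
    by apply: Rmult_le_pos; [lra|apply/Rlt_le/Rinv_0_lt_compat; lra].
  by apply: Rmult_le_compat_l; [lra|apply: Rinv_le_contravar; lra].
have T2 : norm (minus x (mu *r B (xi + mu) x)) <= (1 + M) * norm x.
  apply: Rle_trans (norm_minus_le _ _) _; rewrite norm_rscal Rabs_pos_eq; last lra.
  have : mu * norm (B (xi + mu) x) <= mu * (M / mu * norm x).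
    apply: Rmult_le_compat_l; first lra.
    apply: Rle_trans (rf_decay _ _ _) _; first lra.
    apply: Rmult_le_compat_r => //.
    by apply: Rmult_le_compat_l; [lra|apply: Rinv_le_contravar; lra].
  have -> : mu * (M / mu * norm x) = M * norm x by field; lra.
  lra.
have T3 := Rle_trans _ _ _ (fc _) (Rmult_le_compat_l _ _ _ c0 T2).
have := Rmult_le_compat_l mu _ _ (Rlt_le _ _ mu0) T3; lra.
Qed.

(** The second term covers [xi >= t]. The first is four times the cost [256 * M ^ 5] of one
    doubling, since a quarter of the constant is available for it at each induction step. *)
Definition smoothing_constant : R := 1024 * M ^ 5 + exp M * M.

Lemma sqrt_time_bound xi : 0 < xi -> 0 < sqrt (xi * t) /\ sqrt (xi * t) ^ 2 = xi * t.
Proof.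
move=> Hx; have P : 0 < xi * t by apply: Rmult_lt_0_compat => //; exact: euler_time_pos.
by split; [exact: sqrt_lt_R0|apply: pow2_sqrt; lra].
Qed.

(** Each factor [B xi] equals [B (2 * xi)] composed with [1 + xi B_xi], whose norm is at most
    [1 + M <= 2 M]. This reduces the claim to [euler_square_bound] at [2 * xi]. *)
Lemma euler_square_bound_double xi x :
  16 * M ^ 2 * h <= xi ->
  norm (E (2 * xi) (B xi (B xi x))) <= 64 * M ^ 4 / (xi * t) * norm x.
Proof.
move=> hM; have Hx := step_pos xi hM; have tp := euler_time_pos.
have n0 := norm_nneg x.
have LE := euler_rlinear (2 * xi) (ltac:(lra)).
have S y : B xi y = B (2 * xi) (plus y (xi *r B xi y)).
  rewrite {1}(rf_shift (2 * xi) xi); try lra.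
  by congr (B _ (plus _ (_ *r _))); ring.
have shift_le y : norm (plus y (xi *r B xi y)) <= (1 + M) * norm y.
  apply: Rle_trans (norm_triangle _ _) _; rewrite norm_rscal Rabs_pos_eq; last lra.
  have := Rmult_le_compat_l xi _ _ (Rlt_le _ _ Hx) (rf_decay xi y Hx).
  have -> : xi * (M / xi * norm y) = M * norm y by field; lra.
  lra.
pose y := plus x (xi *r B xi x).
have -> : B xi (B xi x) = B (2 * xi) (B (2 * xi) (plus y (xi *r B xi y))).
  rewrite {1}(S x) -/y rf_commute; try lra.
  by congr (B _ _).
rewrite -!euler_commute; try lra.
apply: Rle_trans (euler_square_bound (2 * xi) _ _) _; first lra.
have -> : 64 * M ^ 4 / (xi * t) * norm x = 32 * M ^ 2 / (2 * xi * t) * (2 * M * (2 * M * norm x)).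
  by field; lra.
apply: Rmult_le_compat_l.
  by apply: Rmult_le_pos; [have := pow2_ge_0 M; lra|apply/Rlt_le/Rinv_0_lt_compat/Rmult_lt_0_compat; lra].
have A := shift_le y; have A2 := shift_le x; rewrite -/y in A2.
have y0 := norm_nneg y.
have A3 : norm y <= 2 * M * norm x by nra.
have A4 : norm (plus y (xi *r B xi y)) <= 2 * M * norm y by nra.
by apply: Rle_trans A4 _; apply: Rmult_le_compat_l; lra.
Qed.

(** The interpolation lemma is applied to [f], the difference of the two Euler powers: it is bounded
    by [32 M^2], and by [(32 + 64) M^4 / (xi t)] after two resolvents, which [mu = sqrt (xi * t)]
    balances. *)
Lemma euler_smoothing_difference xi x :
  16 * M ^ 2 * h <= xi -> xi <= t ->
  norm (minus (E xi (B xi x)) (E (2 * xi) (B (2 * xi) x)))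
  <= 256 * M ^ 5 / sqrt (xi * t) * norm x.
Proof.
move=> hM xt; have Hx := step_pos xi hM; have tp := euler_time_pos.
have n0 := norm_nneg x.
have L1 := euler_rlinear xi (ltac:(lra)); have L2 := euler_rlinear (2 * xi) (ltac:(lra)).
have [mu0 Emu] := sqrt_time_bound xi Hx; set mu := sqrt (xi * t) in mu0 Emu *.
have M0 := pow2_ge_0 M.
pose f y := minus (E xi y) (E (2 * xi) y).
have T1 : norm (f (B xi x)) <= (M * (32 * M ^ 2) / mu + mu * (1 + M) * (96 * M ^ 4 / (xi * t))) * norm x.
  apply: (resolvent_interpolation f (32 * M ^ 2) (96 * M ^ 4 / (xi * t)) mu xi) => //.
  - by move=> y z; rewrite /f (proj1 L1) (proj1 L2); vec.
  - by move=> r y; rewrite /f (proj2 L1) (proj2 L2); vec.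
  - move=> eta y He; rewrite /f (rlinear_minus _ _ _ (rf_linear _ _ _ RF eta _)); last lra.
    by rewrite !euler_commute //; lra.
  - lra.
  - by apply: Rmult_le_pos; [nra|apply/Rlt_le/Rinv_0_lt_compat; nra].
  - by move=> y; apply: euler_dyadic_difference.
  - move=> y; apply: Rle_trans (norm_minus_le _ _) _.
    have A1 := euler_square_bound_double xi y hM.
    have A2 : norm (E xi (B xi (B xi y))) <= 32 * M ^ 4 / (xi * t) * norm y.
      rewrite -!euler_commute; try lra.
      apply: Rle_trans (euler_square_bound xi y hM) _.
      apply: Rmult_le_compat_r; first exact: norm_nneg.
      apply: Rmult_le_compat_r; first by apply/Rlt_le/Rinv_0_lt_compat; nra.
      by have := pow_R1_Rle M 2 M1; nra.
    have -> : 96 * M ^ 4 / (xi * t) * norm y = 32 * M ^ 4 / (xi * t) * norm y + 64 * M ^ 4 / (xi * t) * norm y.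
      by field; lra.
    lra.
(* Replacing [B xi] by [B (2 * xi)] costs [xi] times two resolvents, hence a multiple of [1 / t];
   the assumption [xi <= t] turns this into [1 / sqrt (xi * t)]. *)
have T2 : norm (E (2 * xi) (minus (B xi x) (B (2 * xi) x))) <= 32 * M ^ 3 / mu * norm x.
  have -> : minus (B xi x) (B (2 * xi) x) = xi *r B (2 * xi) (B (2 * xi) (plus x (xi *r B xi x))).
    rewrite (rf_equation _ _ _ RF); try lra.
    congr (_ *r B (2 * xi) _); first by ring.
    rewrite {1}(rf_shift (2 * xi) xi); try lra.
    by congr (B _ (plus _ (_ *r _))); ring.
  rewrite (proj2 L2) norm_rscal Rabs_pos_eq; last lra.
  rewrite -!euler_commute; try lra.
  have A := euler_square_bound (2 * xi) (plus x (xi *r B xi x)) (ltac:(lra)).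
  have A2 : norm (plus x (xi *r B xi x)) <= 2 * M * norm x.
    apply: Rle_trans (norm_triangle _ _) _; rewrite norm_rscal Rabs_pos_eq; last lra.
    have := Rmult_le_compat_l xi _ _ (Rlt_le _ _ Hx) (rf_decay xi x Hx).
    have -> : xi * (M / xi * norm x) = M * norm x by field; lra.
    nra.
  have K0 : 0 <= 32 * M ^ 2 / (2 * xi * t).
    by apply: Rmult_le_pos; [lra|apply/Rlt_le/Rinv_0_lt_compat/Rmult_lt_0_compat; lra].
  have A3 := Rmult_le_compat_l xi _ _ (Rlt_le _ _ Hx) (Rle_trans _ _ _ A (Rmult_le_compat_l _ _ _ K0 A2)).
  apply: Rle_trans A3 _.
  have -> : xi * (32 * M ^ 2 / (2 * xi * t) * (2 * M * norm x)) = 32 * M ^ 3 * / t * norm x by field; lra.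
  apply: Rmult_le_compat_r => //; apply: Rmult_le_compat_l; first by have := pow_R1_Rle M 3 M1; lra.
  apply: Rinv_le_contravar => //; apply: Rsqr_incr_0_var; last lra.
  by rewrite !Rsqr_pow2 Emu; nra.
have -> : minus (E xi (B xi x)) (E (2 * xi) (B (2 * xi) x))
  = plus (f (B xi x)) (E (2 * xi) (minus (B xi x) (B (2 * xi) x))).
  by rewrite /f (rlinear_minus _ _ _ L2); vec.
apply: Rle_trans (norm_triangle _ _) _; apply: Rle_trans (Rplus_le_compat _ _ _ _ T1 T2) _.
rewrite -Rmult_plus_distr_r; apply: Rmult_le_compat_r => //.
rewrite -Emu.
have -> : M * (32 * M ^ 2) / mu + mu * (1 + M) * (96 * M ^ 4 / mu ^ 2) + 32 * M ^ 3 / mu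
  = (64 * M ^ 3 + 96 * M ^ 4 + 96 * M ^ 5) / mu by field; lra.
apply: Rmult_le_compat_r; first by apply/Rlt_le/Rinv_0_lt_compat.
have := Rle_pow M 3 5 M1 (ltac:(lia)); have := Rle_pow M 4 5 M1 (ltac:(lia)); lra.
Qed.

Lemma euler_exp_bound xi x : t <= xi -> norm (E xi x) <= exp M * norm x.
Proof.
move=> xt; have tp := euler_time_pos; have Hx : 0 < xi by lra.
have c0 : 0 <= M / xi by apply: Rmult_le_pos; [lra|apply/Rlt_le/Rinv_0_lt_compat].
apply: Rle_trans (euler_norm_le (M / xi) xi x c0 (fun y => rf_decay xi y Hx)) _.
apply: Rmult_le_compat_r; first exact: norm_nneg.
apply: exp_le_compat; apply: (Rmult_le_reg_r xi) => //.
have -> : t * (M / xi) * xi = t * M by field; lra.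
nra.
Qed.

Lemma euler_smoothing_large xi x :
  t <= xi -> norm (E xi (B xi x)) <= exp M * M / sqrt (xi * t) * norm x.
Proof.
move=> xt; have tp := euler_time_pos; have Hx : 0 < xi by lra.
have [mu0 Emu] := sqrt_time_bound xi Hx.
apply: Rle_trans (euler_exp_bound _ _ xt) _.
rewrite /Rdiv !Rmult_assoc; apply: Rmult_le_compat_l; first by apply/Rlt_le/exp_pos.
apply: Rle_trans (rf_decay _ _ Hx) _; rewrite -Rmult_assoc; apply: Rmult_le_compat_r; first exact: norm_nneg.
apply: Rmult_le_compat_l; first lra.
apply: Rinv_le_contravar => //; apply: Rsqr_incr_0_var; last lra.
by rewrite !Rsqr_pow2 Emu; nra.
Qed.

(** Induction on the number [J] of doublings that bring [xi] above [t], where the Euler power is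
    bounded and the resolvent alone decays fast enough. The costs form a geometric series dominated
    by the first one, so there is no logarithmic loss. *)
Lemma euler_smoothing xi x :
  16 * M ^ 2 * h <= xi -> norm (E xi (B xi x)) <= smoothing_constant / sqrt (xi * t) * norm x.
Proof.
move=> hM; have Hx := step_pos xi hM; have tp := euler_time_pos.
have [J HJ] : exists J, t <= 2 ^ J * xi.
  have [J HJ] := Pow_x_infinity 2 (ltac:(rewrite Rabs_pos_eq; lra)) (t / xi).
  exists J; have := HJ J (le_n J); rewrite Rabs_pos_eq; last by apply: pow_le; lra.
  move=> /Rge_le A; apply: (Rmult_le_reg_r (/ xi)); first exact: Rinv_0_lt_compat.
  by rewrite Rmult_assoc Rinv_r ?Rmult_1_r //; lra.
have e0 := exp_pos M; have M5 := pow_R1_Rle M 5 M1.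
elim: J xi Hx hM HJ => [|J IH] xi Hx hM HJ.
  have [mu0 _] := sqrt_time_bound xi Hx.
  apply: Rle_trans (euler_smoothing_large xi x (ltac:(move: HJ => /=; lra))) _.
  apply: Rmult_le_compat_r; first exact: norm_nneg.
  apply: Rmult_le_compat_r; first by apply/Rlt_le/Rinv_0_lt_compat.
  rewrite /smoothing_constant; lra.
have [mu0 Emu] := sqrt_time_bound xi Hx.
case: (Rle_lt_dec t xi) => [xt|/Rlt_le xt].
  apply: Rle_trans (euler_smoothing_large xi x xt) _.
  apply: Rmult_le_compat_r; first exact: norm_nneg.
  apply: Rmult_le_compat_r; first by apply/Rlt_le/Rinv_0_lt_compat.
  rewrite /smoothing_constant; lra.
have A := IH (2 * xi) (ltac:(lra)) (ltac:(lra)) (ltac:(move: HJ => /=; lra)).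
have D := euler_smoothing_difference xi x hM xt.
have -> : E xi (B xi x) = plus (E (2 * xi) (B (2 * xi) x))
    (minus (E xi (B xi x)) (E (2 * xi) (B (2 * xi) x))) by vec.
apply: Rle_trans (norm_triangle _ _) _; apply: Rle_trans (Rplus_le_compat _ _ _ _ A D) _.
rewrite -Rmult_plus_distr_r; apply: Rmult_le_compat_r; first exact: norm_nneg.
(* Here [1 / sqrt 2] is at most [3 / 4], which leaves a quarter of the constant for the current
   difference. *)
have half : / sqrt (2 * xi * t) <= 3 / 4 * / sqrt (xi * t).
  have [nu0 Enu] := sqrt_time_bound (2 * xi) (ltac:(lra)).
  have -> : 3 / 4 * / sqrt (xi * t) = / (4 / 3 * sqrt (xi * t)) by field; lra.
  apply: Rinv_le_contravar; first lra.
  apply: Rsqr_incr_0_var; last lra.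
  rewrite !Rsqr_pow2 Rpow_mult_distr Enu Emu; nra.
have C0 : 0 <= smoothing_constant by rewrite /smoothing_constant; nra.
have B1 := Rmult_le_compat_l _ _ _ C0 half.
have I0 : 0 < / sqrt (xi * t) by apply: Rinv_0_lt_compat.
have C1 : 256 * M ^ 5 <= smoothing_constant / 4 by rewrite /smoothing_constant; nra.
have B2 := Rmult_le_compat_r _ _ _ (Rlt_le _ _ I0) C1.
rewrite /Rdiv; lra.
Qed.

(** At [xi = s ^ 2 / t] the root [sqrt (xi * t)] equals [s]. If [s <= t] then [xi <= s], and [B s]
    is [B xi] composed with an operator of norm at most [2 M], so the smoothing bound applies. If
    [t <= s] then [t <= xi], the Euler power is bounded and [B s] itself provides [M / s]. *)
Lemma euler_resolvent_top s x :
  1 <= s -> 16 * M ^ 2 * h <= s ^ 2 / t ->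
  norm (E (s ^ 2 / t) (B s x)) <= 2 * M * smoothing_constant / s * norm x.
Proof.
move=> s1 hM; have tp := euler_time_pos; set xi := s ^ 2 / t in hM *.
have Hx := step_pos xi hM; have n0 := norm_nneg x.
have ts : xi * t = s ^ 2 by rewrite /xi; field; lra.
have e0 := exp_pos M; have M5 := pow_R1_Rle M 5 M1.
have Is : 0 < / s by apply: Rinv_0_lt_compat; lra.
case: (Rle_lt_dec s t) => [st|/Rlt_le st].
  have xs : xi <= s by apply: (Rmult_le_reg_r t) => //; rewrite ts; nra.
  rewrite (rf_shift xi s x); try lra.
  apply: Rle_trans (euler_smoothing xi _ hM) _.
  rewrite ts sqrt_pow2; last lra.
  have A : norm (plus x ((xi - s) *r B s x)) <= 2 * M * norm x.
    apply: Rle_trans (norm_triangle _ _) _; rewrite norm_rscal.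
    have D := rf_decay s x (ltac:(lra)).
    have : Rabs (xi - s) * norm (B s x) <= s * (M / s * norm x).
      apply: Rmult_le_compat; [exact: Rabs_pos|exact: norm_nneg| |exact: D].
      rewrite Rabs_left1; lra.
    have -> : s * (M / s * norm x) = M * norm x by field; lra.
    nra.
  have C0 : 0 <= smoothing_constant / s.
    by apply: Rmult_le_pos; [rewrite /smoothing_constant; nra|lra].
  apply: Rle_trans (Rmult_le_compat_l _ _ _ C0 A) _; apply: Req_le; field; lra.
have tx : t <= xi.
  apply: (Rmult_le_reg_r t) => //; rewrite ts; nra.
apply: Rle_trans (euler_exp_bound xi _ tx) _.
have D := rf_decay s x (ltac:(lra)).
apply: Rle_trans (Rmult_le_compat_l _ _ _ (Rlt_le _ _ e0) D) _.
have -> : exp M * (M / s * norm x) = exp M * M * / s * norm x by rewrite /Rdiv; ring.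
apply: Rmult_le_compat_r => //; apply: Rmult_le_compat_r; first lra.
have C0 : exp M * M <= smoothing_constant by rewrite /smoothing_constant; lra.
have : 0 < exp M * M by apply: Rmult_lt_0_compat; lra.
nra.
Qed.

(** Each halving of [xi] adds a dyadic difference applied to [B s x], whose norm is at most
    [M / s * norm x]; hence a cost [32 M^3 / s] per step. *)
Lemma euler_resolvent_dyadic s j x :
  1 <= s -> 16 * M ^ 2 * h <= s ^ 2 / t / 2 ^ j ->
  norm (E (s ^ 2 / t / 2 ^ j) (B s x))
  <= (2 * M * smoothing_constant + 32 * M ^ 3 * INR j) / s * norm x.
Proof.
move=> s1; have n0 := norm_nneg x; have tp := euler_time_pos.
have Is : 0 < / s by apply: Rinv_0_lt_compat; lra.
elim: j => [|j IH] hM.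
  have E0 : s ^ 2 / t / 2 ^ 0 = s ^ 2 / t by rewrite /=; field; lra.
  rewrite E0 in hM *; apply: Rle_trans (euler_resolvent_top s x s1 hM) _.
  by apply: Req_le; rewrite /=; field; lra.
set xi := s ^ 2 / t / 2 ^ S j in hM *; have Hx := step_pos xi hM.
have P2 : 0 < 2 ^ j by apply: pow_lt; lra.
have E2 : s ^ 2 / t / 2 ^ j = 2 * xi by rewrite /xi -(tech_pow_Rmult 2 j); field; lra.
rewrite E2 in IH; have {}IH := IH (ltac:(lra)).
have D := euler_dyadic_difference xi (B s x) hM.
have -> : E xi (B s x) = plus (E (2 * xi) (B s x)) (minus (E xi (B s x)) (E (2 * xi) (B s x))) by vec.
apply: Rle_trans (norm_triangle _ _) _; apply: Rle_trans (Rplus_le_compat _ _ _ _ IH D) _.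
have R := Rmult_le_compat_l (32 * M ^ 2) _ _ (ltac:(have := pow2_ge_0 M; lra)) (rf_decay s x (ltac:(lra))).
apply: Rle_trans (Rplus_le_compat_l _ _ _ R) _.
by apply: Req_le; rewrite S_INR; field; lra.
Qed.

(** [1 - h B_0 = (1 - h xi B_0 B_(xi - h)) (1 - h B_xi)], and the first factor is harmless since [xi <= 1 / t]. *)
Lemma euler_shift_to_zero xi x :
  16 * M ^ 2 * h <= xi -> xi * t <= 1 -> norm (E 0 x) <= exp (beta ^ 2) * norm (E xi x).
Proof.
move=> hM xt; have Hx := step_pos xi hM; have M2 := pow_R1_Rle M 2 M1.
have hx : h <= xi by nra.
have L0 := rf_linear _ _ _ RF 0 (Rle_refl 0).
pose Z y := minus y ((h * xi) *r B 0 (B (xi - h) y)).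
have S y : euler_step h (B 0) y = Z (euler_step h (B xi) y).
  have C : B (xi - h) (euler_step h (B xi) y) = B xi y.
    rewrite (rf_shift (xi - h) xi y); try lra.
    by congr (B _ _); rewrite /euler_step; vec.
  rewrite /Z C /euler_step.
  apply: ip_ext => z.
  have := f_equal (fun v => ip v z) (rf_equation _ _ _ RF 0 xi y (Rle_refl 0) (Rlt_le _ _ Hx)).
  rewrite /=; ipsimp => E1.
  have -> : ip (B 0 y) z = ip (B xi y) z + xi * ip (B 0 (B xi y)) z by lra.
  ring.
have Zlin : rlinear Z.
  have Lx := rf_linear _ _ _ RF (xi - h) (ltac:(lra)).
  by split=> [y z|r y]; rewrite /Z ?(proj1 Lx) ?(proj2 Lx) ?(proj1 L0) ?(proj2 L0); vec.
have ZC y : Z (euler_step h (B xi) y) = euler_step h (B xi) (Z y).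
  apply: euler_step_comm => // w; rewrite /Z (rlinear_minus _ _ _ (rf_linear _ _ _ RF xi _)); last lra.
  rewrite (proj2 (rf_linear _ _ _ RF xi _)); last lra.
  by rewrite (rf_commute xi 0) ?(rf_commute xi (xi - h)) //; lra.
have -> : E 0 x = Nat.iter N Z (E xi x).
  rewrite /E; elim: (N) => [//|n IH] /=.
  by rewrite IH S -iter_comm // => w; rewrite ZC.
have bb : 0 <= h * xi * beta ^ 2 by apply: Rmult_le_pos; [nra|exact: pow2_ge_0].
have ZB y : norm (Z y) <= (1 + h * xi * beta ^ 2) * norm y.
  apply: Rle_trans (norm_minus_le _ _) _; rewrite norm_rscal Rabs_pos_eq; last nra.
  have B1 := rf_bounded _ _ _ RF 0 (B (xi - h) y) (Rle_refl 0).
  have B2 := rf_bounded _ _ _ RF (xi - h) y (ltac:(lra)).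
  have : norm (B 0 (B (xi - h) y)) <= beta ^ 2 * norm y.
    have := norm_nneg y; have := norm_nneg (B (xi - h) y).
    have := norm_nneg (B 0 (B (xi - h) y)) => b1 b2 b3.
    case: (Rle_lt_dec 0 beta) => b0; first by nra.
    have : beta * norm (B (xi - h) y) <= 0 by nra.
    have := pow2_ge_0 beta; nra.
  move=> A; have := Rmult_le_compat_l (h * xi) _ _ (ltac:(nra)) A; lra.
apply: Rle_trans (iter_bound N Z (1 + h * xi * beta ^ 2) _ _ ZB) _; first lra.
apply: Rmult_le_compat_r; first exact: norm_nneg.
apply: Rle_trans (pow_le_exp _ N bb) _.
apply: exp_le_compat.
have -> : INR N * (h * xi * beta ^ 2) = xi * t * beta ^ 2 by rewrite /t; ring.
have := pow2_ge_0 beta; nra.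
Qed.

Lemma dyadic_bracket r : 1 <= r -> exists j, r <= 2 ^ j <= 2 * r.
Proof.
move=> r1.
have [J HJ] : exists J, r <= 2 ^ J.
  have [J HJ] := Pow_x_infinity 2 (ltac:(rewrite Rabs_pos_eq; lra)) r.
  exists J; have := HJ J (le_n J); rewrite Rabs_pos_eq; last by apply: pow_le; lra.
  lra.
elim: J HJ => [|J IH] HJ; first by exists O; move: HJ => /=; lra.
case: (Rle_lt_dec r (2 ^ J)) => [/IH //|L].
by exists (S J); rewrite -tech_pow_Rmult in HJ *; lra.
Qed.

(** The factor [exp (beta ^ 2)] pays for the shift to [0]; [160 = 32 * (1 + 4)] comes from at most
    [1 + 4 * ln s] halvings; the last term covers [t <= 1]. *)
Definition decay_constant : R :=
  exp (beta ^ 2) * (2 * M * smoothing_constant + 160 * M ^ 3) + exp beta * M.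

Lemma euler_resolvent_bound s x :
  1 <= s -> 0 <= beta -> 32 * M ^ 2 * h * t <= 1 ->
  norm (E 0 (B s x)) <= decay_constant * (1 + ln s) / s * norm x.
Proof.
move=> s1 b0 hM; have n0 := norm_nneg x; have tp := euler_time_pos.
have Is : 0 < / s by apply: Rinv_0_lt_compat; lra.
have ls : 0 <= ln s by rewrite -ln_1; case: s1 => [/(ln_increasing 1)|<-]; lra.
have e0 := exp_pos (beta ^ 2); have e1 := exp_pos beta; have e2 := exp_pos M.
have M3 := pow_R1_Rle M 3 M1; have M5 := pow_R1_Rle M 5 M1.
have C0 : 0 <= exp (beta ^ 2) * (2 * M * smoothing_constant + 160 * M ^ 3).
  by apply: Rmult_le_pos; [lra|rewrite /smoothing_constant; nra].
have C1 : 0 <= exp beta * M by nra.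
have red c : c <= decay_constant * (1 + ln s) -> c / s * norm x <= decay_constant * (1 + ln s) / s * norm x.
  by move=> A; apply: Rmult_le_compat_r => //; apply: Rmult_le_compat_r; lra.
have D := rf_decay s x (ltac:(lra)).
case: (Rle_lt_dec t 1) => [t1|/Rlt_le t1].
  apply: Rle_trans (euler_norm_le beta 0 _ b0 (fun y => rf_bounded _ _ _ RF 0 y (Rle_refl 0))) _.
  apply: Rle_trans _ (red (exp beta * M) _); last first.
    rewrite /decay_constant; nra.
  have -> : exp beta * M / s * norm x = exp beta * (M / s * norm x) by rewrite /Rdiv; ring.
  apply: Rmult_le_compat => //; [by apply/Rlt_le/exp_pos|exact: norm_nneg|].
  by apply: exp_le_compat; nra.
(* With this [j] the parameter [xi] lies between [1 / (2 t)] and [1 / t]. The upper bound permits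
   the shift to [0], and the lower one turns the hypothesis on [h * t] into the step condition at
   [xi]. *)
have [j [Hj1 Hj2]] := dyadic_bracket (s ^ 2) (ltac:(nra)).
have P2 : 0 < 2 ^ j by apply: pow_lt; lra.
set xi := s ^ 2 / t / 2 ^ j.
have xt : xi * t = s ^ 2 / 2 ^ j by rewrite /xi; field; lra.
have x1 : xi * t <= 1.
  rewrite xt; apply: (Rmult_le_reg_r (2 ^ j)) => //.
  have -> : s ^ 2 / 2 ^ j * 2 ^ j = s ^ 2 by field; lra.
  lra.
have x2 : / 2 <= xi * t.
  rewrite xt; apply: (Rmult_le_reg_r (2 ^ j)) => //.
  have -> : s ^ 2 / 2 ^ j * 2 ^ j = s ^ 2 by field; lra.
  lra.
have hx : 16 * M ^ 2 * h <= xi by apply: (Rmult_le_reg_r t) => //; lra.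
(* From [2 ^ j <= 2 * s ^ 2] one gets [j ln 2 <= ln 2 + 2 ln s], and [ln 2 > 1 / 2]. *)
have jln : INR j <= 1 + 4 * ln s.
  have := ln_le _ _ P2 Hj2.
  rewrite ln_pow; last lra.
  rewrite ln_mult; try nra.
  rewrite ln_pow; last lra.
  have := ln_lt_2; have := pos_INR j.
  have -> : INR 2 = 2 by []. 
  move=> A1 A2 A3.
  have L2 : ln 2 <= 1 by have := exp_ineq1_le (ln 2); rewrite exp_ln; lra.
  apply: (Rmult_le_reg_r (ln 2)); nra.
apply: Rle_trans (euler_shift_to_zero xi _ hx x1) _.
have T := euler_resolvent_dyadic s j x s1 hx.
apply: Rle_trans (Rmult_le_compat_l _ _ _ (Rlt_le _ _ e0) T) _.
apply: Rle_trans _ (red (exp (beta ^ 2) * (2 * M * smoothing_constant + 32 * M ^ 3 * INR j)) _).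
  by apply: Req_le; rewrite /Rdiv; ring.
have S0 : 0 <= 2 * M * smoothing_constant by rewrite /smoothing_constant; nra.
have : 2 * M * smoothing_constant + 32 * M ^ 3 * INR j
  <= (2 * M * smoothing_constant + 160 * M ^ 3) * (1 + ln s) by nra.
move=> A; have := Rmult_le_compat_l _ _ _ (Rlt_le _ _ e0) A.
rewrite /decay_constant; nra.
Qed.

End EulerBounds.
End ResolventFamily.

(** * The exponential as a limit of the Euler scheme *)

Section ExponentialLimit.
Context {H : HilbertSpace}.
Implicit Types (x y z : H) (D : H -> H).

Lemma sum_n_vsum (u : nat -> H) n : sum_n u n = vsum (S n) u.
Proof.
elim: n => [|n IH]; first by rewrite sum_O /=; vec.
by rewrite sum_Sn IH.
Qed.

Lemma vsum_norm_le n (u : nat -> H) b :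
  (forall k, (k < n)%nat -> norm (u k) <= b k) -> norm (vsum n u) <= rsum n b.
Proof.
elim: n => [|n IH] A /=.
  by rewrite norm_zero; lra.
apply: Rle_trans (norm_triangle _ _) _; apply: Rplus_le_compat; last by apply: A; lia.
by apply: IH => k Hk; apply: A; lia.
Qed.

(** [euler_coef m n k] is the coefficient of [X^k] in [(1 + X / m)^n]. *)
Fixpoint euler_coef (m : R) (n k : nat) : R :=
  match n, k with
  | O, O => 1
  | O, S _ => 0
  | S n', O => 1
  | S n', S k' => euler_coef m n' (S k') + euler_coef m n' k' / m
  end.

(** The Pascal recursion summed against an arbitrary sequence [a], so that one lemma yields both the
    operator expansion, with [a k = ip (Nat.iter k D x) z], and the scalar one, with
    [a k = c ^ k]. *)
Lemma rsum_euler_coef m n K (a : nat -> R) : (n < K)%nat ->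
  rsum (S K) (fun k => euler_coef m (S n) k * a k)
  = rsum K (fun k => euler_coef m n k * a k) + / m * rsum K (fun k => euler_coef m n k * a (S k)).
Proof.
have top l k : (l < k)%nat -> euler_coef m l k = 0.
  elim: l k => [|l IH] [|k] //= Hk; try lia.
  by rewrite !IH /Rdiv; try lia; ring.
move=> nK; rewrite rsum_front.
rewrite (rsum_ext K (fun k => euler_coef m (S n) (S k) * a (S k))
   (fun k => euler_coef m n (S k) * a (S k) + / m * (euler_coef m n k * a (S k)))); last first.
  by move=> k _ /=; rewrite /Rdiv; ring.
rewrite rsum_plus rsum_mult -Rplus_assoc; congr (_ + _).
have -> : euler_coef m (S n) 0 = euler_coef m n 0 by case: (n).
rewrite -(rsum_front K (fun k => euler_coef m n k * a k)) /= (top n K) //; ring.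
Qed.

Lemma euler_coef_expand D m n K x : rlinear D -> (n < K)%nat ->
  Nat.iter n (fun y => plus y ((/ m) *r D y)) x
  = vsum K (fun k => euler_coef m n k *r Nat.iter k D x).
Proof.
move=> LD nK; apply: ip_ext => z; rewrite ip_vsum.
rewrite (rsum_ext K _ (fun k => euler_coef m n k * ip (Nat.iter k D x) z)); last first.
  by move=> k _; ipsimp.
elim: n K x nK => [|n IH] [|K] x nK; try lia.
  by rewrite rsum_front /= -{1}(Rplus_0_r (ip x z)); congr (_ + _); [ring|
     rewrite (rsum_ext K _ (fun _ => 0)) ?rsum_const; [ring|move=> k _; ring]].
rewrite rsum_euler_coef; last lia.
have -> : Nat.iter (S n) (fun y => plus y ((/ m) *r D y)) x
  = Nat.iter n (fun y => plus y ((/ m) *r D y)) (plus x ((/ m) *r D x)).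
  by rewrite /= -(iter_comm n (fun y => plus y ((/ m) *r D y)) (fun y => plus y ((/ m) *r D y))).
rewrite (IH K) -?rsum_mult -?rsum_plus; last lia.
apply: rsum_ext => k _; have LI := iter_rlinear k D LD.
by rewrite (proj1 LI) (proj2 LI) (iter_comm k D D) //; ipsimp => /=; ring.
Qed.

Lemma euler_coef_expand_R (c m : R) n K : (n < K)%nat ->
  (1 + c / m) ^ n = rsum K (fun k => euler_coef m n k * c ^ k).
Proof.
elim: n K => [|n IH] [|K] nK; try lia.
  by rewrite rsum_front /= (rsum_ext K _ (fun _ => 0)) ?rsum_const; [ring|move=> k _; ring].
rewrite rsum_euler_coef -?(IH K); try lia.
rewrite (rsum_ext K (fun k => euler_coef m n k * c ^ S k) (fun k => c * (euler_coef m n k * c ^ k))); last first.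
  by move=> k _ /=; ring.
by rewrite rsum_mult -(IH K) /= /Rdiv; try lia; ring.
Qed.

Lemma bernoulli_pow_le a b k : 0 <= a -> 0 <= b ->
  a ^ S k + INR (S k) * a ^ k * b <= (a + b) ^ S k.
Proof.
move=> a0 b0; elim: k => [|k IH]; first by rewrite /=; lra.
rewrite -(tech_pow_Rmult (a + b)).
have A := Rmult_le_compat_l (a + b) _ _ (ltac:(lra)) IH; apply: Rle_trans _ A.
have ak : 0 <= a ^ k by apply: pow_le.
have Ik := pos_INR (S k).
have -> : a ^ S (S k) = a * (a * a ^ k) by [].
have -> : a ^ S k = a * a ^ k by [].
rewrite (S_INR (S k)).
have : 0 <= INR (S k) * a ^ k * (b * b) by do 2 ![apply: Rmult_le_pos => //]; nra.
nra.
Qed.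

(** For [m = n] the upper bound is the exponential coefficient [1 / k!]. Hence all coefficients of
    the exponential minus the Euler polynomial are nonnegative. *)
Lemma euler_coef_le m n k : 0 < m -> 0 <= euler_coef m n k <= (INR n / m) ^ k / INR (fact k).
Proof.
move=> m0; elim: n k => [|n IH] [|k].
- by rewrite /=; lra.
- by rewrite /= /Rdiv !Rmult_0_l; lra.
- by rewrite /=; lra.
have [A1 A2] := IH (S k); have [A3 A4] := IH k.
have mi : 0 < / m by apply: Rinv_0_lt_compat.
have nm : 0 <= INR n / m by apply: Rmult_le_pos; [exact: pos_INR|lra].
have fk := INR_fact_lt_0 k; have Sk : 0 < INR (S k) by apply: lt_0_INR; lia.
split; first by rewrite /= /Rdiv; nra.
have F : INR (fact (S k)) = INR (S k) * INR (fact k) by rewrite -mult_INR.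
apply: (Rle_trans _ (((INR n / m) ^ S k + INR (S k) * (INR n / m) ^ k * / m) / INR (fact (S k)))).
  have -> : ((INR n / m) ^ S k + INR (S k) * (INR n / m) ^ k * / m) / INR (fact (S k))
    = (INR n / m) ^ S k / INR (fact (S k)) + (INR n / m) ^ k / INR (fact k) / m.
    by rewrite F; field; lra.
  have -> : euler_coef m (S n) (S k) = euler_coef m n (S k) + euler_coef m n k / m by [].
  by apply: Rplus_le_compat => //; apply: Rmult_le_compat_r; lra.
apply: Rmult_le_compat_r; first by apply/Rlt_le/Rinv_0_lt_compat/INR_fact_lt_0.
have -> : INR (S n) / m = INR n / m + / m by rewrite S_INR /Rdiv; ring.
by apply: bernoulli_pow_le; lra.
Qed.

Lemma one_sub_pow_ge u n : 0 <= u <= 1 -> 1 - INR n * u <= (1 - u) ^ n.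
Proof.
move=> Hu; elim: n => [|n IH]; first by rewrite /=; lra.
have := Rmult_le_compat_l (1 - u) _ _ (ltac:(lra)) IH.
rewrite tech_pow_Rmult S_INR; have := pos_INR n; nra.
Qed.

(** With [u = c / n], the inequality [exp u * (1 - u) <= 1] gives [exp u * (1 - u ^ 2) <= 1 + u].
    Its [n]-th power and the Bernoulli inequality for [(1 - u ^ 2) ^ n] conclude, as
    [n * u ^ 2 = c ^ 2 / n]. *)
Lemma exp_sub_euler_le c n : (0 < n)%nat -> 0 <= c <= INR n ->
  exp c - (1 + c / INR n) ^ n <= exp c * c ^ 2 / INR n.
Proof.
move=> n0 Hc; have np : 0 < INR n by apply: lt_0_INR.
set u := c / INR n.
have ni : 0 < / INR n by apply: Rinv_0_lt_compat.
have u0 : 0 <= u by apply: Rmult_le_pos; lra.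
have u1 : u <= 1 by apply: (Rmult_le_reg_r (INR n)) => //; rewrite /u /Rdiv Rmult_assoc Rinv_l; lra.
have A : exp u * (1 - u ^ 2) <= 1 + u.
  have B := exp_ineq1_le (- u); have e0 := exp_pos u.
  have E : exp u * exp (- u) = 1 by rewrite -exp_plus Rplus_opp_r exp_0.
  have : exp u * (1 - u) <= 1 by rewrite -E; apply: Rmult_le_compat_l; lra.
  nra.
have P : exp c * (1 - u ^ 2) ^ n <= (1 + u) ^ n.
  have -> : exp c = exp u ^ n.
    have -> : c = INR n * u by rewrite /u; field; lra.
    elim: (n) => [|k IH]; first by rewrite /= Rmult_0_l exp_0.
    by rewrite S_INR Rmult_plus_distr_r Rmult_1_l exp_plus IH /=; ring.
  rewrite -Rpow_mult_distr; apply: pow_incr; split=> //.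
  by apply: Rmult_le_pos; [apply/Rlt_le/exp_pos|nra].
have Q := one_sub_pow_ge (u ^ 2) n (ltac:(nra)).
have := Rmult_le_compat_l _ _ _ (Rlt_le _ _ (exp_pos c)) Q.
have -> : exp c * (1 - INR n * u ^ 2) = exp c - exp c * c ^ 2 / INR n by rewrite /u; field; lra.
lra.
Qed.

Lemma rsum_exp_lim c : is_lim_seq (fun n => rsum n (fun k => c ^ k / INR (fact k))) (exp c).
Proof.
apply/is_lim_seq_incr_1; have := is_exp_Reals c; apply: filterlim_ext => n.
elim: n => [|n IH]; first by rewrite sum_O pow_n_pow /scal /= /mult /= /Rdiv; ring.
by rewrite sum_Sn IH [RHS]/= /plus /= pow_n_pow /scal /= /mult /= /Rdiv; ring.
Qed.

Lemma rsum_exp_le c n : 0 <= c -> rsum n (fun k => c ^ k / INR (fact k)) <= exp c.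
Proof.
move=> c0; apply: (is_lim_seq_incr_compare _ _ (rsum_exp_lim c)) => k /=.
have : 0 <= c ^ k / INR (fact k).
  by apply: Rmult_le_pos; [exact: pow_le|apply/Rlt_le/Rinv_0_lt_compat/INR_fact_lt_0].
lra.
Qed.

Lemma iter_term_bound D c k x : 0 <= c -> (forall y, norm (D y) <= c * norm y) ->
  norm (scal (RtoC (/ INR (fact k))) (Nat.iter k D x)) <= c ^ k / INR (fact k) * norm x.
Proof.
move=> c0 Dc; rewrite -/(rscal _ _) norm_rscal Rabs_pos_eq; last first.
  by apply/Rlt_le/Rinv_0_lt_compat/INR_fact_lt_0.
have := Rmult_le_compat_l _ _ _ (Rlt_le _ _ (Rinv_0_lt_compat _ (INR_fact_lt_0 k))) (iter_bound k D c x c0 Dc).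
rewrite /Rdiv; lra.
Qed.

(** Since [op_exp] is a description by [iota], its value is usable only once the series is known to
    converge and its sum to be unique. *)
Lemma op_exp_series D c x : 0 <= c -> (forall y, norm (D y) <= c * norm y) ->
  is_series (fun n => scal (RtoC (/ INR (fact n))) (Nat.iter n D x)) (op_exp D x).
Proof.
move=> c0 Dc.
have [l Hl] : ex_series (fun n => scal (RtoC (/ INR (fact n))) (Nat.iter n D x)).
  apply: (ex_series_le _ (fun n => scal (norm x) (c ^ n / INR (fact n)))) => [n|].
    by apply: Rle_trans (iter_term_bound D c n x c0 Dc) _; rewrite /scal /= /mult /=; lra.
  apply: ex_series_scal; exists (exp c).
  have := is_exp_Reals c; apply: is_series_ext => n.
  by rewrite pow_n_pow /scal /= /mult /=.
apply: (iota_correct (fun v => is_series _ v)); exists l; split=> // l' Hl'.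
exact: (filterlim_locally_unique _ _ _ Hl Hl').
Qed.

Lemma lim_norm_le (u : nat -> H) l b n0 :
  filterlim u eventually (locally l) -> (forall n, (n0 <= n)%nat -> norm (u n) <= b) -> norm l <= b.
Proof.
move=> L A; have := is_lim_seq_le_loc _ _ _ _ _ (lim_norm_seq u l L) (is_lim_seq_const b).
by apply; exists n0.
Qed.

Lemma op_exp_norm D c x : 0 <= c -> (forall y, norm (D y) <= c * norm y) ->
  norm (op_exp D x) <= exp c * norm x.
Proof.
move=> c0 Dc; apply: (lim_norm_le _ _ _ O (op_exp_series D c x c0 Dc)) => n _.
rewrite sum_n_vsum; apply: Rle_trans (vsum_norm_le _ _ _ (fun k _ => iter_term_bound D c k x c0 Dc)) _.
rewrite (rsum_ext _ _ (fun k => norm x * (c ^ k / INR (fact k)))); last by move=> k _; ring.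
by rewrite rsum_mult Rmult_comm; apply: Rmult_le_compat_r; [exact: norm_nneg|exact: rsum_exp_le].
Qed.

(** Because the coefficients of the difference are nonnegative, its norm is dominated term by term
    by the scalar difference [exp c - (1 + c / n) ^ n]. *)
Lemma op_exp_euler D c n x : rlinear D -> (forall y, norm (D y) <= c * norm y) ->
  (0 < n)%nat -> 0 <= c <= INR n ->
  norm (minus (op_exp D x) (Nat.iter n (fun y => plus y ((/ INR n) *r D y)) x))
  <= exp c * c ^ 2 / INR n * norm x.
Proof.
move=> LD Dc n0 [c0 cn]; set w := Nat.iter _ _ _.
have L : filterlim (fun k => minus (sum_n (fun k => scal (RtoC (/ INR (fact k))) (Nat.iter k D x)) k) w)
   eventually (locally (minus (op_exp D x) w)).
  have S : filterlim (sum_n (fun k => scal (RtoC (/ INR (fact k))) (Nat.iter k D x))) eventually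
    (locally (op_exp D x)) := op_exp_series D c x c0 Dc.
  exact: (filterlim_comp_2 _ _ plus S (filterlim_const (opp w)) (filterlim_plus (V := H) (op_exp D x) (opp w))).
apply: (lim_norm_le _ _ _ n L) => k Hk.
have np : 0 < INR n by apply: lt_0_INR.
rewrite sum_n_vsum /w (euler_coef_expand D (INR n) n (S k)) //; last lia.
have -> : minus (vsum (S k) (fun k => scal (RtoC (/ INR (fact k))) (Nat.iter k D x)))
    (vsum (S k) (fun k => euler_coef (INR n) n k *r Nat.iter k D x))
  = vsum (S k) (fun k => (/ INR (fact k) - euler_coef (INR n) n k) *r Nat.iter k D x).
  apply: ip_ext => z; move: (S k) => m; ipsimp; rewrite !ip_vsum.
  elim: m => [|j IH] /=; first by ring.
  have R4 p1 p2 p3 p4 : p1 + p2 - (p3 + p4) = p1 - p3 + (p2 - p4) by ring.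
  by rewrite R4 IH -/(rscal _ _); ipsimp; congr (_ + _); ring.
have T j : (j < S k)%nat -> norm ((/ INR (fact j) - euler_coef (INR n) n j) *r Nat.iter j D x)
   <= norm x * (c ^ j / INR (fact j) + (-1) * (euler_coef (INR n) n j * c ^ j)).
  move=> _; have [E1 E2] := euler_coef_le (INR n) n j np.
  have -> : norm x * (c ^ j / INR (fact j) + -1 * (euler_coef (INR n) n j * c ^ j))
    = (/ INR (fact j) - euler_coef (INR n) n j) * (c ^ j * norm x) by rewrite /Rdiv; ring.
  move: E2; rewrite /Rdiv Rinv_r ?pow1; last lra.
  rewrite Rmult_1_l => E2; rewrite norm_rscal Rabs_pos_eq; last lra.
  by apply: Rmult_le_compat_l; [lra|exact: iter_bound].
apply: Rle_trans (vsum_norm_le _ _ _ T) _.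
rewrite rsum_mult rsum_plus rsum_mult -(euler_coef_expand_R c (INR n) n); last lia.
rewrite Rmult_comm; apply: Rmult_le_compat_r; first exact: norm_nneg.
have A1 := rsum_exp_le c (S k) c0; have A2 := exp_sub_euler_le c n n0 (conj c0 cn).
lra.
Qed.

Lemma op_exp_is_linear D : is_linear D -> is_linear (op_exp D).
Proof.
move=> LD; have [c [c0 Dc]] := linear_norm _ LD; have c0' := Rlt_le _ _ c0.
have S x := op_exp_series D c x c0' Dc.
have ID n x y : Nat.iter n D (plus x y) = plus (Nat.iter n D x) (Nat.iter n D y).
  by elim: n => [//|n IH] /=; rewrite IH (linear_plus _ LD).
have IZ n (a : C) x : Nat.iter n D (scal a x) = scal a (Nat.iter n D x).
  by elim: n => [//|n IH] /=; rewrite IH (linear_scal _ LD).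
split.
- move=> x y; apply: (filterlim_locally_unique _ _ _ (S (plus x y))).
  apply: filterlim_ext (is_series_plus _ _ _ _ (S x) (S y)) => n.
  by apply: sum_n_ext => k; rewrite ID scal_distr_l.
- move=> a x; apply: (filterlim_locally_unique _ _ _ (S (scal a x))).
  apply: filterlim_ext (is_series_scal a _ _ (S x)) => n.
  apply: sum_n_ext => k; rewrite IZ !scal_assoc; congr (scal _ _); exact: Cmult_comm.
- exists (exp c); split; first exact: exp_pos.
  by move=> x; apply: op_exp_norm.
Qed.

End ExponentialLimit.

(** * Resolvents of the generator of a bounded semigroup *)

Lemma Cmod_re_ge (z : C) : Re z <= Cmod z.
Proof.
have := Rmax_Cmod z; have := Rmax_l (Rabs (fst z)) (Rabs (snd z)); have := Rle_abs (fst z).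
rewrite /Re; lra.
Qed.

Section ComplexScalars.
Context {H : HilbertSpace}.
Implicit Types x y w : H.

Lemma inner_ext x y : (forall w, inner H x w = inner H y w) -> x = y.
Proof. by move=> E; apply: ip_ext => w; rewrite /ip E. Qed.

Lemma inner_opp_l x y : inner H (opp x) y = Copp (inner H x y).
Proof. by rewrite opp_rscal /rscal inner_scal_l; apply: injective_projections => /=; ring. Qed.

Lemma inner_minus_l x y w : inner H (minus x y) w = Cminus (inner H x w) (inner H y w).
Proof. by rewrite /minus inner_plus_l inner_opp_l. Qed.

Lemma inner_zero_l y : inner H zero y = RtoC 0.
Proof.
have -> : (zero : H) = scal (RtoC 0) zero by rewrite (scal_zero_r (K := C_Ring)).
rewrite inner_scal_l; ring.
Qed.

End ComplexScalars.

Ltac cvec := apply: inner_ext; let w := fresh "w" in intro w;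
  rewrite ?(inner_plus_l, inner_minus_l, inner_opp_l, inner_scal_l, inner_zero_l); ring.

Section Resolvents.
Context {H : HilbertSpace}.
Implicit Types (x y w : H) (A : operator H) (z : C).

Lemma norm_cscal (a : C) x : norm (scal a x) = Cmod a * norm x.
Proof.
have E : norm (scal a x) ^ 2 = (Cmod a * norm x) ^ 2.
  rewrite -ip_norm /ip inner_scal_l inner_scal_r inner_norm Rpow_mult_distr.
  rewrite /Cmod pow2_sqrt; first by rewrite /Re /=; ring.
  by apply: Rplus_le_le_0_compat; apply: pow2_ge_0.
apply: Rsqr_inj; [exact: norm_nneg| |by rewrite !Rsqr_pow2].
by apply: Rmult_le_pos; [exact: Cmod_ge_0|exact: norm_nneg].
Qed.

Lemma is_linear_rlinear (f : H -> H) : is_linear f -> rlinear f.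
Proof. by move=> L; split=> [x y|r x]; [exact: linear_plus|exact: linear_scal]. Qed.

Lemma is_series_linear (f : H -> H) (a : nat -> H) (l : H) :
  is_linear f -> is_series a l -> is_series (fun n => f (a n)) (f l).
Proof.
move=> L S; apply: filterlim_ext (filterlim_comp _ _ _ (sum_n a) f _ _ _ S (linear_cont f l L)) => n.
by elim: n => [|n IH]; rewrite ?sum_O // !sum_Sn (linear_plus _ L) IH.
Qed.

(** The hypothesis bounds the powers and not [D] itself, because the resolvents are contractive only
    in an equivalent norm: the constant [M] of the equivalence may exceed [1] but occurs once for
    all powers. *)
Lemma neumann_series (D : H -> H) (M rho : R) :
  is_linear D -> 0 <= rho < 1 -> 0 <= M ->
  (forall n x, norm (Nat.iter n D x) <= M * rho ^ n * norm x) ->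
  exists K, is_linear K /\ (forall x, minus (K x) (D (K x)) = x) /\
    (forall x, K (minus x (D x)) = x) /\ (forall x, norm (K x) <= M / (1 - rho) * norm x).
Proof.
move=> LD Hr M0 PB.
have LI n : is_linear (Nat.iter n D).
  elim: n => [|n IH]; first exact: is_linear_id.
  exact: (is_linear_comp _ _ IH LD).
have [K HK] : exists K : H -> H, forall x, is_series (fun n => Nat.iter n D x) (K x).
  suff /choice [K HK] : forall x, exists l : H, is_series (fun n => Nat.iter n D x) l by exists K.
  move=> x; apply: (ex_series_le _ (fun n => scal (M * norm x) (rho ^ n))) => [n|].
    by apply: Rle_trans (PB n x) _; rewrite /scal /= /mult /=; lra.
  by apply: ex_series_scal; exists (/ (1 - rho)); apply: is_series_geom; rewrite Rabs_pos_eq; lra.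
have KB x : norm (K x) <= M / (1 - rho) * norm x.
  apply: (lim_norm_le _ _ _ O (HK x)) => n _; rewrite sum_n_vsum.
  apply: Rle_trans (vsum_norm_le _ _ _ (fun k _ => PB k x)) _.
  rewrite (rsum_ext _ _ (fun k => (M * norm x) * rho ^ k)); last by move=> k _; ring.
  rewrite (rsum_mult _ _ (fun k => rho ^ k)); have G := rsum_geometric_le (S n) rho Hr.
  have P : 0 <= M * norm x by apply: Rmult_le_pos => //; exact: norm_nneg.
  have := Rmult_le_compat_l _ _ _ P G => G2.
  apply: (Rmult_le_reg_l (1 - rho)); first lra.
  have -> : (1 - rho) * (M / (1 - rho) * norm x) = M * norm x * 1 by field; lra.
  by apply: Rle_trans _ G2; apply: Req_le; ring.
have LK : is_linear K.
  split.
  - move=> x y; apply: (filterlim_locally_unique _ _ _ (HK (plus x y))).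
  apply: filterlim_ext (is_series_plus _ _ _ _ (HK x) (HK y)) => n.
  by apply: sum_n_ext => k; rewrite (linear_plus _ (LI k)).
  - move=> a x; apply: (filterlim_locally_unique _ _ _ (HK (scal a x))).
    apply: filterlim_ext (is_series_scal a _ _ (HK x)) => n.
  by apply: sum_n_ext => k; rewrite (linear_scal _ (LI k)).
  - exists (M / (1 - rho) + 1); split.
    have : 0 <= M / (1 - rho) by apply: Rmult_le_pos => //; apply/Rlt_le/Rinv_0_lt_compat; lra.
    lra.
  by move=> x; have := KB x; have := norm_nneg x; nra.
have KDs x : is_series (fun n => D (Nat.iter n D x)) (D (K x)) by apply: is_series_linear.
have KD x : K (D x) = D (K x).
  apply: (filterlim_locally_unique _ _ _ (HK (D x))).
  by apply: is_series_ext (KDs x) => n; rewrite (iter_comm n D D).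
have KE x : K x = plus x (D (K x)).
  apply: (filterlim_locally_unique _ _ _ (HK x)).
  apply: is_series_decr_1 => /=.
  by have -> : plus (plus x (D (K x))) (opp x) = D (K x) by cvec.
exists K; split; [|split; [|split]] => //.
- by move=> x; rewrite {1}(KE x); cvec.
- by move=> x; rewrite (linear_minus _ _ _ LK) KD {1}(KE x); cvec.
Qed.

Definition resolvent_at A z (S : H -> H) : Prop :=
  is_linear S /\ (forall y, op_dom A (S y) /\ minus (scal z (S y)) (A (S y)) = y) /\
  (forall x, op_dom A x -> S (minus (scal z x) (A x)) = x).

(** One has [z - A = (1 - (z0 - z) S0) (z0 - A)], and [K] inverts the first factor. *)
Lemma resolvent_at_perturb A z0 z S0 (M rho : R) :
  resolvent_at A z0 S0 -> 0 <= rho < 1 -> 0 <= M ->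
  (forall n x, norm (Nat.iter n (fun y => scal (Cminus z0 z) (S0 y)) x) <= M * rho ^ n * norm x) ->
  exists K, (forall y, norm (K y) <= M / (1 - rho) * norm y) /\ resolvent_at A z (fun y => S0 (K y)).
Proof.
move=> [L0 [R0 I0]] Hr M0 PB.
have LD : is_linear (fun y : H => scal (Cminus z0 z) (S0 y)).
  by apply: (is_linear_comp _ _ L0); apply: is_linear_scal_r => a b; exact: Cmult_comm.
have [K [LK [K1 [K2 KB]]]] := neumann_series _ M rho LD Hr M0 PB.
exists K; split=> //; split; [exact: is_linear_comp|split].
- move=> y; have [Dy Ey] := R0 (K y); split=> //.
  apply: inner_ext => v.
  have E1 := f_equal (fun u => inner H u v) (K1 y); have E2 := f_equal (fun u => inner H u v) Ey.
  move: E1 E2; rewrite /= !inner_minus_l !inner_scal_l => <- <-; ring.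
- move=> x Dx; have E := I0 x Dx; rewrite -[RHS]E; congr S0.
  rewrite -[RHS](K2 (minus (scal z0 x) (A x))); congr K.
  by rewrite E; cvec.
Qed.

Lemma resolvent_at_unique A z S x y :
  resolvent_at A z S -> op_dom A x -> minus (scal z x) (A x) = y -> x = S y.
Proof. by move=> [_ [_ I]] Dx <-; rewrite I. Qed.

Lemma resolvent_correct A z : resolvent_set A z -> resolvent_at A z (resolvent A z).
Proof.
move=> [S HS].
have E y : resolvent A z y = S y.
  apply: iota_unique => [x [Dx Ex]|]; first exact: (resolvent_at_unique A z).
  by have [_ [R _]] := HS; exact: R.
have [L [R I]] := HS; split; first by apply: is_linear_ext L => y; rewrite E.
by split=> [y|x Dx]; rewrite E //; auto.
Qed.

Lemma resolvent_identity A z z' S T y :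
  resolvent_at A z S -> resolvent_at A z' T ->
  minus (S y) (T y) = scal (Cminus z' z) (S (T y)).
Proof.
move=> HS HT; have [LS [RS IS]] := HS; have [_ [RT _]] := HT; have [Dt Et] := RT y.
have E := IS _ Dt.
rewrite -[X in minus _ X]E -(linear_minus _ _ _ LS) -(linear_scal _ LS); congr S.
by rewrite -{1}Et; cvec.
Qed.

Lemma op_inv_resolvent A y : resolvent_set A (RtoC 0) -> op_inv A y = resolvent A (RtoC 0) (opp y).
Proof.
move=> R0; have HR := resolvent_correct A _ R0; have [L [R I]] := HR.
have [Dx Ex] := R (opp y).
apply: iota_unique => [x [Dx' Ex']|].
  apply: (resolvent_at_unique A _ _ _ _ HR) => //; rewrite Ex'; cvec.
split=> //; apply: inner_ext => v; have := f_equal (fun u => inner H u v) Ex.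
rewrite /= inner_minus_l inner_scal_l inner_opp_l => E.
have -> : inner H y v = Copp (Copp (inner H y v)) by ring.
by rewrite -E; ring.
Qed.

End Resolvents.

Lemma RtoC_m1 : RtoC (-1) = Copp (RtoC 1).
Proof. by rewrite -RtoC_opp. Qed.

(** * The open left half-plane in the resolvent set, through an equivalent contractive norm *)

Section HalfPlane.
Context {H : HilbertSpace} (A : operator H) (T : R -> H -> H) (M : R).
Implicit Types (x y : H) (z lam : C).
Hypothesis SG : C0_semigroup T.
Hypothesis M1 : 1 <= M.
Hypothesis TM : forall t, 0 <= t -> forall x, norm (T t x) <= M * norm x.
Hypothesis GA : is_generator T (op_opp A).
Hypothesis R0 : resolvent_set A (RtoC 0).

(** The norm [sup_(t >= 0) norm (T t x)], for which the semigroup is contractive. *)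
Definition orbit_norm (tn : H -> R) : Prop :=
  forall x, (forall t, 0 <= t -> norm (T t x) <= tn x) /\
            (forall c, (forall t, 0 <= t -> norm (T t x) <= c) -> tn x <= c).

Lemma orbit_norm_exists : exists tn, orbit_norm tn.
Proof.
suff /choice [tn Htn] : forall x, exists r, (forall t, 0 <= t -> norm (T t x) <= r) /\
     (forall c, (forall t, 0 <= t -> norm (T t x) <= c) -> r <= c) by exists tn.
move=> x.
have [r [r1 r2]] : {r | is_lub (fun s => exists t, 0 <= t /\ s = norm (T t x)) r}.
  apply: completeness; first by exists (M * norm x) => s [t [t0 ->]]; exact: TM.
  by exists (norm (T 0 x)), 0; split; [lra|].
exists r; split=> [t t0|c Hc]; first by apply: r1; exists t.
by apply: r2 => s [t [t0 ->]]; exact: Hc.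
Qed.

Variable tn : H -> R.
Hypothesis TN : orbit_norm tn.

Lemma norm_le_orbit x : norm x <= tn x.
Proof. by have := proj1 (TN x) 0 (Rle_refl 0); rewrite (sg_zero _ SG). Qed.

Lemma orbit_le_norm x : tn x <= M * norm x.
Proof. by apply: (proj2 (TN x)) => t t0; exact: TM. Qed.

Lemma orbit_nneg x : 0 <= tn x.
Proof. exact: Rle_trans (norm_nneg x) (norm_le_orbit x). Qed.

Lemma orbit_triangle x y : tn (plus x y) <= tn x + tn y.
Proof.
apply: (proj2 (TN _)) => t t0; rewrite (linear_plus _ (sg_linear _ SG t t0)).
by apply: Rle_trans (norm_triangle _ _) _; apply: Rplus_le_compat; apply: (proj1 (TN _)).
Qed.

Lemma orbit_scal_le (a : C) x : tn (scal a x) <= Cmod a * tn x.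
Proof.
apply: (proj2 (TN _)) => t t0; rewrite (linear_scal _ (sg_linear _ SG t t0)) norm_cscal.
by apply: Rmult_le_compat_l; [exact: Cmod_ge_0|exact: (proj1 (TN _))].
Qed.

Lemma orbit_scal_ge (a : C) x : Cmod a * tn x <= tn (scal a x).
Proof.
case: (Rle_lt_or_eq_dec 0 (Cmod a) (Cmod_ge_0 a)) => [P|<-]; last first.
  by rewrite Rmult_0_l; exact: orbit_nneg.
apply: (Rmult_le_reg_l (/ Cmod a)); first exact: Rinv_0_lt_compat.
rewrite -Rmult_assoc Rinv_l ?Rmult_1_l; last lra.
apply: (proj2 (TN _)) => t t0; apply: (Rmult_le_reg_l (Cmod a)) => //.
rewrite -Rmult_assoc Rinv_r ?Rmult_1_l; last lra.
by rewrite -norm_cscal -(linear_scal _ (sg_linear _ SG t t0)); exact: (proj1 (TN _)).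
Qed.

Lemma orbit_semigroup h x : 0 <= h -> tn (T h x) <= tn x.
Proof.
move=> h0; apply: (proj2 (TN _)) => t t0.
by rewrite -(sg_plus _ SG) //; apply: (proj1 (TN _)); lra.
Qed.

(** The generator is dissipative for the orbit norm: [(1 + h lam) x = T_h x + h (A + lam) x + o(h)]. *)
Lemma orbit_dissipative lam x : op_dom A x ->
  Re lam * tn x <= tn (plus (A x) (scal lam x)).
Proof.
move=> Dx; set y := plus _ _.
have G := proj1 (GA x (opp (A x))) (conj Dx eq_refl).
apply: Rnot_lt_le => L.
have M0 : 0 < M by lra.
have e0 : 0 < (Re lam * tn x - tn y) / (2 * M) by apply: Rdiv_lt_0_compat; lra.
have [d Hd] := G _ (locally_le_locally_norm _ _ (locally_norm_ball_norm _ (mkposreal _ e0))).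
set h := d / 2; have h0 : 0 < h by rewrite /h; have := cond_pos d; lra.
have B : ball 0 d h.
  rewrite /ball /= /AbsRing_ball /abs /minus /plus /opp /= Ropp_0 Rplus_0_r Rabs_pos_eq; last lra.
  by rewrite /h; have := cond_pos d; lra.
have {Hd} := Hd h B h0.
set e := minus (scal (RtoC (/ h)) (minus (T h x) x)) (opp (A x)).
rewrite /ball_norm /= -/e => He.
have E : scal (Cplus (RtoC 1) (Cmult (RtoC h) lam)) x
   = plus (plus (T h x) (scal (RtoC h) y)) (scal (RtoC (- h)) e).
  have hi : Cmult (RtoC (- h)) (RtoC (/ h)) = RtoC (-1).
    by rewrite -RtoC_mult; congr RtoC; field; lra.
  have -> : scal (RtoC (- h)) e
    = minus (scal (Cmult (RtoC (- h)) (RtoC (/ h))) (minus (T h x) x)) (scal (RtoC h) (A x)).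
    by rewrite /e RtoC_opp; cvec.
  by rewrite hi /y RtoC_m1; cvec.
have A1 := orbit_scal_ge (Cplus (RtoC 1) (Cmult (RtoC h) lam)) x.
rewrite E in A1.
have A2 := Rle_trans _ _ _ A1 (orbit_triangle _ _).
have A3 := orbit_triangle (T h x) (scal (RtoC h) y).
have A4 := orbit_semigroup h x (Rlt_le _ _ h0).
have A5 := orbit_scal_le (RtoC h) y; rewrite Cmod_R Rabs_pos_eq in A5; last lra.
have A6 := Rle_trans _ _ _ (orbit_scal_le (RtoC (- h)) e)
  (Rmult_le_compat_l _ _ _ (Cmod_ge_0 _) (orbit_le_norm e)).
rewrite Cmod_R Rabs_Ropp Rabs_pos_eq in A6; last lra.
have A7 : (1 + h * Re lam) * tn x <= Cmod (Cplus (RtoC 1) (Cmult (RtoC h) lam)) * tn x.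
  apply: Rmult_le_compat_r; first exact: orbit_nneg.
  apply: Rle_trans _ (Cmod_re_ge _); apply: Req_le; rewrite /Re /=; ring.
have A8 : h * (M * norm e) <= h * ((Re lam * tn x - tn y) / 2).
  apply: Rmult_le_compat_l; first lra.
  have -> : (Re lam * tn x - tn y) / 2 = M * ((Re lam * tn x - tn y) / (2 * M)) by field; lra.
  by apply: Rmult_le_compat_l; lra.
nra.
Qed.

(** Dissipativity is applied to [S y] with [lam = - z], where [(A - z) S y = - y]. *)
Lemma resolvent_orbit_bound z S y :
  resolvent_at A z S -> - Re z * tn (S y) <= tn y.
Proof.
move=> [_ [RS _]]; have [Ds Es] := RS y.
have A1 := orbit_dissipative (Copp z) _ Ds.
have A2 := orbit_scal_le (RtoC (-1)) y.
have E : plus (A (S y)) (scal (Copp z) (S y)) = scal (RtoC (-1)) y.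
  by rewrite -{3}Es RtoC_m1; cvec.
rewrite E in A1; rewrite Cmod_R Rabs_Ropp Rabs_R1 in A2.
have -> : - Re z = Re (Copp z) by [].
lra.
Qed.

(** The iteration takes place in the orbit norm, where no constant is lost; [M] appears once, on
    comparing with the original norm. *)
Lemma resolvent_iter_bound z0 z S n x :
  resolvent_at A z0 S -> Re z0 < 0 ->
  norm (Nat.iter n (fun y => scal (Cminus z0 z) (S y)) x)
  <= M * (Cmod (Cminus z0 z) / - Re z0) ^ n * norm x.
Proof.
move=> HS z0n; have r0 : 0 <= Cmod (Cminus z0 z) / - Re z0.
  by apply: Rmult_le_pos; [exact: Cmod_ge_0|apply/Rlt_le/Rinv_0_lt_compat; lra].
have S1 y : tn (scal (Cminus z0 z) (S y)) <= Cmod (Cminus z0 z) / - Re z0 * tn y.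
  apply: Rle_trans (orbit_scal_le _ _) _.
  rewrite /Rdiv Rmult_assoc; apply: Rmult_le_compat_l; first exact: Cmod_ge_0.
  apply: (Rmult_le_reg_l (- Re z0)); first lra.
  rewrite -Rmult_assoc Rinv_r ?Rmult_1_l; last lra.
  exact: resolvent_orbit_bound.
have In : tn (Nat.iter n (fun y => scal (Cminus z0 z) (S y)) x) <= (Cmod (Cminus z0 z) / - Re z0) ^ n * tn x.
  elim: n => [|n IH]; first by rewrite /=; lra.
  rewrite [Nat.iter _ _ _]/= -tech_pow_Rmult Rmult_assoc; apply: Rle_trans (S1 _) _.
  exact: Rmult_le_compat_l.
apply: Rle_trans (norm_le_orbit _) _; apply: Rle_trans In _.
rewrite (Rmult_comm M) Rmult_assoc; apply: Rmult_le_compat_l; first exact: pow_le.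
exact: orbit_le_norm.
Qed.

Lemma resolvent_set_disc z0 z :
  resolvent_set A z0 -> Re z0 < 0 -> Cmod (Cminus z0 z) < - Re z0 -> resolvent_set A z.
Proof.
move=> /resolvent_correct HS z0n Hz.
have [||//|K [_ HK]] := resolvent_at_perturb A z0 z _ M (Cmod (Cminus z0 z) / - Re z0) HS.
- split.
    by apply: Rmult_le_pos; [exact: Cmod_ge_0|apply/Rlt_le/Rinv_0_lt_compat; lra].
  apply: (Rmult_lt_reg_r (- Re z0)); first lra.
  by rewrite /Rdiv Rmult_assoc Rinv_l; lra.
- lra.
- by move=> n x; exact: resolvent_iter_bound.
by eexists; exact: HK.
Qed.

Lemma resolvent_set_near_zero : exists delta, 0 < delta /\ forall z, Cmod z <= delta -> resolvent_set A z.
Proof.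
have HS := resolvent_correct A _ R0; have [c [c0 Bc]] := linear_norm _ (proj1 HS).
exists (/ (2 * c)); split; first by apply: Rinv_0_lt_compat; lra.
move=> z Hz.
have Hr : Cmod (Cminus (RtoC 0) z) * c <= / 2.
  have -> : Cmod (Cminus (RtoC 0) z) = Cmod z.
    by rewrite -(Cmod_opp z); congr Cmod; ring.
  apply: (Rle_trans _ (/ (2 * c) * c)); first by apply: Rmult_le_compat_r; lra.
  by apply: Req_le; field; lra.
have P : 0 <= Cmod (Cminus (RtoC 0) z) * c by apply: Rmult_le_pos; [exact: Cmod_ge_0|lra].
have [||//|K [_ HK]] := resolvent_at_perturb A (RtoC 0) z _ 1 (Cmod (Cminus (RtoC 0) z) * c) HS.
- lra.
- lra.
- move=> n x; rewrite Rmult_1_l; apply: iter_bound => // y.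
  by rewrite norm_cscal Rmult_assoc; apply: Rmult_le_compat_l; [exact: Cmod_ge_0|exact: Bc].
by eexists; exact: HK.
Qed.

Lemma resolvent_set_left_half_plane z : Re z < 0 -> resolvent_set A z.
Proof.
move=> zn; have [d [d0 Hd]] := resolvent_set_near_zero.
(* The discs centred at [- d (3 / 2)^k] and touching the imaginary axis exhaust the half-plane, and each contains the next centre. *)
have axis k : resolvent_set A (RtoC (- (d * (3 / 2) ^ k))).
  elim: k => [|k IH].
    by apply: Hd; rewrite Cmod_R Rabs_Ropp Rabs_pos_eq /=; lra.
  have p : 0 < (3 / 2) ^ k by apply: pow_lt; lra.
  apply: resolvent_set_disc IH _ _; first by rewrite /Re /=; nra.
  rewrite -RtoC_minus Cmod_R -tech_pow_Rmult Rabs_pos_eq /Re /=; nra.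
(* The disc of radius [n] about [- n] contains [z] exactly when [norm z ^ 2 < - 2 n Re z], so a
   large centre suffices. *)
have [k Hk] : exists k, Cmod z ^ 2 / (- 2 * Re z) < d * (3 / 2) ^ k.
  have [k /(_ k (le_n k))] := Pow_x_infinity (3 / 2) (ltac:(rewrite Rabs_pos_eq; lra))
     (Cmod z ^ 2 / (- 2 * Re z) / d + 1).
  rewrite Rabs_pos_eq; last by apply: pow_le; lra.
  move=> /Rge_le A1; exists k; have := Rmult_le_compat_l _ _ _ (Rlt_le _ _ d0) A1.
  have -> : d * (Cmod z ^ 2 / (-2 * Re z) / d + 1) = Cmod z ^ 2 / (-2 * Re z) + d by field; lra.
  lra.
apply: (resolvent_set_disc _ _ (axis k)).
  have p : 0 < (3 / 2) ^ k by apply: pow_lt; lra.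
  by rewrite /Re /=; nra.
set n := d * (3 / 2) ^ k in Hk *.
have n0 : 0 < n by apply: Rmult_lt_0_compat => //; apply: pow_lt; lra.
have A1 : Cmod z ^ 2 < n * (- 2 * Re z).
  apply: (Rmult_lt_reg_r (/ (- 2 * Re z))); first by apply: Rinv_0_lt_compat; lra.
  by rewrite Rmult_assoc Rinv_r; lra.
have -> : - Re (RtoC (- n)) = n by rewrite /Re /=; ring.
apply: Rsqr_incrst_0; [|exact: Cmod_ge_0|lra].
rewrite !Rsqr_pow2.
have E (u : C) : Cmod u ^ 2 = Re u ^ 2 + Im u ^ 2.
  by rewrite /Cmod pow2_sqrt //; apply: Rplus_le_le_0_compat; exact: pow2_ge_0.
move: A1; rewrite !E /Re /Im /=; nra.
Qed.

End HalfPlane.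

(** * The bound for the exponential *)

Lemma le_of_le_add_inv_nat a b K n0 :
  (forall n, (n0 <= n)%nat -> a <= b + K / INR n) -> a <= b.
Proof.
move=> A; apply: (le_of_le_add_inv a b (2 * Rabs K) (INR n0 + 1)) => lam Hl l0.
have [n [Hn1 Hn2]] : exists n, INR n <= lam < INR n + 1 by have [n Hn] := nfloor_ex lam (Rlt_le _ _ l0); exists n.
have n0n : (n0 <= n)%nat by apply: INR_le; lra.
have := A n n0n; have n1 : 1 <= INR n.
  have : (0 < n)%nat by apply: INR_lt; rewrite [INR 0]/=; have := pos_INR n0; lra.
  by move=> /(le_INR 1).
have : K / INR n <= 2 * Rabs K / lam.
  apply: (Rle_trans _ (Rabs K * / INR n)).
    by apply: Rmult_le_compat_r; [apply/Rlt_le/Rinv_0_lt_compat; lra|exact: Rle_abs].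
  have -> : 2 * Rabs K / lam = Rabs K * / (lam / 2) by field; lra.
  apply: Rmult_le_compat_l; [exact: Rabs_pos|apply: Rinv_le_contravar; lra].
lra.
Qed.

Section ExponentialBound.
Context {H : HilbertSpace}.
Implicit Types x y : H.

Lemma iter_ext n (f g : H -> H) x : (forall y, f y = g y) -> Nat.iter n f x = Nat.iter n g x.
Proof. by move=> E; elim: n => [//|n IH] /=; rewrite IH E. Qed.

(** The Euler bound with step [t / n] does not depend on [n], and the distance to the exponential is
    of order [1 / n]. The case [t = 0] is separate because the step must be positive. *)
Lemma exp_resolvent_family_bound M beta (B : R -> H -> H) t s x :
  1 <= M -> 0 <= beta -> resolvent_family M beta B -> 0 <= t -> 1 <= s ->
  norm (op_exp (fun y => (- t) *r B 0 y) (B s x)) <= decay_constant M beta * (1 + ln s) / s * norm x.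
Proof.
move=> M1 b0 RF t0 s1.
have Is : 0 < / s by apply: Rinv_0_lt_compat; lra.
have ls : 0 <= ln s by rewrite -ln_1; case: s1 => [/(ln_increasing 1)|<-]; lra.
have n0 := norm_nneg x.
have D := rf_decay M beta B RF s x (ltac:(lra)).
have LB := rf_linear _ _ _ RF 0 (Rle_refl 0).
have Bb y := rf_bounded _ _ _ RF 0 y (Rle_refl 0).
have LD : rlinear (fun y => (- t) *r B 0 y).
  by split=> [y z|r y]; rewrite ?(proj1 LB) ?(proj2 LB); vec.
have Db y : norm ((- t) *r B 0 y) <= t * beta * norm y.
  rewrite norm_rscal Rabs_Ropp Rabs_pos_eq // Rmult_assoc.
  by apply: Rmult_le_compat_l.
have tb : 0 <= t * beta by apply: Rmult_le_pos.
case: (Rle_lt_or_eq_dec 0 t t0) => [tp|tz]; last first.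
  have A := op_exp_norm _ (t * beta) (B s x) tb Db.
  rewrite -tz Rmult_0_l exp_0 Rmult_1_l in A; rewrite -tz; apply: Rle_trans A _.
  apply: Rle_trans D _; apply: Rmult_le_compat_r => //; apply: Rmult_le_compat_r; first lra.
  have E1 := exp_ineq1_le beta; have E2 := exp_pos (beta ^ 2); have E3 := exp_pos M.
  have M3 := pow_R1_Rle M 3 M1; have M5 := pow_R1_Rle M 5 M1.
  have : M <= decay_constant M beta.
    rewrite /decay_constant /smoothing_constant.
    have : 0 <= exp (beta ^ 2) * (2 * M * (1024 * M ^ 5 + exp M * M) + 160 * M ^ 3).
      apply: Rmult_le_pos; first lra.
      have : 0 <= exp M * M by nra.
      nra.
    nra.
  nra.
(* Beyond this index both the step condition [32 M^2 h t <= 1] with [h = t / n] and the condition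
   [t * beta <= n] of the Euler approximation hold. *)
have [n0' Hn0] : exists n0 : nat, 32 * M ^ 2 * t ^ 2 + t * beta + 1 <= INR n0.
  have [n Hn] := nfloor_ex (32 * M ^ 2 * t ^ 2 + t * beta + 1) (ltac:(have := pow2_ge_0 M; have := pow2_ge_0 t; nra)).
  by exists (S n); rewrite S_INR; lra.
apply: (le_of_le_add_inv_nat _ _ (exp (t * beta) * (t * beta) ^ 2 * norm (B s x)) n0') => n Hn.
have Hn' := le_INR _ _ Hn.
have P1 : 0 <= 32 * M ^ 2 * t ^ 2 by have := pow2_ge_0 M; have := pow2_ge_0 t; nra.
have np : (0 < n)%nat by apply: INR_lt; rewrite [INR 0]/=; lra.
have npos : 0 < INR n by apply: lt_0_INR.
have A1 := op_exp_euler _ (t * beta) n (B s x) LD Db np (ltac:(lra)).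
have h0 : 0 < t / INR n by apply: Rdiv_lt_0_compat.
have ht : INR n * (t / INR n) = t by field; lra.
have A2 := euler_resolvent_bound M beta B M1 RF n (t / INR n) np h0 s x s1 b0.
rewrite ht in A2.
have hA : 32 * M ^ 2 * (t / INR n) * t <= 1.
  apply: (Rmult_le_reg_r (INR n)) => //.
  have -> : 32 * M ^ 2 * (t / INR n) * t * INR n = 32 * M ^ 2 * t ^ 2 by field; lra.
  lra.
have {}A2 := A2 hA.
have E : Nat.iter n (fun y => plus y ((/ INR n) *r ((- t) *r B 0 y))) (B s x)
   = Nat.iter n (euler_step (t / INR n) (B 0)) (B s x).
  by apply: iter_ext => y; rewrite /euler_step; vec_ext; rewrite /Rdiv; ring.
rewrite E in A1; cbv beta in A2.
set w := Nat.iter n _ _ in A1 A2; set v := op_exp _ _ in A1 *.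
have -> : v = plus w (minus v w) by vec.
apply: Rle_trans (norm_triangle _ _) _; apply: Rle_trans (Rplus_le_compat _ _ _ _ A2 A1) _.
by apply: Req_le; rewrite /Rdiv; ring.
Qed.

(** This is [(A + xi)^-1 y]: the two signs convert from the convention [(z - A)^-1] of
    [resolvent]. *)
Definition shifted_resolvent (A : operator H) (xi : R) (y : H) : H :=
  resolvent A (RtoC (- xi)) (opp y).

Lemma shifted_resolvent_family (A : operator H) (T : R -> H -> H) M :
  C0_semigroup T -> 1 <= M -> (forall t, 0 <= t -> forall x, norm (T t x) <= M * norm x) ->
  is_generator T (op_opp A) -> resolvent_set A (RtoC 0) ->
  exists beta, 0 <= beta /\ resolvent_family M beta (shifted_resolvent A).
Proof.
move=> SG M1 TM GA R0.
have [tn TN] := orbit_norm_exists T M TM.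
have RS xi : 0 <= xi -> resolvent_at A (RtoC (- xi)) (resolvent A (RtoC (- xi))).
  move=> x0; apply: resolvent_correct.
  case: (Rle_lt_or_eq_dec 0 xi x0) => [xp|<-]; last by rewrite Ropp_0.
  by apply: (resolvent_set_left_half_plane A T M SG M1 TM GA R0 tn TN); rewrite /Re /=; lra.
have opp_plus' (x y : H) : opp (plus x y) = plus (opp x) (opp y) by vec.
have opp_rscal' r (x : H) : opp (r *r x) = r *r opp x by vec.
have lin xi : 0 <= xi -> rlinear (shifted_resolvent A xi).
  move=> /RS [/is_linear_rlinear [LD LZ] _]; split=> [x y|r x]; rewrite /shifted_resolvent.
    by rewrite opp_plus' LD.
  by rewrite opp_rscal' LZ.
have eqn xi eta x : 0 <= xi -> 0 <= eta ->
    minus (shifted_resolvent A eta x) (shifted_resolvent A xi x)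
    = (xi - eta) *r shifted_resolvent A xi (shifted_resolvent A eta x).
  move=> /RS Hx /RS He; have E := resolvent_identity _ _ _ _ _ (opp x) Hx He.
  rewrite /shifted_resolvent.
  have -> : resolvent A (RtoC (- xi)) (opp (resolvent A (RtoC (- eta)) (opp x)))
     = opp (resolvent A (RtoC (- xi)) (resolvent A (RtoC (- eta)) (opp x))).
    by apply: linear_opp; exact: (proj1 Hx).
  have E' := f_equal opp E.
  have <- : opp (minus (resolvent A (RtoC (- xi)) (opp x)) (resolvent A (RtoC (- eta)) (opp x)))
     = minus (resolvent A (RtoC (- eta)) (opp x)) (resolvent A (RtoC (- xi)) (opp x)) by vec.
  rewrite E' -opp_rscal'; congr opp; rewrite /rscal; congr (scal _ _).
  by rewrite -RtoC_minus; congr RtoC; ring.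
have tno x : tn (opp x) <= tn x.
  rewrite opp_rscal; apply: Rle_trans (orbit_scal_le T SG tn TN _ _) _.
  by rewrite Cmod_R Rabs_Ropp Rabs_R1; lra.
have pw xi : 0 < xi -> power_bounded M (fun x => xi *r shifted_resolvent A xi x).
  move=> xp n x.
  have S1 y : tn (xi *r shifted_resolvent A xi y) <= tn y.
    apply: Rle_trans (orbit_scal_le T SG tn TN _ _) _.
    rewrite Cmod_R Rabs_pos_eq; last lra.
    have := resolvent_orbit_bound A T M SG M1 TM GA tn TN _ _ (opp y) (RS xi (Rlt_le _ _ xp)).
    have := tno y; rewrite /Re /= Ropp_involutive /shifted_resolvent; lra.
  have In : tn (Nat.iter n (fun x => xi *r shifted_resolvent A xi x) x) <= tn x.
    elim: n => [|n IH]; first exact: Rle_refl.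
    by rewrite [Nat.iter _ _ _]/=; apply: Rle_trans (S1 _) IH.
  apply: Rle_trans (norm_le_orbit T SG tn TN _) _; apply: Rle_trans In _.
  exact: (orbit_le_norm T M TM tn TN).
have [c [c0 Bc]] := linear_norm _ (proj1 (RS 0 (Rle_refl 0))).
have Bc' x : norm (shifted_resolvent A 0 x) <= c * norm x.
  apply: Rle_trans (Bc _) _; rewrite opp_rscal norm_rscal Rabs_Ropp Rabs_R1; lra.
(* From [B_xi = B_0 (1 - xi B_xi)], where [c] bounds [B_0] and [M] bounds [xi B_xi]. *)
exists (c * (1 + M)); split; first by nra.
split=> // xi x x0.
case: (Rle_lt_or_eq_dec 0 xi x0) => [xp|<-]; last first.
  apply: Rle_trans (Bc' x) _; apply: Rmult_le_compat_r; [exact: norm_nneg|nra].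
have L0 := lin 0 (Rle_refl 0).
have -> : shifted_resolvent A xi x = shifted_resolvent A 0 (minus x (xi *r shifted_resolvent A xi x)).
  rewrite (rlinear_minus _ _ _ L0) (proj2 L0).
  have E := eqn 0 xi x (Rle_refl 0) x0.
  apply: ip_ext => z; have := f_equal (fun v => ip v z) E; cbv beta; ipsimp; lra.
apply: Rle_trans (Bc' _) _; rewrite Rmult_assoc; apply: Rmult_le_compat_l; first lra.
apply: Rle_trans (norm_minus_le _ _) _.
have := pw xi xp 1%nat x; rewrite /=; lra.
Qed.

End ExponentialBound.

(** * The contour integral *)

Lemma Cis_sq theta : cos theta ^ 2 + sin theta ^ 2 = 1.
Proof. by have := sin2_cos2 theta; rewrite /Rsqr; lra. Qed.

Lemma Cmod_Cis theta : Cmod (Cis theta) = 1.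
Proof. by rewrite /Cmod /Cis [fst _]/= [snd _]/= Cis_sq sqrt_1. Qed.

Lemma Cmod_polar r theta : 0 <= r -> Cmod (Cmult (RtoC r) (Cis theta)) = r.
Proof. by move=> r0; rewrite Cmod_mult Cmod_Cis Cmod_R Rabs_pos_eq //; ring. Qed.

Lemma Carg_polar r theta : 0 < r -> - PI < theta < PI -> Carg (Cmult (RtoC r) (Cis theta)) = theta.
Proof.
move=> r0 Ht; rewrite /Carg Cmod_polar; last lra.
have -> : Re (Cmult (RtoC r) (Cis theta)) / r = cos theta by rewrite /Re /=; field; lra.
have -> : Im (Cmult (RtoC r) (Cis theta)) = r * sin theta by rewrite /Im /=; ring.
case: Rle_dec => S.
- have S0 : 0 <= sin theta by apply: (Rmult_le_reg_l r) => //; lra.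
  apply: acos_cos; split; last lra.
  apply: Rnot_lt_le => L; have := sin_gt_0 (- theta); rewrite sin_neg; lra.
- have S0 : sin theta < 0 by apply: Rnot_le_lt => L; apply: S; apply: Rmult_le_pos; lra.
  rewrite -cos_neg acos_cos; first ring.
  split; last lra.
  apply: Rnot_lt_le => L; have := sin_ge_0 theta; lra.
Qed.

Lemma Cpower_polar r theta s : 0 < r -> - PI < theta < PI ->
  Cpower (Cmult (RtoC r) (Cis theta)) s = Cmult (RtoC (Rpower r s)) (Cis (s * theta)).
Proof. by move=> r0 Ht; rewrite /Cpower Carg_polar // Cmod_polar //; lra. Qed.

Lemma Cmod_Cpower_polar r theta s : 0 < r -> - PI < theta < PI ->
  Cmod (Cpower (Cmult (RtoC r) (Cis theta)) s) = Rpower r s.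
Proof. by move=> r0 Ht; rewrite Cpower_polar // Cmod_polar //; apply/Rlt_le/exp_pos. Qed.

(** A chord is no longer than its arc: the squared left side is [2 - 2 cos (a - b) = 4 sin ((a - b)
    / 2) ^ 2]. *)
Lemma Cis_lipschitz a b : Cmod (Cminus (Cis a) (Cis b)) <= Rabs (a - b).
Proof.
have sin_le u : 0 <= u -> sin u ^ 2 <= u ^ 2.
  move=> u0; case: (Rle_lt_or_eq_dec 0 u u0) => [up|<-]; last by rewrite sin_0; lra.
  have [S1 S2] := SIN_bound u; have := sin_lt_x u up.
  case: (Rle_lt_dec 0 (sin u)) => S; first by nra.
  have := PI_RGT_0; case: (Rle_lt_dec u 1) => U; last by nra.
  have := sin_gt_0 u up; have := PI2_3_2; rewrite /PI2 => *; lra.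
have sin_le' u : sin u ^ 2 <= u ^ 2.
  case: (Rle_lt_dec 0 u) => U; first exact: sin_le.
  by have := sin_le (- u) (ltac:(lra)); rewrite sin_neg; lra.
apply: Rsqr_incr_0_var; last exact: Rabs_pos.
rewrite !Rsqr_pow2 pow2_abs /Cmod pow2_sqrt; last by apply: Rplus_le_le_0_compat; exact: pow2_ge_0.
have -> : fst (Cminus (Cis a) (Cis b)) ^ 2 + snd (Cminus (Cis a) (Cis b)) ^ 2
  = 2 - 2 * cos (a - b).
  rewrite [fst _]/= [snd _]/= cos_minus; have := Cis_sq a; have := Cis_sq b; nra.
have -> : a - b = 2 * ((a - b) / 2) by field.
rewrite cos_2a_sin; have := sin_le' ((a - b) / 2); nra.
Qed.

Lemma Carg_gt_cos z omega : z <> RtoC 0 -> 0 <= omega <= PI ->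
  omega < Rabs (Carg z) -> Re z < Cmod z * cos omega.
Proof.
move=> z0 Ho; have m0 : 0 < Cmod z by apply/Cmod_gt_0.
have B : -1 <= Re z / Cmod z <= 1.
  have A1 := Cmod_re_ge z; have A2 := Cmod_re_ge (Copp z); rewrite Cmod_opp in A2.
  have A3 : Re (Copp z) = - Re z by [].
  split; apply: (Rmult_le_reg_r (Cmod z)) => //; rewrite /Rdiv Rmult_assoc Rinv_l; lra.
have -> : Rabs (Carg z) = acos (Re z / Cmod z).
  have [P _] := acos_bound (Re z / Cmod z).
  by rewrite /Carg; case: Rle_dec => _; rewrite ?Rabs_Ropp Rabs_pos_eq.
move=> L; have [P1 P2] := acos_bound (Re z / Cmod z).
have := cos_decreasing_1 omega (acos (Re z / Cmod z)) (proj1 Ho) (proj2 Ho) P1 P2 L.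
rewrite cos_acos // => C1.
have := Rmult_lt_compat_l _ _ _ m0 C1.
by have -> : Cmod z * (Re z / Cmod z) = Re z by field; lra.
Qed.

(** * Existence of admissible contours, and integrals along them *)

Section Admissible.
Context {H : HilbertSpace}.
Implicit Types (x y : H) (A : operator H) (z : C).

(** Outside a sector of half-angle [om > PI / 2] one has [- Re z >= - cos om * Cmod z], so the
    half-plane bound [M / - Re z] gives sectoriality of angle [PI / 2]. Without such a pair the
    contour chosen by [epsilon] would carry no information. *)
Lemma admissible_exists A (T : R -> H -> H) M :
  C0_semigroup T -> 1 <= M -> (forall t, 0 <= t -> forall x, norm (T t x) <= M * norm x) ->
  is_generator T (op_opp A) -> resolvent_set A (RtoC 0) ->
  exists p : R * R, admissible A (fst p) (snd p).
Proof.
move=> SG M1 TM GA R0.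
have [tn TN] := orbit_norm_exists T M TM.
have [delta [d0 Hd]] := resolvent_set_near_zero A R0.
have left_rs := resolvent_set_left_half_plane A T M SG M1 TM GA R0 tn TN.
have pi0 := PI_RGT_0.
exists (3 * PI / 4, delta); split; last by [].
exists (PI / 2); split; last by rewrite /=; lra.
split; first lra.
split.
- move=> z z0 Hz; apply: left_rs.
  by have := Carg_gt_cos z (PI / 2) z0 (ltac:(lra)) Hz; rewrite cos_PI2; lra.
- move=> om Hom; have c0 : cos om < 0 by apply: cos_lt_0; lra.
  exists (M / - cos om) => z z0 Hz x.
  have C1 := Carg_gt_cos z om z0 (ltac:(lra)) Hz.
  have m0 : 0 < Cmod z by apply/Cmod_gt_0.
  have zn : Re z < 0 by nra.
  have HR := resolvent_correct A z (left_rs z zn).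
  have B1 := resolvent_orbit_bound A T M SG M1 TM GA tn TN z _ x HR.
  have B2 := norm_le_orbit T SG tn TN (resolvent A z x).
  have B3 := orbit_le_norm T M TM tn TN x.
  have n1 := norm_nneg (resolvent A z x).
  rewrite norm_cscal; apply: (Rmult_le_reg_l (- cos om)); first lra.
  have -> : - cos om * (M / - cos om * norm x) = M * norm x by field; lra.
  have : (Cmod z * - cos om) * norm (resolvent A z x) <= - Re z * tn (resolvent A z x).
    have P1 : 0 <= Cmod z * - cos om by apply: Rmult_le_pos; lra.
    by apply: Rmult_le_compat => //; lra.
  lra.
Qed.

Lemma resolvent_locally_bounded A z : resolvent_set A z ->
  exists c K, 0 < c /\ 0 < K /\ forall z', Cmod (Cminus z z') < c ->
    resolvent_set A z' /\ forall y, norm (resolvent A z' y) <= K * norm y.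
Proof.
move=> /resolvent_correct HS; have [k [k0 Bk]] := linear_norm _ (proj1 HS).
exists (/ (2 * k)), (2 * k); split; first by apply: Rinv_0_lt_compat; lra.
split; first lra.
move=> z' Hz'.
have P0 := Cmod_ge_0 (Cminus z z').
have Hr : Cmod (Cminus z z') * k <= / 2.
  apply: (Rle_trans _ (/ (2 * k) * k)); first by apply: Rmult_le_compat_r; lra.
  by apply: Req_le; field; lra.
have P : 0 <= Cmod (Cminus z z') * k by apply: Rmult_le_pos; lra.
have P2 : Cmod (Cminus z z') * k < 1 by lra.
have PB n x : norm (Nat.iter n (fun y => scal (Cminus z z') (resolvent A z y)) x)
    <= 1 * (Cmod (Cminus z z') * k) ^ n * norm x.
  rewrite Rmult_1_l; apply: iter_bound => // y.
  by rewrite norm_cscal Rmult_assoc; apply: Rmult_le_compat_l.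
have [K [KB HK]] := resolvent_at_perturb A z z' _ 1 (Cmod (Cminus z z') * k) HS (conj P P2) Rle_0_1 PB.
have R' : resolvent_set A z' by eexists; exact: HK.
split=> // y.
have HR' := resolvent_correct A z' R'.
have [D' E'] := proj1 (proj2 HR') y.
rewrite (resolvent_at_unique A z' _ _ _ HK D' E').
apply: Rle_trans (Bk _) _; rewrite (Rmult_comm 2) Rmult_assoc; apply: Rmult_le_compat_l; first lra.
apply: Rle_trans (KB y) _; apply: Rmult_le_compat_r; first exact: norm_nneg.
rewrite /Rdiv Rmult_1_l -(Rinv_inv 2); apply: Rinv_le_contravar; lra.
Qed.

(** [H] and [restr_R H] share their norm, so that it suffices to estimate in [H]. *)
Lemma continuous_restr (F : R -> restr_R H) (psi : R -> R) r :
  locally r (fun r' => @norm _ H (@minus H (F r') (F r)) <= psi r') ->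
  continuous psi r -> psi r = 0 -> continuous F r.
Proof.
move=> L C0 E0 P HP.
have [eps He] := locally_norm_le_locally (K := C_AbsRing) (V := H) (F r) P HP.
have L2 : locally r (fun r' => psi r' < eps).
  apply: (C0 (fun u => u < eps)); apply: (open_lt eps (psi r)).
  by rewrite E0; exact: cond_pos.
apply: filter_imp (filter_and _ _ L L2) => r' [A1 A2].
by apply: He; apply: Rle_lt_trans A1 A2.
Qed.

(** The functions [a] and [b] are moduli of continuity for the path and the weight. The resolvent
    identity converts the first into one for the resolvent, using its local boundedness. *)
Lemma resolvent_path_continuous A (zeta g : R -> C) (a b : R -> R) x r :
  resolvent_set A (zeta r) ->
  continuous a r -> a r = 0 -> locally r (fun r' => Cmod (Cminus (zeta r) (zeta r')) <= a r') ->
  continuous b r -> b r = 0 -> locally r (fun r' => Cmod (Cminus (g r') (g r)) <= b r') ->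
  continuous (fun r' => scal (g r') (resolvent A (zeta r') x) : restr_R H) r.
Proof.
move=> R1 Ca a0 Ha Cb b0 Hb; have [c [K [c0 [K0 HK]]]] := resolvent_locally_bounded A _ R1.
set v := resolvent A (zeta r) x.
apply: (continuous_restr _ (fun r' =>
  (b r' + Cmod (g r)) * (a r' * (K * norm v)) + b r' * norm v)).
- have L : locally r (fun r' => a r' < c).
    by apply: (Ca (fun u => u < c)); apply: (open_lt c); rewrite a0.
  apply: filter_imp (filter_and _ _ L (filter_and _ _ Ha Hb)) => r' [Hr' [A1 B1]].
  have [R2 B2] := HK _ (Rle_lt_trans _ _ _ A1 Hr').
  have v0 := norm_nneg v; have m0 := Cmod_ge_0 (Cminus (zeta r) (zeta r')).
  have -> : minus (scal (g r') (resolvent A (zeta r') x)) (scal (g r) v)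
    = plus (scal (g r') (minus (resolvent A (zeta r') x) v)) (scal (Cminus (g r') (g r)) v) by cvec.
  apply: Rle_trans (norm_triangle _ _) _; rewrite !norm_cscal; apply: Rplus_le_compat; last first.
    exact: Rmult_le_compat_r.
  rewrite (resolvent_identity _ _ _ _ _ _ (resolvent_correct _ _ R2) (resolvent_correct _ _ R1)).
  rewrite norm_cscal; apply: Rmult_le_compat; [exact: Cmod_ge_0| | |].
  + by apply: Rmult_le_pos; [exact: Cmod_ge_0|exact: norm_nneg].
  + have -> : g r' = Cplus (Cminus (g r') (g r)) (g r) by ring.
    apply: Rle_trans (Cmod_triangle _ _) _; lra.
  + by apply: Rmult_le_compat => //; first [exact: B2|exact: norm_nneg].
- have Cc (d : R) : continuous (fun _ : R => d) r by apply: continuous_const.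
  by repeat first [apply: (continuous_plus (V := R_NormedModule)) | apply: (continuous_mult (K := R_AbsRing)) | exact: Ca | exact: Cb | exact: Cc].
- by rewrite a0 b0; ring.
Qed.

Lemma is_RInt_linear (E : H -> H) (F : R -> restr_R H) a b l :
  is_linear E -> is_RInt F a b l -> is_RInt (fun r => E (F r) : restr_R H) a b (E l).
Proof.
move=> LE I.
have S ptd : Riemann_sum (fun r => E (F r) : restr_R H) ptd = E (Riemann_sum F ptd).
  apply: (SF_cons_ind (fun ptd => Riemann_sum (fun r => E (F r) : restr_R H) ptd = E (Riemann_sum F ptd))) => [x0|h p IH].
    by rewrite /Riemann_sum /=; symmetry; apply: (linear_zero E LE).
  rewrite !Riemann_sum_cons IH; symmetry.
  transitivity (plus (E (scal (RtoC (SF_h p - fst h)) (F (snd h) : H))) (E (Riemann_sum F p))).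
    exact: (linear_plus _ LE).
  by rewrite (linear_scal _ LE).
apply: filterlim_ext (filterlim_comp _ _ _ _ E _ _ _ I (linear_cont E l LE)) => ptd /=.
by rewrite S; exact: (linear_scal _ LE).
Qed.

Lemma RInt_image_bound (E : H -> H) (F : R -> restr_R H) (g : R -> R) a b l lg :
  is_linear E -> a <= b -> is_RInt F a b l -> is_RInt g a b lg ->
  (forall r, a <= r <= b -> @norm _ H (E (F r)) <= g r) -> @norm _ H (E l) <= lg.
Proof.
move=> LE ab IF Ig B.
exact: (norm_RInt_le (V := restr_R H) _ g a b (E l) lg ab B (is_RInt_linear E F a b l LE IF) Ig).
Qed.

Lemma is_RInt_Rpower gamma a b : 0 < gamma -> 0 < a -> a <= b ->
  is_RInt (fun r => Rpower r (-1 - gamma)) a b ((Rpower a (- gamma) - Rpower b (- gamma)) / gamma).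
Proof.
move=> g0 a0 ab.
have -> : (Rpower a (- gamma) - Rpower b (- gamma)) / gamma
  = minus (- / gamma * Rpower b (- gamma)) (- / gamma * Rpower a (- gamma)).
  by rewrite /minus /plus /opp /=; field; lra.
apply: (is_RInt_derive (fun r => - / gamma * Rpower r (- gamma))) => r; rewrite Rmin_left // Rmax_right // => Hr.
- rewrite /Rpower; auto_derive; first lra.
  have -> : exp ((-1 - gamma) * ln r) = exp (- gamma * ln r) * / r.
    have -> : (-1 - gamma) * ln r = - gamma * ln r + - ln r by ring.
    by rewrite exp_plus exp_Ropp exp_ln //; lra.
  by field; lra.
- apply: (ex_derive_continuous (V := R_NormedModule)); rewrite /Rpower; auto_derive; lra.
Qed.

(** The two constants have distinct roles: [K] only secures convergence, whereas [K'] measures the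
    integrand after [E] and is the one that will be uniform in time. *)
Lemma improper_integral (F : R -> restr_R H) delta K gamma :
  0 < delta -> 0 < gamma ->
  (forall r, delta <= r -> continuous F r) ->
  (forall r, delta <= r -> @norm _ H (F r) <= K * Rpower r (-1 - gamma)) ->
  exists l : H, RInt_gen F (at_point delta) (Rbar_locally p_infty) = l /\
   (forall (E : H -> H) K', is_linear E ->
      (forall r, delta <= r -> @norm _ H (E (F r)) <= K' * Rpower r (-1 - gamma)) ->
      @norm _ H (E l) <= K' * Rpower delta (- gamma) / gamma).
Proof.
move=> d0 g0 CF BF.
have nneg k u : u <= k * Rpower delta (-1 - gamma) -> 0 <= u -> 0 <= k.
  move=> A1 A2; have P := exp_pos ((-1 - gamma) * ln delta).
  by apply: (Rmult_le_reg_r (exp ((-1 - gamma) * ln delta))) => //; rewrite /Rpower in A1; lra.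
have K0 : 0 <= K by apply: nneg (BF delta (Rle_refl _)) (norm_nneg (F delta : H)).
have ex a b : delta <= a -> a <= b -> ex_RInt F a b.
  move=> da ab; apply: ex_RInt_continuous => r; rewrite Rmin_left // => Hr.
  by apply: CF; lra.
pose I b := RInt F delta b.
have HI b : delta <= b -> is_RInt F delta b (I b).
  by move=> db; apply: RInt_correct; apply: ex => //; lra.
have scaled a b k : delta <= a -> a <= b ->
  is_RInt (fun r => k * Rpower r (-1 - gamma)) a b (k * ((Rpower a (- gamma) - Rpower b (- gamma)) / gamma)).
  move=> da ab; apply: (is_RInt_scal (V := R_NormedModule) _ _ _ k); apply: is_RInt_Rpower => //; lra.
have pw r : 0 < Rpower r (- gamma) by exact: exp_pos.
have tail a b : delta <= a -> a <= b -> @norm _ H (@minus H (I b) (I a)) <= K / gamma * Rpower a (- gamma).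
  move=> da ab.
  have J : is_RInt F a b (@minus H (I b) (I a)).
    have C := is_RInt_Chasles F a delta b _ _ (is_RInt_swap _ _ _ _ (HI a da)) (HI b (ltac:(lra))).
    by have <- : @plus H (opp (I a)) (I b) = @minus H (I b) (I a) by vec.
  have := RInt_image_bound (fun x => x) F _ a b _ _ is_linear_id ab J (scaled a b K da ab) (fun r Hr => BF r (ltac:(lra))).
  move=> A; apply: Rle_trans A _.
  have := pw b; have : 0 <= K / gamma by apply: Rmult_le_pos => //; apply/Rlt_le/Rinv_0_lt_compat.
  rewrite /Rdiv => A1 A2; nra.
have [l Hl] : exists l : H, filterlim (I : R -> H) (Rbar_locally p_infty) (locally l).
  apply/(filterlim_locally_cauchy (U := H)) => eps.
  pose e := eps / 2 / (K / gamma + 1).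
  have Kg : 0 <= K / gamma by apply: Rmult_le_pos => //; apply/Rlt_le/Rinv_0_lt_compat.
  have e0 : 0 < e by apply: Rdiv_lt_0_compat; have := cond_pos eps; lra.
  (* The second entry solves [a ^ (- gamma) = e], so that the tail beyond [a0] is below
     [eps / 2]. *)
  pose a0 := Rmax delta (Rpower e (- / gamma)).
  have a0d : delta <= a0 by exact: Rmax_l.
  have small : K / gamma * Rpower a0 (- gamma) < eps / 2.
    have S1 : Rpower a0 (- gamma) <= e.
      have -> : e = Rpower (Rpower e (- / gamma)) (- gamma).
        rewrite Rpower_mult; have -> : - / gamma * - gamma = 1 by field; lra.
        by rewrite Rpower_1.
      rewrite /Rpower; apply: exp_le_compat.
      have : ln (exp (- / gamma * ln e)) <= ln a0.
        by apply: ln_le; [exact: exp_pos|exact: Rmax_r].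
      nra.
    have -> : eps / 2 = (K / gamma + 1) * e by rewrite /e; field; lra.
    have := pw a0; nra.
  have half u : a0 < u -> @norm _ H (@minus H (I u) (I a0)) <= K / gamma * Rpower a0 (- gamma).
    by move=> Hu; apply: tail; lra.
  exists (fun u => a0 < u); split; first by exists a0.
  move=> u v Hu Hv; apply: (norm_compat1 (V := H)).
  have -> : minus (I v : H) (I u) = minus (minus (I v : H) (I a0)) (minus (I u : H) (I a0)) by vec.
  apply: Rle_lt_trans (norm_minus_le _ _) _; have := half u Hu; have := half v Hv; lra.
exists l; split.
  have J : is_RInt_gen (V := restr_R H) F (at_point delta) (Rbar_locally p_infty) l.
    move=> P HP.
    apply: (Filter_prod _ _ _ (fun a => a = delta) (fun b => delta < b /\ P (I b))) => //.
      by apply: filter_and; [exists delta|exact: Hl].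
    by move=> a b -> [db Pb]; exists (I b); split=> //; apply: HI => /=; lra.
  exact: (is_RInt_gen_unique (V := restr_R H) F l J).
move=> E K' LE BE.
have K'0 : 0 <= K' by apply: nneg (BE delta (Rle_refl _)) (norm_nneg _).
have L2 : filterlim (fun b => norm (E (I b))) (Rbar_locally p_infty) (locally (norm (E l))).
  exact: (filterlim_comp _ _ _ _ _ _ _ _ (filterlim_comp _ _ _ (I : R -> H) E _ _ _ Hl (linear_cont E l LE)) (filterlim_norm (E l))).
apply: (filterlim_le (F := Rbar_locally p_infty) (fun b => norm (E (I b))) (fun _ => K' * Rpower delta (- gamma) / gamma) (norm (E l)) (K' * Rpower delta (- gamma) / gamma)) => //; last exact: filterlim_const.
exists delta => b db.
apply: Rle_trans (RInt_image_bound E F _ delta b _ _ LE (Rlt_le _ _ db) (HI b (Rlt_le _ _ db))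
   (scaled delta b K' (Rle_refl _) (Rlt_le _ _ db)) (fun r Hr => BE r (proj1 Hr))) _.
have := pw b; have : 0 <= K' / gamma by apply: Rmult_le_pos => //; apply/Rlt_le/Rinv_0_lt_compat.
rewrite /Rdiv; nra.
Qed.

End Admissible.

Lemma Cis_plus a b : Cmult (Cis a) (Cis b) = Cis (a + b).
Proof.
by apply: injective_projections; rewrite /Cis /= ?cos_plus ?sin_plus; ring.
Qed.

Lemma Cmod_Ci : Cmod Ci = 1.
Proof.
rewrite /Cmod /Ci [fst _]/= [snd _]/=.
by have -> : 0 ^ 2 + 1 ^ 2 = 1 by [ring]; rewrite sqrt_1.
Qed.

Lemma continuous_Rabs_sub (f : R -> R) r : continuous f r -> continuous (fun r' => Rabs (f r' - f r)) r.
Proof.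
move=> Cf; apply: (continuous_comp (fun r' => f r' - f r) Rabs); last exact: continuous_Rabs.
by apply: (continuous_minus (V := R_NormedModule)) => //; exact: continuous_const.
Qed.

(** Half of the exponent [alpha] is spent on the logarithm; the remaining [alpha / 2] keeps the ray
    integral convergent. *)
Lemma log_le_power delta alpha : 0 < delta -> 0 < alpha ->
  exists c, 0 <= c /\ forall r, delta <= r -> 1 + ln (1 + r) <= c * Rpower r (alpha / 2).
Proof.
move=> d0 a0; have p r : 0 < Rpower r (alpha / 2) by exact: exp_pos.
have di : 0 < / delta by apply: Rinv_0_lt_compat.
have l0 : 0 <= ln (1 + / delta) by rewrite -ln_1; apply: ln_le; lra.
exists ((1 + ln (1 + / delta)) / Rpower delta (alpha / 2) + 2 / alpha).
split.
  apply: Rplus_le_le_0_compat; apply: Rmult_le_pos; try lra; apply/Rlt_le/Rinv_0_lt_compat => //.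
move=> r Hr; have A1 : ln (1 + r) <= ln (1 + / delta) + ln r.
  rewrite -ln_mult; try lra; apply: ln_le; first lra.
  have : 1 <= / delta * r by apply: (Rmult_le_reg_l delta) => //; rewrite -Rmult_assoc Rinv_r; lra.
  lra.
have A2 : ln r <= 2 / alpha * Rpower r (alpha / 2).
  have := exp_ineq1_le (alpha / 2 * ln r); rewrite -/(Rpower r (alpha / 2)) => A.
  apply: (Rmult_le_reg_l (alpha / 2)); first lra.
  have -> : alpha / 2 * (2 / alpha * Rpower r (alpha / 2)) = Rpower r (alpha / 2) by field; lra.
  lra.
have A3 : 1 + ln (1 + / delta) <= (1 + ln (1 + / delta)) / Rpower delta (alpha / 2) * Rpower r (alpha / 2).
  have M : Rpower delta (alpha / 2) <= Rpower r (alpha / 2) by apply: Rle_Rpower_l; lra.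
  have := p delta => pd.
  apply: (Rmult_le_reg_r (Rpower delta (alpha / 2))) => //.
  have -> : (1 + ln (1 + / delta)) / Rpower delta (alpha / 2) * Rpower r (alpha / 2) * Rpower delta (alpha / 2)
     = (1 + ln (1 + / delta)) * Rpower r (alpha / 2) by field; lra.
  by apply: Rmult_le_compat_l; lra.
lra.
Qed.

(** * Uniform bounds for the contour integral after smoothing *)

Section Contour.
Context {H : HilbertSpace}.
Variables (A : operator H) (alpha phi delta : R).
Hypothesis alpha0 : 0 < alpha.
Hypothesis negative_axis : forall s, 0 <= s -> resolvent_set A (RtoC (- s)).
Hypothesis AD : admissible A phi delta.
Implicit Types (x y : H) (z : C) (E : H -> H).

(** The only property of [exp (- t A^-1)] used on the contour. *)
Definition resolvent_smoothing (C : R) E : Prop :=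
  is_linear E /\ 0 <= C /\
  forall s x, 1 <= s -> norm (E (shifted_resolvent A s x)) <= C * (1 + ln s) / s * norm x.

(** Transfers the estimate from the negative axis to any [z] of the resolvent set through [(z -
    A)^-1 = (A + s)^-1 ((z + s) (z - A)^-1 - 1)]. *)
Lemma smoothing_resolvent C E z m s x :
  resolvent_smoothing C E -> resolvent_set A z -> norm (resolvent A z x) <= m * norm x -> 1 <= s ->
  norm (E (resolvent A z x)) <= C * (1 + ln s) / s * (((Cmod z + s) * m + 1) * norm x).
Proof.
move=> [LE [C0 HE]] Rz Bz s1.
have HS := resolvent_correct A _ (negative_axis s (ltac:(lra))); have HZ := resolvent_correct A _ Rz.
have F : resolvent A z x = shifted_resolvent A s (minus (scal (Cplus z (RtoC s)) (resolvent A z x)) x).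
  have I := resolvent_identity _ _ _ _ _ x HS HZ; rewrite /shifted_resolvent.
  have -> : opp (minus (scal (Cplus z (RtoC s)) (resolvent A z x)) x)
    = minus x (scal (Cplus z (RtoC s)) (resolvent A z x)) by cvec.
  rewrite (linear_minus _ _ _ (proj1 HS)) (linear_scal _ (proj1 HS)).
  have -> : Cplus z (RtoC s) = Cminus z (RtoC (- s)) by rewrite RtoC_opp; ring.
  by rewrite -I; cvec.
rewrite {1}F; apply: Rle_trans (HE s _ s1) _.
apply: Rmult_le_compat_l.
  have : 0 <= ln s by rewrite -ln_1; apply: ln_le; lra.
  by move=> l0; apply: Rmult_le_pos; [apply: Rmult_le_pos; lra|apply/Rlt_le/Rinv_0_lt_compat; lra].
apply: Rle_trans (norm_minus_le _ _) _; rewrite norm_cscal.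
have : Cmod (Cplus z (RtoC s)) <= Cmod z + s.
  apply: Rle_trans (Cmod_triangle _ _) _; rewrite Cmod_R Rabs_pos_eq; lra.
move=> T; have := Rmult_le_compat _ _ _ _ (Cmod_ge_0 _) (norm_nneg _) T Bz; lra.
Qed.

Lemma angle_bounds : 0 < phi < PI /\ 0 < delta.
Proof. by have [[om [[S1 _] S2]] [d0 _]] := AD; split; lra. Qed.

Lemma ray_resolvent theta : Rabs theta = phi ->
  exists M', 0 <= M' /\ forall r, 0 < r -> resolvent_set A (Cmult (RtoC r) (Cis theta)) /\
    forall x, norm (resolvent A (Cmult (RtoC r) (Cis theta)) x) <= M' / r * norm x.
Proof.
move=> Ht; have [[om [[S1 [S2 S3]] S4]] _] := AD.
(* An angle strictly between [om] and [phi] is needed, as the uniform bound holds only outside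
   larger sectors. *)
have [M' HM] := S3 ((om + phi) / 2) (ltac:(lra)).
have th : - PI < theta < PI by move: Ht; rewrite /Rabs; case: Rcase_abs; lra.
exists (Rabs M'); split; first exact: Rabs_pos.
move=> r r0.
have Ez := Carg_polar r theta r0 th; have Em := Cmod_polar r theta (Rlt_le _ _ r0).
have z0 : Cmult (RtoC r) (Cis theta) <> RtoC 0 by move=> E; move: Em; rewrite E Cmod_0; lra.
split=> [|x]; first by apply: S2 => //; rewrite Ez Ht; lra.
have := HM _ z0 (ltac:(rewrite Ez Ht; lra)) x; rewrite norm_cscal Em => B.
apply: (Rmult_le_reg_l r) => //; apply: Rle_trans B _.
have -> : r * (Rabs M' / r * norm x) = Rabs M' * norm x by field; lra.
by apply: Rmult_le_compat_r; [exact: norm_nneg|exact: Rle_abs].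
Qed.

(** The integrand after [E] is of order [r ^ (- alpha) * (1 + ln (1 + r)) / r], and [log_le_power]
    reduces this to [r ^ (-1 - alpha / 2)]. The constant [K] is chosen before [E], hence serves all
    times at once. *)
Lemma ray_bound theta : Rabs theta = phi -> exists K, 0 <= K /\ forall C E x, resolvent_smoothing C E ->
  @norm _ H (E (RInt_gen (fun r => scal (Cmult (Cpower (Cmult (RtoC r) (Cis theta)) (- alpha)) (Cis theta))
      (resolvent A (Cmult (RtoC r) (Cis theta)) x) : restr_R H) (at_point delta) (Rbar_locally p_infty)))
  <= C * K * norm x.
Proof.
move=> Ht; have [p0 d0] := angle_bounds.
have th : - PI < theta < PI by move: Ht; rewrite /Rabs; case: Rcase_abs; lra.
have [M' [M0 HM]] := ray_resolvent theta Ht.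
have [c [c0 Hc]] := log_le_power delta alpha d0 alpha0.
have di : 0 < / delta by apply: Rinv_0_lt_compat.
have ff r : 0 < r -> Cmod (Cmult (Cpower (Cmult (RtoC r) (Cis theta)) (- alpha)) (Cis theta)) = Rpower r (- alpha).
  by move=> r0; rewrite Cmod_mult Cmod_Cpower_polar // Cmod_Cis; ring.
have pw r : 0 < r -> Rpower r (- alpha) * / r * Rpower r (alpha / 2) = Rpower r (-1 - alpha / 2).
  move=> r0; rewrite -{2}(Rpower_1 r r0) -Rpower_Ropp -!Rpower_plus; congr Rpower; field.
pose kap := ((2 + / delta) * M' + 1).
have kap0 : 0 <= kap by rewrite /kap; nra.
have pos (u : R) : 0 < Rpower delta u by exact: exp_pos.
exists (c * kap * Rpower delta (- (alpha / 2)) / (alpha / 2)); split.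
  apply: Rmult_le_pos; last by apply/Rlt_le/Rinv_0_lt_compat; lra.
  by apply: Rmult_le_pos; [nra|apply/Rlt_le/pos].
move=> C E x SE; have n0 := norm_nneg x.
set F : R -> restr_R H := (fun r => _).
have CF r : delta <= r -> continuous F r.
  move=> dr; have r0 : 0 < r by lra.
  have [R1 _] := HM r r0.
  have Cp : continuous (fun r' => Rpower r' (- alpha)) r.
    apply: (ex_derive_continuous (V := R_NormedModule)); rewrite /Rpower; auto_derive; lra.
  apply: (resolvent_path_continuous A (fun r' => Cmult (RtoC r') (Cis theta))
     (fun r' => Cmult (Cpower (Cmult (RtoC r') (Cis theta)) (- alpha)) (Cis theta))
     (fun r' => Rabs (r' - r)) (fun r' => Rabs (Rpower r' (- alpha) - Rpower r (- alpha)))) => //.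
  - exact: (continuous_Rabs_sub (fun r' => r') r (continuous_id r)).
  - by rewrite Rminus_diag Rabs_R0.
  - apply: filter_forall => r'.
    have -> : Cminus (Cmult (RtoC r) (Cis theta)) (Cmult (RtoC r') (Cis theta)) = Cmult (RtoC (r - r')) (Cis theta).
      by rewrite RtoC_minus; ring.
    by rewrite Cmod_mult Cmod_Cis Cmod_R Rabs_minus_sym; lra.
  - exact: (continuous_Rabs_sub (fun r' => Rpower r' (- alpha)) r Cp).
  - by rewrite Rminus_diag Rabs_R0.
  - have L : locally r (fun r' => 0 < r') by exact: (open_gt 0 r r0).
    apply: filter_imp L => r' r'0; rewrite !Cpower_polar //.
    set u := Cis (- alpha * theta).
    have -> : Cminus (Cmult (Cmult (RtoC (Rpower r' (- alpha))) u) (Cis theta))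
       (Cmult (Cmult (RtoC (Rpower r (- alpha))) u) (Cis theta))
      = Cmult (RtoC (Rpower r' (- alpha) - Rpower r (- alpha))) (Cmult u (Cis theta)).
      by rewrite RtoC_minus; ring.
    by rewrite !Cmod_mult /u !Cmod_Cis Cmod_R; lra.
have one_le r : delta <= r -> 1 <= c * Rpower r (alpha / 2).
  move=> dr; have := Hc r dr; have : 0 <= ln (1 + r) by rewrite -ln_1; apply: ln_le; lra.
  lra.
have BF r : delta <= r -> @norm _ H (F r) <= M' * c * norm x * Rpower r (-1 - alpha / 2).
  move=> dr; have r0 : 0 < r by lra.
  rewrite /F norm_cscal ff // -pw //.
  have ri : 0 < / r by apply: Rinv_0_lt_compat.
  have a1 : 0 < Rpower r (- alpha) by exact: exp_pos.
  have := Rmult_le_compat_l _ _ _ (Rlt_le _ _ a1) (proj2 (HM r r0) x).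
  move=> A1; apply: Rle_trans A1 _.
  have P : 0 <= M' * norm x * Rpower r (- alpha) * / r.
    by do 3 ![apply: Rmult_le_pos; try lra].
  have := Rmult_le_compat_l _ _ _ P (one_le r dr); rewrite /Rdiv; lra.
have [l [-> Hl]] := improper_integral F delta _ (alpha / 2) d0 (ltac:(lra)) CF BF.
have [LE [C0 HE]] := SE.
have BE r : delta <= r -> @norm _ H (E (F r)) <= C * c * kap * norm x * Rpower r (-1 - alpha / 2).
  move=> dr; have r0 : 0 < r by lra.
  have ri : 0 < / r by apply: Rinv_0_lt_compat.
  have a1 : 0 < Rpower r (- alpha) by exact: exp_pos.
  rewrite /F (linear_scal _ LE) norm_cscal ff // -pw //.
  (* The choice [s = 1 + r] is at least [1] and comparable with [Cmod z = r] for large [r], so that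
     the factor [(Cmod z + s) * M' / r + 1] stays below [kap] for [r >= delta]. *)
  have T := smoothing_resolvent C E _ (M' / r) (1 + r) x SE (proj1 (HM r r0)) (proj2 (HM r r0) x) (ltac:(lra)).
  rewrite Cmod_polar in T; last lra.
  have K1 : (r + (1 + r)) * (M' / r) + 1 <= kap.
    have -> : (r + (1 + r)) * (M' / r) + 1 = (2 + / r) * M' + 1 by field; lra.
    have : / r <= / delta by apply: Rinv_le_contravar.
    rewrite /kap; nra.
  have K2 : C * (1 + ln (1 + r)) / (1 + r) <= C * (c * Rpower r (alpha / 2)) * / r.
    have L0 : 0 <= 1 + ln (1 + r) by have : 0 <= ln (1 + r) by [rewrite -ln_1; apply: ln_le; lra]; lra.
    apply: Rmult_le_compat; [exact: Rmult_le_pos|apply/Rlt_le/Rinv_0_lt_compat; lra| |apply: Rinv_le_contravar; lra].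
    by apply: Rmult_le_compat_l => //; exact: Hc.
  have K3 : norm (E (resolvent A (Cmult (RtoC r) (Cis theta)) x)) <= C * (c * Rpower r (alpha / 2)) * / r * (kap * norm x).
    apply: Rle_trans T _; apply: Rmult_le_compat => //.
    - have L0 : 0 <= ln (1 + r) by [rewrite -ln_1; apply: ln_le; lra].
      by apply: Rmult_le_pos; [apply: Rmult_le_pos; lra|apply/Rlt_le/Rinv_0_lt_compat; lra].
    - apply: Rmult_le_pos => //; have : 0 <= M' / r by [apply: Rmult_le_pos; lra]; nra.
    - exact: Rmult_le_compat_r.
  have := Rmult_le_compat_l _ _ _ (Rlt_le _ _ a1) K3; lra.
apply: Rle_trans (Hl E _ LE BE) _; apply: Req_le; rewrite /Rdiv; ring.
Qed.

(** Compactness of the angle interval. One number [d theta] serves both as radius of a neighbourhood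
    and as inverse of the local bound, so a positive lower bound [e] for it yields the global bound
    [/ e]. *)
Lemma arc_resolvent_bound : exists K, 0 <= K /\ forall theta x, - phi <= theta <= phi ->
  norm (resolvent A (Cmult (RtoC delta) (Cis theta)) x) <= K * norm x.
Proof.
have [p0 d0] := angle_bounds; have [_ [_ HD]] := AD.
have RS theta : resolvent_set A (Cmult (RtoC delta) (Cis theta)).
  by apply: HD; rewrite Cmod_polar; lra.
have [d Hd] : exists d : R -> posreal, forall theta theta', Rabs (theta' - theta) < d theta -> forall y,
    norm (resolvent A (Cmult (RtoC delta) (Cis theta')) y) <= / d theta * norm y.
  suff /choice [d Hd] : forall theta, exists d : posreal, forall theta', Rabs (theta' - theta) < d -> forall y,
    norm (resolvent A (Cmult (RtoC delta) (Cis theta')) y) <= / d * norm y by exists d.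
  move=> theta; have [c [K [c0 [K0 HK]]]] := resolvent_locally_bounded A _ (RS theta).
  (* Division by [delta] converts a distance on the circle into an angle; the entry [/ K] makes the
     inverse of the minimum at least [K]. *)
  have e0 : 0 < Rmin (c / delta) (/ K).
    by apply: Rmin_pos; [exact: Rdiv_lt_0_compat|exact: Rinv_0_lt_compat].
  exists (mkposreal _ e0) => theta' /= Ht y.
  have Hz : Cmod (Cminus (Cmult (RtoC delta) (Cis theta)) (Cmult (RtoC delta) (Cis theta'))) < c.
    have -> : Cminus (Cmult (RtoC delta) (Cis theta)) (Cmult (RtoC delta) (Cis theta'))
      = Cmult (RtoC delta) (Cminus (Cis theta) (Cis theta')) by ring.
    rewrite Cmod_mult Cmod_R Rabs_pos_eq; last lra.
    have L := Cis_lipschitz theta theta'; rewrite Rabs_minus_sym in L.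
    apply: (Rle_lt_trans _ (delta * Rabs (theta' - theta))).
      by apply: Rmult_le_compat_l; lra.
    have -> : c = delta * (c / delta) by field; lra.
    apply: Rmult_lt_compat_l => //; apply: Rlt_le_trans Ht (Rmin_l _ _).
  apply: Rle_trans (proj2 (HK _ Hz) y) _; apply: Rmult_le_compat_r; first exact: norm_nneg.
  rewrite -{1}(Rinv_inv K); apply: Rinv_le_contravar => //; exact: Rmin_r.
have [e He] := compactness_value_1d (- phi) phi d.
exists (/ e); split; first by apply/Rlt_le/Rinv_0_lt_compat/cond_pos.
move=> theta x Ht; have [t [_ [Ht1 Ht2]]] := NNPP _ (He theta Ht).
apply: Rle_trans (Hd t theta Ht1 x) _; apply: Rmult_le_compat_r; first exact: norm_nneg.
by apply: Rinv_le_contravar => //; exact: cond_pos.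
Qed.

(** On the arc [Cmod z] is the constant [delta], so the smoothing estimate at [s = 1] suffices. *)
Lemma arc_bound : exists K, 0 <= K /\ forall C E x, resolvent_smoothing C E ->
  @norm _ H (E (RInt (fun theta => scal (Cmult (Cpower (Cmult (RtoC delta) (Cis theta)) (- alpha))
        (Cmult Ci (Cmult (RtoC delta) (Cis theta))))
      (resolvent A (Cmult (RtoC delta) (Cis theta)) x) : restr_R H) phi (- phi)))
  <= C * K * norm x.
Proof.
have [p0 d0] := angle_bounds; have [_ [_ HD]] := AD.
have [m [m0 Hm]] := arc_resolvent_bound.
have RS theta : resolvent_set A (Cmult (RtoC delta) (Cis theta)).
  by apply: HD; rewrite Cmod_polar; lra.
set dd := Rpower delta (- alpha) * delta.
have dd0 : 0 < dd by apply: Rmult_lt_0_compat => //; exact: exp_pos.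
exists (2 * phi * (dd * ((delta + 1) * m + 1))); split.
  apply: Rmult_le_pos; first lra.
  apply: Rmult_le_pos; first lra.
  nra.
move=> C E x SE; have [LE [C0 HE]] := SE.
set F : R -> restr_R H := (fun theta => _).
have CF theta : - phi <= theta <= phi -> continuous F theta.
  move=> Ht; have L : locally theta (fun u => - PI < u < PI).
    apply: (locally_interval _ theta (Finite (- PI)) (Finite PI)) => /=; try lra.
    by move=> u; rewrite /=; lra.
  apply: (resolvent_path_continuous A (fun u => Cmult (RtoC delta) (Cis u))
     (fun u => Cmult (Cpower (Cmult (RtoC delta) (Cis u)) (- alpha)) (Cmult Ci (Cmult (RtoC delta) (Cis u))))
     (fun u => delta * Rabs (u - theta)) (fun u => dd * Rabs ((1 - alpha) * u - (1 - alpha) * theta))) => //.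
  - apply: (continuous_mult (K := R_AbsRing)); first exact: continuous_const.
    exact: (continuous_Rabs_sub (fun u => u) theta (continuous_id theta)).
  - by rewrite Rminus_diag Rabs_R0 Rmult_0_r.
  - apply: filter_forall => u.
    have -> : Cminus (Cmult (RtoC delta) (Cis theta)) (Cmult (RtoC delta) (Cis u))
      = Cmult (RtoC delta) (Cminus (Cis theta) (Cis u)) by ring.
    rewrite Cmod_mult Cmod_R Rabs_pos_eq; last lra.
    by apply: Rmult_le_compat_l; [lra|rewrite Rabs_minus_sym; exact: Cis_lipschitz].
  - apply: (continuous_mult (K := R_AbsRing)); first exact: continuous_const.
    apply: (continuous_Rabs_sub (fun u => (1 - alpha) * u)).
    by apply: (continuous_mult (K := R_AbsRing)); [exact: continuous_const|exact: continuous_id].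
  - by rewrite Rminus_diag Rabs_R0 Rmult_0_r.
  - apply: filter_imp L => u Hu; rewrite !Cpower_polar //; last lra.
    (* Away from the branch cut [z^-alpha dz] is [delta^(1 - alpha) i exp (i (1 - alpha) v) dv],
       with [dd = delta^(1 - alpha)], which is Lipschitz in [v]. *)
    have G v : Cmult (Cmult (RtoC (Rpower delta (- alpha))) (Cis (- alpha * v))) (Cmult Ci (Cmult (RtoC delta) (Cis v)))
      = Cmult (RtoC dd) (Cmult Ci (Cis ((1 - alpha) * v))).
      have -> : (1 - alpha) * v = - alpha * v + v by ring.
      by rewrite -Cis_plus /dd RtoC_mult; ring.
    rewrite !G.
    have -> : Cminus (Cmult (RtoC dd) (Cmult Ci (Cis ((1 - alpha) * u)))) (Cmult (RtoC dd) (Cmult Ci (Cis ((1 - alpha) * theta))))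
      = Cmult (RtoC dd) (Cmult Ci (Cminus (Cis ((1 - alpha) * u)) (Cis ((1 - alpha) * theta)))) by ring.
    rewrite !Cmod_mult Cmod_Ci Cmod_R Rabs_pos_eq; last lra.
    by rewrite Rmult_1_l; apply: Rmult_le_compat_l; [lra|exact: Cis_lipschitz].
have HI : is_RInt F (- phi) phi (RInt F (- phi) phi).
  apply: RInt_correct; apply: ex_RInt_continuous => u.
  by rewrite Rmin_left ?Rmax_right; try lra; exact: CF.
have -> : RInt F phi (- phi) = opp (RInt F (- phi) phi : H).
  by apply: is_RInt_unique; exact: is_RInt_swap.
rewrite (linear_opp _ _ LE) opp_rscal norm_rscal Rabs_Ropp Rabs_R1 Rmult_1_l.
have Ic : is_RInt (fun _ : R => C * (dd * ((delta + 1) * m + 1)) * norm x) (- phi) phi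
   (C * (2 * phi * (dd * ((delta + 1) * m + 1))) * norm x).
  have -> : C * (2 * phi * (dd * ((delta + 1) * m + 1))) * norm x
    = scal (phi - - phi) (C * (dd * ((delta + 1) * m + 1)) * norm x).
    by rewrite /scal /= /mult /=; ring.
  exact: is_RInt_const.
apply: (RInt_image_bound E F _ (- phi) phi _ _ LE _ HI Ic) => [|theta Ht]; first lra.
rewrite /F (linear_scal _ LE) norm_cscal Cmod_mult Cmod_Cpower_polar //; last lra.
rewrite !Cmod_mult Cmod_Ci Cmod_Cis Cmod_R Rabs_pos_eq; last lra.
have T := smoothing_resolvent C E _ m 1 x SE (RS theta) (Hm theta x Ht) (Rle_refl 1).
rewrite Cmod_polar ?ln_1 in T; last lra.
rewrite -/dd; have -> : Rpower delta (- alpha) * (1 * (delta * 1)) = dd by rewrite /dd; ring.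
have := Rmult_le_compat_l _ _ _ (Rlt_le _ _ dd0) T; lra.
Qed.

Lemma contour_bound : exists K, forall C E x, resolvent_smoothing C E ->
  norm (E (contour_calculus A phi delta (fun z => Cpower z (- alpha)) x)) <= C * K * norm x.
Proof.
have [p0 d0] := angle_bounds.
have Hq : Rabs phi = phi by rewrite Rabs_pos_eq //; lra.
have [K1 [K10 H1]] := ray_bound phi Hq.
have Hp : Rabs (- phi) = phi by rewrite Rabs_Ropp Rabs_pos_eq //; lra.
have [K2 [K20 H2]] := ray_bound (- phi) Hp.
have [K3 [K30 H3]] := arc_bound.
exists (Cmod (Cinv (Cmult (RtoC (2 * PI)) Ci)) * (K1 + K3 + K2)) => C E x SE.
have LE := proj1 SE.
have := H1 C E x SE; have := H2 C E x SE; have := H3 C E x SE.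
rewrite /contour_calculus.
set r2 := RInt_gen _ _ _; set r1 := RInt_gen _ _ _; set r3 := RInt _ _ _ => A3 A2 A1.
rewrite (linear_scal _ LE) norm_cscal !(linear_plus _ LE).
have T : norm (plus (plus (E (opp (r1 : H))) (E (r3 : H))) (E (r2 : H))) <= C * (K1 + K3 + K2) * norm x.
  apply: Rle_trans (norm_triangle _ _) _; apply: Rle_trans (Rplus_le_compat_r _ _ _ (norm_triangle _ _)) _.
  rewrite (linear_opp _ _ LE) opp_rscal norm_rscal Rabs_Ropp Rabs_R1 Rmult_1_l; lra.
apply: Rle_trans (Rmult_le_compat_l _ _ _ (Cmod_ge_0 _) T) _; lra.
Qed.

End Contour.

Theorem theorem4p1 :
  forall (H : HilbertSpace) (A : operator H) (T : R -> H -> H),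
    C0_semigroup T ->
    bounded_family T ->
    is_generator T (op_opp A) ->
    resolvent_set A (RtoC 0) ->
    forall alpha : R, 0 < alpha ->
      bounded_family
        (fun t x => op_exp (fun y => scal (RtoC (- t)) (op_inv A y))
                      (neg_power A alpha x)).
Proof.
move=> H A T SG [M0 TM0] GA R0 alpha a0.
(* The constants above compare powers of [M], which requires [1 <= M]. *)
set M := Rmax M0 1; have M1 : 1 <= M by exact: Rmax_r.
have TM t : 0 <= t -> forall x, norm (T t x) <= M * norm x.
  move=> t0 x; apply: Rle_trans (TM0 t t0 x) _.
  by apply: Rmult_le_compat_r; [exact: norm_nneg|exact: Rmax_l].
have [tn TN] := orbit_norm_exists T M TM.
have axis s : 0 <= s -> resolvent_set A (RtoC (- s)).
  move=> s0; case: (Rle_lt_or_eq_dec 0 s s0) => [sp|<-]; last by rewrite Ropp_0.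
  by apply: (resolvent_set_left_half_plane A T M SG M1 TM GA R0 tn TN); rewrite /Re /=; lra.
have [beta [b0 RF]] := shifted_resolvent_family A T M SG M1 TM GA R0.
rewrite /neg_power /sectorial_calculus.
(* The contour of the functional calculus is the one selected by [epsilon]; only its admissibility
   is known, and [contour_bound] asks for no more. *)
have AD := epsilon_spec (inhabits (0, 0)) _ (admissible_exists A T M SG M1 TM GA R0).
move: AD; set p := epsilon _ _ => AD.
have [K HK] := contour_bound A alpha (fst p) (snd p) a0 axis AD.
exists (decay_constant M beta * K) => t t0 x.
apply: HK.
have inv_eq y : op_inv A y = shifted_resolvent A 0 y.
  by rewrite op_inv_resolvent // /shifted_resolvent Ropp_0.
have L0 := resolvent_correct A _ R0.
have Linv : is_linear (op_inv A).
  apply: (is_linear_ext (fun y => resolvent A (RtoC 0) (opp y))) => [y|]; first by rewrite op_inv_resolvent.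
  exact: (is_linear_comp _ _ is_linear_opp (proj1 L0)).
split; last split.
- apply: op_exp_is_linear.
  by apply: (is_linear_comp _ _ Linv); apply: is_linear_scal_r => a b; exact: Cmult_comm.
- have E1 := exp_pos (beta ^ 2); have E2 := exp_pos beta; have E3 := exp_pos M.
  have M3 := pow_R1_Rle M 3 M1; have M5 := pow_R1_Rle M 5 M1.
  rewrite /decay_constant /smoothing_constant.
  have : 0 <= exp M * M by nra.
  move=> E4; apply: Rplus_le_le_0_compat; last by nra.
  by apply: Rmult_le_pos; [lra|nra].
- move=> s y s1.
  have -> : (fun y => scal (RtoC (- t)) (op_inv A y)) = (fun y => (- t) *r shifted_resolvent A 0 y).
    by apply: functional_extensionality => w; rewrite inv_eq.
  exact: (exp_resolvent_family_bound M beta).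
Qed.
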